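(* Let $D\in\{D_4,E_6,E_7,E_8\}$ and let $r$ be the rank of $D$ (so $r=4,6,7,8$ respectively). Assume that $q\in\mathbb{C}^*$ is not a root of unity. Then the Hochschild cohomology of the algebra $B(q)$ attached to $D$ is $$H^0(B(q))=\mathbb{C},\qquad H^1(B(q))=0,\qquad H^2(B(q))=\mathbb{C}^{r+1},\qquad H^i(B(q))=0\ \text{ for } i>2 .$$
   Context: To $D$ attach integers $m$ and $(d_1,\dots,d_m)$: for $D_4$, $m=4$ and $(2,2,2,2)$; for $E_6$, $m=3$ and $(3,3,3)$; for $E_7$, $m=3$ and $(2,4,4)$; for $E_8$, $m=3$ and $(2,3,6)$. (The affine Dynkin diagram of $D$ is a star with $m$ legs, the $k$-th leg having $d_k-1$ vertices besides the node.) For $q\in\mathbb{C}^*$, $B(q)$ is the unital associative $\mathbb{C}$-algebra generated by $T_1,\dots,T_m$ with defining relations $T_k^{d_k}=1$ ($k=1,\dots,m$) and $T_1T_2\cdots T_m=q$. $H^i(A)=H^i(A,A)$ denotes the Hochschild cohomology of the algebra $A$ with coefficients in $A$. *)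

(* Defs.v *)
From HB Require Import structures.
From mathcomp Require Import all_boot all_order all_algebra.
From mathcomp Require Import boolp classical_sets functions reals.
From mathcomp Require Import complex monalg.

Set Implicit Arguments.
Unset Strict Implicit.
Unset Printing Implicit Defensive.

Import GRing.Theory.

Local Open Scope ring_scope.

(* Unital associative K-algebras.  The library's [algType] excludes the zero *)
(* ring, so it could not carry a presented algebra before that algebra has    *)
(* been shown to be nonzero; no such restriction is made here.                *)
HB.mixin Record isAssocAlgebra (K : pzRingType) A of GRing.Lmodule K A := {
  amul : A -> A -> A;
  aone : A;
  amulA : associative amul;
  amul1x : left_id aone amul;
  amulx1 : right_id aone amul;
  amulPl : forall (c : K) (x y z : A),
    amul (c *: x + y) z = c *: amul x z + amul y z;
  amulPr : forall (c : K) (x y z : A),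
    amul x (c *: y + z) = c *: amul x y + amul x z
}.

#[short(type="assocAlgType")]
HB.structure Definition AssocAlgebra (K : pzRingType) :=
  {A of GRing.Lmodule K A & isAssocAlgebra K A}.

Definition lmod_iso (K : pzRingType) (U V : lmodType K) : Prop :=
  exists f : {linear U -> V}, bijective f.

Section LmodQuotient.
Variables (K : pzRingType) (V : lmodType K) (S : submodClosed V).

(* [submodClosed] does not inherit from the [zmodClosed] that [Quotient.quot] *)
(* expects.                                                                   *)
Definition submod_pred : {pred V} := S.

Fact submod_pred_zmod : zmod_closed submod_pred.
Proof.
split=> [|x y xS yS]; first exact: (@rpred0 V S).
by rewrite /submod_pred -[- y]scaleN1r; apply: rpredD => //; apply: rpredZ.
Qed.

HB.instance Definition _ := GRing.isZmodClosed.Build V submod_pred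
  submod_pred_zmod.

Definition lmod_quot := Quotient.quot submod_pred.

HB.instance Definition _ := GRing.Zmodule.on lmod_quot.

Definition lmod_pi (x : V) : lmod_quot := \pi_(Quotient.quot submod_pred)%qT x.

Lemma lmod_piP x y : (lmod_pi x = lmod_pi y) <-> (x - y \in S).
Proof.
rewrite (_ : (x - y \in S) = (lmod_pi x == lmod_pi y)).
  by split=> /eqP.
exact: (Quotient.idealrBE submod_pred x y).
Qed.

Lemma lmod_piE (u : lmod_quot) : lmod_pi (repr u) = u.
Proof. exact: reprK. Qed.

Lemma lmod_piB : {morph lmod_pi : x y / x - y}.
Proof. by move=> x y; rewrite /lmod_pi raddfB. Qed.

Lemma lmod_piD : {morph lmod_pi : x y / x + y}.
Proof. by move=> x y; rewrite /lmod_pi raddfD. Qed.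

Definition lmod_quot_scale (c : K) (u : lmod_quot) : lmod_quot :=
  lmod_pi (c *: repr u).

Lemma lmod_piZ c x : lmod_quot_scale c (lmod_pi x) = lmod_pi (c *: x).
Proof.
by apply/lmod_piP; rewrite -scalerBr rpredZ//; apply/lmod_piP/lmod_piE.
Qed.

Fact lmod_quot_scalerA a b u :
  lmod_quot_scale a (lmod_quot_scale b u) = lmod_quot_scale (a * b) u.
Proof. by rewrite -(lmod_piE u) !lmod_piZ scalerA. Qed.

Fact lmod_quot_scale1r : left_id 1 lmod_quot_scale.
Proof. by move=> u; rewrite -(lmod_piE u) lmod_piZ scale1r. Qed.

Fact lmod_quot_scalerDr : right_distributive lmod_quot_scale +%R.
Proof.
move=> c u v; rewrite -(lmod_piE u) -(lmod_piE v).
by rewrite -lmod_piD !lmod_piZ scalerDr lmod_piD.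
Qed.

Fact lmod_quot_scalerDl u : {morph lmod_quot_scale^~ u : a b / a + b}.
Proof. by move=> a b; rewrite -(lmod_piE u) !lmod_piZ scalerDl lmod_piD. Qed.

HB.instance Definition _ := GRing.Zmodule_isLmodule.Build K lmod_quot
  lmod_quot_scalerA lmod_quot_scale1r lmod_quot_scalerDr lmod_quot_scalerDl.

End LmodQuotient.

Section PresentedAlgebra.
Variables (K : pzRingType) (A : algType K).

Definition two_sided_ideal (I : set A) : Prop :=
  [/\ I 0, forall x y, I x -> I y -> I (x + y)
    & forall a x b, I x -> I (a * x * b)].

Variable rel : set A.

Definition gen_ideal : {pred A} :=
  fun x => `[< smallest two_sided_ideal rel x >].

Lemma gen_idealP : two_sided_ideal (smallest two_sided_ideal rel).
Proof.
split=> [I [[I0 _ _] _]//|x y xI yI I II|a x b xI I II].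
  by have [[_ ID _] _] := II; apply: ID; [apply: xI|apply: yI].
by have [[_ _ IM] _] := II; apply: IM; apply: xI.
Qed.

Lemma gen_idealM a x b : x \in gen_ideal -> a * x * b \in gen_ideal.
Proof.
by move=> /asboolP xI; apply/asboolP; case: gen_idealP => _ _; apply.
Qed.

Fact gen_ideal_submod : submod_closed gen_ideal.
Proof.
have [I0 ID IM] := gen_idealP.
split; first exact/asboolP.
move=> c x y /asboolP xI /asboolP yI; apply/asboolP.
have : smallest two_sided_ideal rel ((c *: 1) * x * 1) by exact: IM xI.
by rewrite mulr1 -scalerAl mul1r => cxI; exact: ID cxI yI.
Qed.

HB.instance Definition _ := GRing.isSubmodClosed.Build K A gen_ideal
  (GRing.submod_closed_semi gen_ideal_submod).

Definition alg_quot := lmod_quot gen_ideal.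

HB.instance Definition _ := GRing.Lmodule.on alg_quot.

Definition alg_pi (x : A) : alg_quot := lmod_pi gen_ideal x.

Definition alg_quot_mul (u v : alg_quot) : alg_quot :=
  alg_pi (repr u * repr v).

Lemma alg_piM x y : alg_quot_mul (alg_pi x) (alg_pi y) = alg_pi (x * y).
Proof.
apply/lmod_piP; set x' := repr _; set y' := repr _.
have xx' : x' - x \in gen_ideal by apply/lmod_piP/lmod_piE.
have yy' : y' - y \in gen_ideal by apply/lmod_piP/lmod_piE.
have -> : x' * y' - x * y = 1 * (x' - x) * y' + x * (y' - y) * 1.
  by rewrite mul1r mulr1 mulrBl mulrBr addrA subrK.
by rewrite rpredD// gen_idealM.
Qed.

Let alg_piK (u : alg_quot) : alg_pi (repr u) = u := lmod_piE u.

Fact alg_quot_mulrA : associative alg_quot_mul.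
Proof.
move=> u v w; rewrite -(alg_piK u) -(alg_piK v) -(alg_piK w).
by rewrite !alg_piM mulrA.
Qed.

Fact alg_quot_mul1r : left_id (alg_pi 1) alg_quot_mul.
Proof. by move=> u; rewrite -(alg_piK u) alg_piM mul1r. Qed.

Fact alg_quot_mulr1 : right_id (alg_pi 1) alg_quot_mul.
Proof. by move=> u; rewrite -(alg_piK u) alg_piM mulr1. Qed.

Fact alg_quot_mulrDl : left_distributive alg_quot_mul +%R.
Proof.
move=> u v w; rewrite -(alg_piK u) -(alg_piK v) -(alg_piK w).
by rewrite -[_ + _]lmod_piD !alg_piM mulrDl [LHS]lmod_piD.
Qed.

Fact alg_quot_mulrDr : right_distributive alg_quot_mul +%R.
Proof.
move=> u v w; rewrite -(alg_piK u) -(alg_piK v) -(alg_piK w).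
by rewrite -[_ + _]lmod_piD !alg_piM mulrDr [LHS]lmod_piD.
Qed.

HB.instance Definition _ := GRing.Zmodule_isPzRing.Build alg_quot
  alg_quot_mulrA alg_quot_mul1r alg_quot_mulr1
  alg_quot_mulrDl alg_quot_mulrDr.

Fact alg_quot_mulPl (c : K) (u v w : alg_quot) :
  (c *: u + v) * w = c *: (u * w) + v * w.
Proof.
rewrite mulrDl; congr (_ + _); rewrite -(alg_piK u) -(alg_piK w).
rewrite [c *: _]lmod_piZ [LHS]alg_piM -scalerAl -[LHS]lmod_piZ.
exact: (congr1 (lmod_quot_scale c) (esym (alg_piM _ _))).
Qed.

Fact alg_quot_mulPr (c : K) (u v w : alg_quot) :
  u * (c *: v + w) = c *: (u * v) + u * w.
Proof.
rewrite mulrDr; congr (_ + _); rewrite -(alg_piK u) -(alg_piK v).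
rewrite [c *: _]lmod_piZ [LHS]alg_piM -scalerAr -[LHS]lmod_piZ.
exact: (congr1 (lmod_quot_scale c) (esym (alg_piM _ _))).
Qed.

HB.instance Definition _ := isAssocAlgebra.Build K alg_quot
  (@mulrA alg_quot) (@mul1r alg_quot) (@mulr1 alg_quot)
  alg_quot_mulPl alg_quot_mulPr.

End PresentedAlgebra.

Section FreeAlgebra.
Variables (K : comNzRingType) (I : choiceType).

(* The monoid algebra of the free monoid on I. *)
Definition free_alg := {malg K[{fmonom I}]}.

HB.instance Definition _ := GRing.Lalgebra.on free_alg.

Fact free_alg_scalerAr (c : K) (x y : free_alg) : c *: (x * y) = x * (c *: y).
Proof.
have central : x * c%:MP = c%:MP * x.
  rewrite mul_malgC malgM_def fgmulgU malgZ_def.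
  by apply: eq_bigr => k _; rewrite mulm1 mulrC.
by rewrite -!mul_malgC mulrA -central mulrA.
Qed.

HB.instance Definition _ := GRing.Lalgebra_isAlgebra.Build K free_alg
  free_alg_scalerAr.

Definition free_gen (i : I) : free_alg := << fmu i >>.

End FreeAlgebra.

Section Hochschild.
Variables (K : comNzRingType) (A : assocAlgType K).

Lemma amulDl (x y z : A) : amul (x + y) z = amul x z + amul y z.
Proof. by rewrite -[x]scale1r amulPl !scale1r. Qed.

Lemma amulDr (x y z : A) : amul x (y + z) = amul x y + amul x z.
Proof. by rewrite -[y]scale1r amulPr !scale1r. Qed.

Lemma amul0x (x : A) : amul 0 x = 0.
Proof. by apply: (addrI (amul 0 x)); rewrite -amulDl !addr0. Qed.

Lemma amulx0 (x : A) : amul x 0 = 0.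
Proof. by apply: (addrI (amul x 0)); rewrite -amulDr !addr0. Qed.

Lemma amulZl c (x y : A) : amul (c *: x) y = c *: amul x y.
Proof. by rewrite -[c *: x]addr0 amulPl amul0x addr0. Qed.

Lemma amulZr c (x y : A) : amul x (c *: y) = c *: amul x y.
Proof. by rewrite -[c *: y]addr0 amulPr amulx0 addr0. Qed.

(* A linear map from the n-th tensor power of A to A is represented by the    *)
(* corresponding multilinear function of n arguments.                         *)
Definition multilinear n (f : ('I_n -> A) -> A) : Prop :=
  forall (i : 'I_n) (a : 'I_n -> A) (c : K) (x y : A),
    f [eta a with i |-> c *: x + y]
    = c *: f [eta a with i |-> x] + f [eta a with i |-> y].

(* (a_0, ..., a_n) |-> (a_0, ..., a_i a_(i+1), ..., a_n) *)
Definition contract n (i : 'I_n) (a : 'I_n.+1 -> A) : 'I_n -> A := fun j =>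
  if (j < i)%N then a (widen_ord (leqnSn n) j)
  else if j == i then amul (a (widen_ord (leqnSn n) j)) (a (lift ord0 j))
  else a (lift ord0 j).

Definition hoch_d n (f : ('I_n -> A) -> A) : ('I_n.+1 -> A) -> A := fun a =>
  amul (a ord0) (f (fun j => a (lift ord0 j)))
  + \sum_(i < n) (-1) ^+ i.+1 *: f (contract i a)
  + (-1) ^+ n.+1 *: amul (f (fun j => a (widen_ord (leqnSn n) j))) (a ord_max).

Lemma hoch_dP n (c : K) (f g : ('I_n -> A) -> A) :
  hoch_d (c *: f + g) = c *: hoch_d f + hoch_d g.
Proof.
apply: funext => a; rewrite /hoch_d !fctE amulPr amulPl.
have -> : \sum_(i < n) (-1) ^+ i.+1 *: (c *: f + g) (contract i a)
    = c *: \sum_(i < n) (-1) ^+ i.+1 *: f (contract i a)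
      + \sum_(i < n) (-1) ^+ i.+1 *: g (contract i a).
  rewrite scaler_sumr -big_split; apply: eq_bigr => i _ /=.
  by rewrite scalerDr !scalerA mulrC.
rewrite !scalerDr [RHS]addrACA; congr (_ + _); first exact: addrACA.
by rewrite !scalerA mulrC.
Qed.

Lemma hoch_d0 n : hoch_d (0 : ('I_n -> A) -> A) = 0.
Proof.
apply: (addrI (hoch_d (0 : ('I_n -> A) -> A))).
by rewrite -[X in X + _]scale1r -hoch_dP scaler0 !addr0.
Qed.

Let linfun_for (L : A -> A) :=
  forall (c : K) (x y : A), L (c *: x + y) = c *: L x + L y.

Let contract_upd n (i : 'I_n) (k : 'I_n.+1) (a : 'I_n.+1 -> A) :
  exists k' : 'I_n, exists2 L : A -> A, linfun_for L &
    forall x, contract i [eta a with k |-> x] =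
      [eta contract i a with k' |-> L x].
Proof.
have kn := ltn_ord k; have iN := ltn_ord i.
case: (leqP k i) => ki.
  have kltn : (k < n)%N by apply: leq_ltn_trans ki iN.
  exists (Ordinal kltn).
  exists (fun x => if k == i :> nat then amul x (a (lift ord0 i)) else x).
    by move=> c x y; case: eqP => _; rewrite ?amulPl.
  move=> x; apply: funext => j; rewrite /contract /= -!val_eqE /= /bump /=.
  rewrite add1n; case: (ltngtP j i) => ji.
  - by case: (eqVneq (nat_of_ord j) k) => // jk; rewrite -jk ltn_eqF.
  - rewrite !gtn_eqF//; first exact: leq_ltn_trans ki ji.
    by rewrite ltnS; apply: ltnW; exact: leq_ltn_trans ki ji.
  - rewrite [j.+1 == k]gtn_eqF; last by rewrite ltnS ji.
    rewrite ji eq_sym; case: eqP => // _; congr (amul _ (a _)).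
    exact/val_inj/(congr1 S).
have kltn : (k.-1 < n)%N by rewrite -ltnS prednK// (leq_ltn_trans _ ki).
have k0 : (0 < k)%N by rewrite (leq_ltn_trans _ ki).
exists (Ordinal kltn).
exists (fun x => if k.-1 == i :> nat
                 then amul (a (widen_ord (leqnSn n) i)) x else x).
  by move=> c x y; case: eqP => _; rewrite ?amulPr.
move=> x; apply: funext => j; rewrite /contract /= -!val_eqE /= /bump /=.
rewrite add1n -[in j.+1 == k](prednK k0) eqSS; case: (ltngtP j i) => ji.
- rewrite !ltn_eqF//; last by rewrite (ltn_trans ji).
  by rewrite -ltnS prednK// (leq_ltn_trans _ ki).
- by case: (eqVneq (nat_of_ord j) k.-1) => // jk; rewrite -jk gtn_eqF.
- rewrite ltn_eqF; last by rewrite ji.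
  rewrite ji eq_sym; case: eqP => // _; congr (amul (a _) _).
  exact/val_inj.
Qed.

Lemma hoch_d_multilinear n (f : ('I_n -> A) -> A) :
  multilinear f -> multilinear (hoch_d f).
Proof.
move=> mf k a c x y; rewrite /hoch_d.
pose T1 z := let b := [eta a with k |-> z] in
  amul (b ord0) (f (fun j => b (lift ord0 j))).
pose T2 z := \sum_(i < n) (-1) ^+ i.+1 *: f (contract i [eta a with k |-> z]).
pose T3 z := let b := [eta a with k |-> z] in
  (-1) ^+ n.+1 *: amul (f (fun j => b (widen_ord (leqnSn n) j))) (b ord_max).
suff [l1 l2 l3] : [/\ linfun_for T1, linfun_for T2 & linfun_for T3].
  rewrite -!/(T1 _) -!/(T2 _) -!/(T3 _).
  rewrite l1 l2 l3 !scalerDr [RHS]addrACA; congr (_ + _).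
  exact: addrACA.
split.
- rewrite /T1 => d z t; case: (unliftP ord0 k) => [k'|] ->.
  + have e w : (fun j => [eta a with lift ord0 k' |-> w] (lift ord0 j))
             = [eta (fun j => a (lift ord0 j)) with k' |-> w].
      apply: funext => j /=.
      by rewrite (inj_eq (@lift_inj _ ord0)).
    by rewrite !e mf amulPr.
  + have e w : (fun j => [eta a with ord0 |-> w] (lift ord0 j))
             = fun j : 'I_n => a (lift ord0 j) by apply: funext.
    by rewrite !e /= amulPl.
- move=> d z t; rewrite /T2 scaler_sumr -big_split; apply: eq_bigr => i _ /=.
  have [k' [L lL e]] := contract_upd i k a.
  by rewrite !e lL mf scalerDr !scalerA mulrC.
- move=> d z t; rewrite /T3 /= scalerA -[d * _]mulrC -scalerA -scalerDr.
  congr (_ *: _); case: (unliftP ord_max k) => [k'|] ->.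
  + have e w : (fun j => [eta a with lift ord_max k' |-> w]
                           (widen_ord (leqnSn n) j))
             = [eta (fun j => a (widen_ord (leqnSn n) j)) with k' |-> w].
      apply: funext => j /=.
      by rewrite -!val_eqE /= /bump leqNgt ltn_ord.
    by rewrite !e mf /= (negPf (neq_lift ord_max k')) amulPl.
  + have e w : (fun j => [eta a with ord_max |-> w] (widen_ord (leqnSn n) j))
             = fun j : 'I_n => a (widen_ord (leqnSn n) j).
      by apply: funext => j /=; rewrite -val_eqE /= ltn_eqF.
    by rewrite !e /= eqxx amulPr.
Qed.

Let res n (b : nat -> A) : 'I_n -> A := fun j => b j.
Let ncontract (i : nat) (b : nat -> A) : nat -> A := fun j =>
  if (j < i)%N then b j else if j == i then amul (b j) (b j.+1) else b j.+1.

Let contract_res n (i : 'I_n) b :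
  contract i (@res n.+1 b) = @res n (ncontract i b).
Proof.
apply: funext => j; rewrite /contract /res /ncontract /=.
by rewrite -val_eqE /=.
Qed.

Let hoch_d_res n (f : ('I_n -> A) -> A) b :
  hoch_d f (@res n.+1 b) = amul (b 0) (f (@res n (b \o S)))
  + \sum_(i < n) (-1) ^+ i.+1 *: f (@res n (ncontract i b))
  + (-1) ^+ n.+1 *: amul (f (@res n b)) (b n).
Proof.
rewrite /hoch_d; congr (_ + _ + _).
Qed.

Let ncontract_comm i j b : (i <= j)%N ->
  ncontract j (ncontract i b) = ncontract i (ncontract j.+1 b).
Proof.
move=> ij; apply: funext => k; rewrite /ncontract !ltnS !eqSS.
case: (ltngtP k i) => ki.
- by rewrite (leq_trans ki ij) (ltnW (leq_trans ki ij)).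
- have -> : (k.+1 < i)%N = false by rewrite ltnNge (leq_trans (ltnW ki)).
  by rewrite [k.+1 == i]gtn_eqF// ltnS ltnW.
- rewrite ki; case: (ltngtP i j) ij => // _ _.
  by rewrite ltnNge leqnSn /= gtn_eqF// amulA.
Qed.

Let altsum_eq0 n (s : nat -> nat -> A) :
  (forall i j, (i <= j)%N -> s j.+1 i = - s i j) ->
  \sum_(i < n.+1) \sum_(j < n) s i j = 0.
Proof.
move=> sE; pose hi (i : nat) := \sum_(j < n | (i <= j)%N) s i j.
pose lo (i : nat) := \sum_(j < n | (j < i)%N) s i j.
have -> : \sum_(i < n.+1) \sum_(j < n) s i j
    = \sum_(i < n.+1) hi i + \sum_(i < n.+1) lo i.
  rewrite -big_split; apply: eq_bigr => i _ /=.
  rewrite (bigID (fun j : 'I_n => (i <= j)%N)) /=; congr (_ + _).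
  by apply: eq_bigl => j; rewrite ltnNge.
rewrite [X in X + _]big_ord_recr [X in _ + X]big_ord_recl /=.
have -> : hi n = 0 by apply: big_pred0 => j; rewrite leqNgt ltn_ord.
have -> : lo 0%N = 0 by apply: big_pred0 => j.
rewrite addr0 add0r.
suff -> : \sum_(i < n) lo (bump 0 i) = - \sum_(i < n) hi i by rewrite subrr.
rewrite /lo /hi [in RHS](exchange_big_dep predT) //= -sumrN.
apply: eq_bigr => i _; rewrite -sumrN; apply: eq_big => j.
  by rewrite ltnS.
by rewrite ltnS; exact: sE.
Qed.

Lemma hoch_dd n (f : ('I_n -> A) -> A) : hoch_d (hoch_d f) = 0.
Proof.
apply: funext => a.
have -> : a = @res n.+2 (fun k => a (inord k)).
  by apply: funext => j; rewrite /res inord_val.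
move: (fun k => a (inord k)) => b {a}; rewrite hoch_d_res.
pose P := amul (b 0) (amul (b 1) (f (@res n (b \o S \o S))))
  + \sum_(j < n) (-1) ^+ j.+1 *: amul (b 0) (f (@res n (ncontract j (b \o S)))).
pose Z := (-1) ^+ n.+1 *: amul (b 0) (amul (f (@res n (b \o S))) (b n.+1)).
pose V := \sum_(i < n) ((-1) ^+ n.+1 * (-1) ^+ i.+1) *:
     amul (f (@res n (ncontract i b))) (b n.+1)
  + ((-1) ^+ n.+1 * (-1) ^+ n.+1) *: amul (f (@res n b)) (amul (b n) (b n.+1)).
have -> : amul (b 0) (hoch_d f (@res n.+1 (b \o S))) = P + Z.
  rewrite hoch_d_res !amulDr amulZr /P /Z; congr (_ + _ + _).
  rewrite (big_morph _ (amulDr _) (amulx0 _)).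
  by apply: eq_bigr => i _; rewrite amulZr.
have -> : (-1) ^+ n.+2 *: amul (hoch_d f (@res n.+1 b)) (b n.+1) = - (Z + V).
  rewrite hoch_d_res !amulDl exprS mulN1r scaleNr !scalerDr -addrA; congr (- _).
  congr (_ + _); first by rewrite /Z amulA.
  rewrite /V; congr (_ + _); last by rewrite amulZl scalerA amulA.
  rewrite (big_morph (amul^~ (b n.+1)) (fun x y => amulDl x y _) (amul0x _)).
  rewrite scaler_sumr.
  by apply: eq_bigr => i _; rewrite amulZl scalerA.
suff -> : \sum_(i < n.+1) (-1) ^+ i.+1 *: hoch_d f (@res n.+1 (ncontract i b))
    = - P + V by rewrite addrACA subrr add0r subrr.
under eq_bigr => i _ do rewrite hoch_d_res !scalerDr.
rewrite !big_split /=.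
set Q2 := (X in _ + X + _).
have -> : Q2 = 0.
  pose s i j := ((-1) ^+ i.+1 * (-1) ^+ j.+1) *:
    f (@res n (ncontract j (ncontract i b))).
  rewrite /Q2 -[RHS](@altsum_eq0 n s).
    apply: eq_bigr => i _; rewrite scaler_sumr.
    by apply: eq_bigr => j _; rewrite scalerA.
  move=> i j ij; rewrite /s -ncontract_comm// -scaleNr; congr (_ *: _).
  by rewrite [_ ^+ j.+2]exprS mulN1r mulNr mulrC.
rewrite addr0; congr (_ + _).
  rewrite big_ord_recl /= expr1 scaleN1r /P opprD; congr (_ + _).
    by rewrite -amulA.
  rewrite -sumrN; apply: eq_bigr => i _.
  by rewrite /bump leq0n add1n exprS mulN1r scaleNr.
rewrite big_ord_recr /= /V; congr (_ + _).
  apply: eq_bigr => i _; rewrite scalerA mulrC; congr (_ *: amul _ _).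
  by rewrite /ncontract ltnNge ltnW//= gtn_eqF.
rewrite scalerA; congr (_ *: amul (f _) _).
  by apply: funext => j; rewrite /res /ncontract ltn_ord.
by rewrite /ncontract ltnn eqxx.
Qed.

Definition cocycle n : {pred ('I_n -> A) -> A} :=
  fun f => `[< multilinear f /\ hoch_d f = 0 >].

Fact cocycle_submod n : submod_closed (@cocycle n).
Proof.
split.
  by apply/asboolP; split; [move=> *; rewrite scaler0 addr0|exact: hoch_d0].
move=> c f g /asboolP[mf df] /asboolP[mg dg]; apply/asboolP; split.
  move=> i a d x y; rewrite !fctE mf mg !scalerDr [RHS]addrACA.
  by rewrite !scalerA mulrC.
by rewrite hoch_dP df dg scaler0 addr0.
Qed.

HB.instance Definition _ n := GRing.isSubmodClosed.Build K (('I_n -> A) -> A)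
  (@cocycle n) (GRing.submod_closed_semi (@cocycle_submod n)).

Definition cocycles n := {f : ('I_n -> A) -> A | f \in @cocycle n}.

HB.instance Definition _ n := SubChoice.on (cocycles n).
HB.instance Definition _ n := [SubChoice_isSubLmodule of cocycles n by <:].

Definition is_coboundary n : (('I_n -> A) -> A) -> Prop :=
  match n with
  | 0 => fun f => f = 0
  | m.+1 => fun f => exists2 g : ('I_m -> A) -> A, multilinear g & f = hoch_d g
  end.

Lemma coboundary_cocycle n (f : ('I_n -> A) -> A) :
  is_coboundary f -> f \in @cocycle n.
Proof.
case: n f => [|n] f /=; first by move=> ->; exact: (@rpred0 _ (@cocycle 0)).
move=> [g mg ->]; apply/asboolP; split; first exact: hoch_d_multilinear.
exact: hoch_dd.
Qed.

Definition coboundary n : {pred cocycles n} :=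
  fun f => `[< is_coboundary (\val f) >].

Fact coboundary_submod n : submod_closed (@coboundary n).
Proof.
split.
  apply/asboolP; case: n => [|n] //=; exists 0 => [i a c x y|].
    by rewrite scaler0 addr0.
  by rewrite hoch_d0.
move=> c f g /asboolP cf /asboolP cg; apply/asboolP.
rewrite linearP; case: n f g cf cg => [|n] f g /=.
  by move=> -> ->; rewrite scaler0 addr0.
move=> [f' mf ->] [g' mg ->]; exists (c *: f' + g'); last by rewrite hoch_dP.
move=> i a d x y; rewrite !fctE mf mg !scalerDr [RHS]addrACA.
by rewrite !scalerA mulrC.
Qed.

HB.instance Definition _ n := GRing.isSubmodClosed.Build K (cocycles n)
  (@coboundary n) (GRing.submod_closed_semi (@coboundary_submod n)).

End Hochschild.

(* Cohomology of the Hochschild cochain complex with coefficients in A; over  *)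
(* a field K this is the Ext over the enveloping algebra of A.                *)
Definition HH (K : comNzRingType) (A : assocAlgType K) (n : nat) : lmodType K :=
  lmod_quot (@coboundary K A n).

Inductive diagram := D4 | E6 | E7 | E8.

Definition dynkin_rank (D : diagram) : nat :=
  match D with D4 => 4 | E6 => 6 | E7 => 7 | E8 => 8 end.

(* The affine Dynkin diagram is a star whose k-th leg has d_k - 1 vertices    *)
(* besides the node; these are the d_k.                                       *)
Definition leg_orders (D : diagram) : seq nat :=
  match D with
  | D4 => [:: 2; 2; 2; 2]
  | E6 => [:: 3; 3; 3]
  | E7 => [:: 2; 4; 4]
  | E8 => [:: 2; 3; 6]
  end%N.

Definition nlegs (D : diagram) : nat := size (leg_orders D).

Definition leg_order (D : diagram) (k : 'I_(nlegs D)) : nat :=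
  nth 0%N (leg_orders D) k.

Section GDAHA.
Variables (K : comNzRingType) (D : diagram) (q : K).

Let T (k : 'I_(nlegs D)) : free_alg K 'I_(nlegs D) := free_gen K k.

Definition B_relators : set (free_alg K 'I_(nlegs D)) :=
  [set x | (exists k, x = T k ^+ leg_order k - 1)
           \/ x = \prod_(k < nlegs D) T k - q *: 1]%classic.

Definition B : assocAlgType K := alg_quot B_relators.

End GDAHA.

(* Main.v *)
Require Import Defs.
From HB Require Import structures.
From mathcomp Require Import all_boot all_order all_algebra.
From mathcomp Require Import finmap boolp functions classical_sets reals complex monalg.
From mathcomp Require Import zify ring.

(** The algebra is a twisted group algebra.  Up to scalars the star relations
    are those of a plane crystallographic group, the lattice [Z^2] extended by
    a cyclic group of rotations of order 2, 3, 4 or 6; the legs are rotations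
    about the cone points of the quotient of the plane.  Choose [z] with
    [z ^ 24 = q].  The star relations turn suitable products of the generators
    into two Weyl elements [X], [Y] with [X Y = z ^ (2 L) Y X] and a rotation
    [rho] normalizing them ([D4_lift] to [E8_lift]), so the elements
    [z ^ - mu (v, k) W v rho ^ k] span, where [W v] is the Weyl ordering of
    [X ^ v.1 Y ^ v.2]; conversely, reading words in the central extension of
    the group by the powers of [z] separates them ([presented_basis],
    [star_basis]).  The powers [z ^ - mu] are chosen so that conjugation
    permutes the basis elements that are not translations, without scalars, and
    multiplies the basis element of a translation [v] by a power of [z] that is
    trivial for all conjugating translations only if [v = 0]
    ([lattice_action]); this is where [q] must not be a root of unity.

    Hochschild cochains of a twisted group algebra are equivariant homogeneous
    cochains on the group, the group acting by conjugation ([hom_d],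
    [hom_dehom]).  A group of motions of the plane has cohomological dimension
    two over a field in which the order of the rotations is invertible, and
    this is made explicit: a point, a pair and a triple of group elements are
    replaced by the average, over all rotated frames, of a point, a lattice
    path and a lattice rectangle ([lattice_system]).  The rectangles of four
    points cancel, so the prism homotopy contracts everything above degree two
    ([HH_ge3_eq0]), and presents a cocycle of degree one or two through its
    values on the two translations or on the unit square.

    In degree zero, a central element has finite support, but conjugation by
    translations has infinite orbits outside the translations and nontrivial
    eigenvalues on the nonzero translations: only scalars remain ([HH0_iso]).
    In degree one, dividing by [X - 1] and [Y - 1] shows that, up to
    coboundaries, the values on the translations are scalars
    ([lattice_H1]); the average over all frames of such a homomorphism is zero,
    because the rotations of a vector add up to zero ([HH1_eq0]).  In degree
    two, a cocycle amounts to its value on the fundamental cycle of the torus,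
    modulo commutators with translations and averaged over the rotations
    ([theta], [theta_area], [area_boundary]).  The quotient is detected by the
    traces supported on conjugacy classes of torsion elements
    ([HH2_iso_classes]).  These classes are the identity and, for a leg of order
    [d], the [d - 1] nontrivial powers of its generator, which makes
    [1 + \sum_k (d_k - 1)], that is [r + 1], of them. *)

Set Implicit Arguments.
Unset Strict Implicit.
Unset Printing Implicit Defensive.

Import GRing.Theory.

Local Open Scope ring_scope.

Local Notation "x ** y" := (amul x y) (at level 40, left associativity).

(** * Linear extension *)

Section LinearExtension.
Variables (K : comNzRingType) (G : choiceType) (V : lmodType K) (f : G -> V).

Definition lext (x : {malg K[G]}) : V := \sum_(k <- msupp x) x@_k *: f k.

Lemma lextEw (d : {fset G}) (x : {malg K[G]}) :
  (msupp x `<=` d)%fset -> lext x = \sum_(k <- d) x@_k *: f k.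
Proof.
move=> sd; apply/big_fset_incl => // k _ /mcoeff_outdom ->.
by rewrite scale0r.
Qed.

Fact lext_linear : linear lext.
Proof.
move=> c x y; pose d := (msupp x `|` msupp y)%fset.
have sx : (msupp x `<=` d)%fset by rewrite fsubsetUl.
have sy : (msupp y `<=` d)%fset by rewrite fsubsetUr.
have sxy : (msupp (c *: x + y) `<=` d)%fset.
  apply: fsubset_trans (msuppD_le _ _) _.
  by rewrite fsubUset sy andbT (fsubset_trans (msuppZ_le _ _)).
rewrite (lextEw sx) (lextEw sy) (lextEw sxy) scaler_sumr -big_split.
by apply: eq_bigr => k _ /=; rewrite mcoeffD mcoeffZ scalerDl scalerA.
Qed.

HB.instance Definition _ :=
  GRing.isLinear.Build K {malg K[G]} V *:%R lext lext_linear.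

Lemma lextU k : lext << k >> = f k.
Proof. by rewrite /lext msuppU oner_eq0 big_seq_fset1 mcoeffUU scale1r. Qed.

Lemma lext_scaleU c k : lext (c *: << k >>) = c *: f k.
Proof. by rewrite linearZ /= lextU. Qed.

End LinearExtension.

Lemma malg_ind (K : comNzRingType) (G : choiceType) (P : {malg K[G]} -> Prop) :
  P 0 -> (forall c x y, P x -> P y -> P (c *: x + y)) ->
  (forall k, P << k >>) -> forall x, P x.
Proof.
move=> P0 PD PU x; rewrite (monalgE x); elim/big_rec: _ => // k y _ Py.
rewrite (_ : << x@_k *g k >> = x@_k *: << k >>).
  exact: PD.
by apply/malgP => k'; rewrite mcoeffZ !mcoeffU mulr_natr.
Qed.

(** * Twisted group algebras *)

(** A basis indexed by a group and multiplicative up to scalars.  Being a basis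
    is expressed by a coordinate map: its injectivity makes the family span,
    and [tb_coordU] makes it free. *)
Record twisted_basis (K : fieldType) (A : assocAlgType K) (G : groupType) :=
  TwistedBasis {
  tb :> G -> A;
  tb_coord : {linear A -> {malg K[G]}};
  tb_cocycle : G -> G -> K;
  tb_coordU : forall g, tb_coord (tb g) = << g >>;
  tb_coord_inj : injective tb_coord;
  tb_cocycle_neq0 : forall g h, tb_cocycle g h != 0;
  tb1 : tb 1%g = (aone : A);
  tbM : forall g h, tb g ** tb h = tb_cocycle g h *: tb (g * h)%g
}.

Section TwistedTheory.
Variables (K : fieldType) (A : assocAlgType K) (G : groupType).
Variable (u : twisted_basis A G).
Implicit Types (x y : A) (g h : G).

Local Notation co := (tb_coord u).
Local Notation c := (tb_cocycle u).

(** The inverse of [u g]; locked because its scalar cancels in every use. *)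
Definition tbi g : A := locked ((c g^-1%g g)^-1 *: u g^-1%g).

Lemma tbVb g : tbi g ** u g = (aone : A).
Proof. by rewrite /tbi -lock amulZl tbM scalerA mulVf ?tb_cocycle_neq0// scale1r mulVg tb1. Qed.

Lemma tbbV g : u g ** tbi g = (aone : A).
Proof.
have e : u g ** ((c g g^-1%g)^-1 *: u g^-1%g) = (aone : A).
  by rewrite amulZr tbM scalerA mulVf ?tb_cocycle_neq0// scale1r mulgV tb1.
rewrite -[RHS]e; congr (_ ** _); rewrite -[LHS]amulx1 -e amulA tbVb.
by rewrite amul1x.
Qed.

Lemma tbKV g x : u g ** (tbi g ** x) = x.
Proof. by rewrite amulA tbbV amul1x. Qed.
Lemma tbVK g x : tbi g ** (u g ** x) = x.
Proof. by rewrite amulA tbVb amul1x. Qed.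

Lemma tbME g h : u (g * h)%g = (c g h)^-1 *: (u g ** u h).
Proof. by rewrite tbM scalerA mulVf ?tb_cocycle_neq0// scale1r. Qed.

Lemma tbi_uniq g x : x ** u g = (aone : A) -> tbi g = x.
Proof. by move=> xg; rewrite -[LHS]amul1x -xg -amulA tbbV amulx1. Qed.

Lemma tbiM g h : tbi (g * h)%g = c g h *: (tbi h ** tbi g).
Proof.
apply: tbi_uniq; rewrite tbME amulZl amulZr scalerA mulfV ?tb_cocycle_neq0//.
by rewrite scale1r -amulA tbVK tbVb.
Qed.

Lemma tbi1 : tbi 1%g = (aone : A).
Proof. by apply: tbi_uniq; rewrite tb1 amulx1. Qed.

(** The scalars of the cocycle cancel in a conjugation, which is why [G]
    itself, and not an extension of it, acts on [A]. *)
Definition ad g x : A := u g ** x ** tbi g.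

Fact ad_linear g : linear (ad g).
Proof. by move=> k x y; rewrite /ad amulPr amulPl. Qed.
HB.instance Definition _ g :=
  GRing.isLinear.Build K A A *:%R (ad g) (ad_linear g).

Lemma ad1 x : ad 1%g x = x.
Proof. by rewrite /ad tb1 tbi1 amul1x amulx1. Qed.

Lemma adM g h x : ad (g * h)%g x = ad g (ad h x).
Proof.
rewrite /ad tbME tbiM !amulZl amulZr scalerA mulVf ?tb_cocycle_neq0//.
by rewrite scale1r !amulA.
Qed.

Lemma adK g x : ad g^-1%g (ad g x) = x.
Proof. by rewrite -adM mulVg ad1. Qed.

Lemma tb_ind (P : A -> Prop) :
  P 0 -> (forall k x y, P x -> P y -> P (k *: x + y)) ->
  (forall g, P (u g)) -> forall x, P x.
Proof.
move=> P0 PD PU x.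
have bij : x = lext u (co x).
  apply: (@tb_coord_inj _ _ _ u).
  move: (co x); apply: (@malg_ind K G) => [|k y z ey ez|g].
  - by rewrite !linear0.
  - by rewrite !linearP -ey -ez.
  - by rewrite lextU tb_coordU.
rewrite bij; move: (co x); apply: (@malg_ind K G) => [|k y z|g].
- by rewrite linear0.
- by rewrite linearP; exact: PD.
- by rewrite lextU.
Qed.

Lemma tb_lin_eq (V : lmodType K) (f1 f2 : {linear A -> V}) :
  (forall g, f1 (u g) = f2 (u g)) -> f1 =1 f2.
Proof.
move=> e; apply: tb_ind => [|k x y ex ey|//]; first by rewrite !linear0.
by rewrite !linearP ex ey.
Qed.

(** ** Multilinear functions *)

Definition fcons n (x : A) (a : 'I_n -> A) : 'I_n.+1 -> A :=
  fun i => oapp a x (unlift ord0 i).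

Lemma fcons0 n x (a : 'I_n -> A) : fcons x a ord0 = x.
Proof. by rewrite /fcons unlift_none. Qed.
Lemma fconsS n x (a : 'I_n -> A) i : fcons x a (lift ord0 i) = a i.
Proof. by rewrite /fcons liftK. Qed.
Lemma fcons_eta n (a : 'I_n.+1 -> A) :
  fcons (a ord0) (fun i => a (lift ord0 i)) = a.
Proof.
by apply: funext => i; case: (unliftP ord0 i) => [j|] ->;
  rewrite ?fconsS ?fcons0.
Qed.

Lemma multilinear_head n (f : ('I_n.+1 -> A) -> A) t k x y : multilinear f ->
  f (fcons (k *: x + y) t) = k *: f (fcons x t) + f (fcons y t).
Proof.
move=> /(_ ord0 (fcons 0 t) k x y).
have e z : [eta fcons 0 t with ord0 |-> z] = fcons z t :> ('I_n.+1 -> A).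
  apply: funext => i /=; case: (unliftP ord0 i) => [j|] ->.
    by rewrite !fconsS.
  by rewrite eqxx fcons0.
by rewrite !e.
Qed.

Lemma multilinear_tail n (f : ('I_n.+1 -> A) -> A) x : multilinear f ->
  multilinear (fun t => f (fcons x t)).
Proof.
move=> mf i a k y z; have := mf (lift ord0 i) (fcons x a) k y z.
have e w : [eta fcons x a with lift ord0 i |-> w]
           = fcons x [eta a with i |-> w] :> ('I_n.+1 -> A).
  apply: funext => j /=; case: (unliftP ord0 j) => [j'|] ->.
    by rewrite !fconsS (inj_eq (@lift_inj _ ord0)).
  by rewrite !fcons0.
by rewrite !e.
Qed.

Lemma multilinear_eq n (f1 f2 : ('I_n -> A) -> A) :
  multilinear f1 -> multilinear f2 ->
  (forall g : 'I_n -> G, f1 (u \o g) = f2 (u \o g)) -> f1 = f2.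
Proof.
elim: n f1 f2 => [|n IHn] f1 f2 m1 m2 e.
  apply: funext => a; suff -> : a = u \o (fun=> 1%g) by exact: e.
  by apply: funext => -[].
apply: funext => a; rewrite -(fcons_eta a).
move: (a ord0) (fun i => a _) => x t {a}.
elim/tb_ind: x => [|k x y ex ey|g].
- have z (f : ('I_n.+1 -> A) -> A) : multilinear f -> f (fcons 0 t) = 0.
    move=> mf; have := multilinear_head t 1 0 0 mf.
    by rewrite scaler0 addr0 scale1r => /esym/(canRL (addrK _)) ->; rewrite subrr.
  by rewrite !z.
- by rewrite !multilinear_head// ex ey.
- have := IHn _ _ (multilinear_tail (u g) m1) (multilinear_tail (u g) m2).
  move=> /(_ _)/(congr1 (@^~ t)); apply => h.
  have -> : fcons (u g) (u \o h) = u \o (fun i => oapp h g (unlift ord0 i)).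
    by apply: funext => i; rewrite /fcons /=; case: unlift.
  exact: e.
Qed.

Lemma multilinear_scale n (f : ('I_n -> A) -> A) (k : 'I_n -> K) a :
  multilinear f -> f (fun i => k i *: a i) = (\prod_i k i) *: f a.
Proof.
elim: n f k a => [|n IHn] f k a mf.
  rewrite big_ord0 scale1r; congr f; by apply: funext => -[].
rewrite -[LHS](congr1 f (fcons_eta _)) -[in RHS](fcons_eta a).
rewrite -[k _ *: _]addr0 multilinear_head// (_ : f (fcons 0 _) = 0).
  rewrite addr0 big_ord_recl -scalerA; congr (_ *: _).
  by rewrite (IHn (fun t => f (fcons (a ord0) t)))//; exact: multilinear_tail.
set t := (X in fcons 0 X).
have := multilinear_head t 1 0 0 mf.
by rewrite scaler0 addr0 scale1r => /esym/(canRL (addrK _)) ->; rewrite subrr.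
Qed.

(** Arguments are removed one at a time, which is why the values on the basis
    are prescribed on sequences. *)
Fixpoint mext n : (seq G -> A) -> ('I_n -> A) -> A :=
  if n is n'.+1 then fun f a =>
    lext (fun g => @mext n' (fun t => f (g :: t)) (fun i => a (lift ord0 i)))
         (co (a ord0))
  else fun f _ => f [::].

Lemma mext_multilinear n f : multilinear (@mext n f).
Proof.
elim: n f => [|n IHn] f i a k x y; first by case: i.
case: (unliftP ord0 i) => [j|] -> /=.
  have e z : (fun j' => if lift ord0 j' == lift ord0 j then z
                        else a (lift ord0 j'))
             = [eta (fun j' => a (lift ord0 j')) with j |-> z] :> ('I_n -> A).
    by apply: funext => j' /=; rewrite (inj_eq (@lift_inj _ ord0)).
  rewrite !e /lext scaler_sumr -big_split; apply: eq_bigr => g _ /=.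
  by rewrite IHn scalerDr !scalerA mulrC.
by rewrite !linearP.
Qed.

End TwistedTheory.

(** * Homogeneous cochains *)

Definition face (X : Type) i (s : seq X) := take i s ++ drop i.+1 s.

Lemma size_face (X : Type) i (s : seq X) :
  (i < size s)%N -> size (face i s) = (size s).-1.
Proof.
by move=> lt_is; rewrite size_cat (size_takel (ltnW lt_is)) size_drop; lia.
Qed.

Lemma nth_face (X : Type) (x : X) i (s : seq X) j :
  (i < size s)%N -> nth x (face i s) j = nth x s (bump i j).
Proof.
move=> lt_is; rewrite nth_cat (size_takel (ltnW lt_is)) /bump.
case: (ltnP j i) => ij; first by rewrite nth_take.
by rewrite nth_drop add1n addSn subnKC.
Qed.

Section Simplicial.
Variables (X : Type) (K : comNzRingType) (V : lmodType K).
Implicit Types (f : seq X -> V) (s : seq X).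

(** The simplicial differential [sdE]; recursion on the list makes it compute on
    explicit lists. *)
Fixpoint sd f s {struct s} : V :=
  if s is x :: s' then f s' - sd (fun t => f (x :: t)) s' else 0.

Lemma sdE f s : sd f s = \sum_(i < size s) (-1) ^+ i *: f (face i s).
Proof.
elim: s f => [|x s IHs] f /=; first by rewrite big_ord0.
rewrite big_ord_recl IHs scale1r /face /= drop0; congr (_ + _).
rewrite -sumrN; apply: eq_bigr => i _.
by rewrite /bump add1n exprS mulN1r scaleNr.
Qed.

Lemma sd_eq f1 f2 s :
  (forall t, size t = (size s).-1 -> f1 t = f2 t) -> sd f1 s = sd f2 s.
Proof.
move=> e; rewrite !sdE; apply: eq_bigr => i _.
by rewrite e// size_face.
Qed.

End Simplicial.

Lemma sd_linear (X : Type) (K : comNzRingType) (V W : lmodType K)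
    (L : {linear V -> W}) (f : seq X -> V) s :
  L (sd f s) = sd (fun t => L (f t)) s.
Proof.
by elim: s f => [|x s IHs] f /=; rewrite ?linear0// linearB IHs.
Qed.

Lemma sd_map (X Y : Type) (K : comNzRingType) (V : lmodType K)
    (f : seq Y -> V) (m : X -> Y) s :
  sd f (map m s) = sd (fun t => f (map m t)) s.
Proof. by elim: s f => [|x s IHs] f //=; rewrite IHs. Qed.

Section QuotientModule.
Variables (K : pzRingType) (V : lmodType K) (S : submodClosed V).

Lemma lmod_pi0 : lmod_pi S 0 = 0.
Proof. by rewrite -[X in lmod_pi _ X](subrr 0) lmod_piB subrr. Qed.

Lemma lmod_quot_eq0 : (forall x, x \in S) -> forall x : lmod_quot S, x = 0.
Proof.
move=> allS x; rewrite -(lmod_piE x) -lmod_pi0.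
by apply/lmod_piP; rewrite subr0.
Qed.

(** First isomorphism theorem; the inverse is obtained by choice. *)
Lemma lmod_quot_iso (W : lmodType K) (t : {linear V -> W}) :
  (forall x, t x = 0 <-> x \in S) -> (forall w, exists x, t x = w) ->
  lmod_iso (lmod_quot S) W.
Proof.
move=> kert surj; pose T (x : lmod_quot S) := t (repr x).
have Tpi x : T (lmod_pi S x) = t x.
  apply/subr0_eq; rewrite -linearB; apply/kert; apply/lmod_piP.
  exact: lmod_piE.
have linT : linear T.
  move=> c x y; rewrite -(lmod_piE x) -(lmod_piE y).
  by rewrite [c *: _]lmod_piZ -lmod_piD !Tpi linearP.
pose L := GRing.isLinear.Build K _ _ *:%R T linT.
pose T' : {linear lmod_quot S -> W} := HB.pack T L.
exists T'; have injT : injective T.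
  move=> x y; rewrite -(lmod_piE x) -(lmod_piE y) !Tpi => e.
  by apply/lmod_piP/kert; rewrite linearB e subrr.
have surjT w : exists x, T x == w.
  by have [x <-] := surj w; exists (lmod_pi S x); rewrite Tpi.
exists (fun w => xchoose (surjT w)) => [x|w].
  by apply: injT; exact/eqP/(xchooseP (surjT (T x))).
exact/eqP/(xchooseP (surjT w)).
Qed.

End QuotientModule.

Section Homogeneous.
Variables (K : fieldType) (A : assocAlgType K) (G : groupType).
Variable (u : twisted_basis A G).
Implicit Types (x y : A) (g h : G) (s : seq G).

Definition equivariant (f : seq G -> A) :=
  forall g s, f [seq (g * h)%g | h <- s] = ad u g (f s).

(** The homogeneous form [s0 F(s0^-1 s1, ...) sn^-1] of a cochain, where the
    elements of the group act through the basis.  It is extended by zero to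
    sequences of the wrong length, so that cochains of all degrees have the same
    type. *)
Definition hom n (F : ('I_n -> A) -> A) s : A :=
  if size s == n.+1 then
    u (nth 1%g s 0) ** F (fun i => tbi u (nth 1%g s i) ** u (nth 1%g s i.+1))
      ** tbi u (nth 1%g s n)
  else 0.

Lemma homE n (F : ('I_n -> A) -> A) s : size s = n.+1 ->
  hom F s = u (nth 1%g s 0)
    ** F (fun i => tbi u (nth 1%g s i) ** u (nth 1%g s i.+1))
    ** tbi u (nth 1%g s n).
Proof. by rewrite /hom => ->; rewrite eqxx. Qed.

Lemma hom_linear n k (F1 F2 : ('I_n -> A) -> A) :
  hom (k *: F1 + F2) = k *: hom F1 + hom F2.
Proof.
apply: funext => s; rewrite !fctE /hom; case: eqP => _.
  by rewrite amulPr amulPl.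
by rewrite scaler0 addr0.
Qed.

(** The multiplications of neighbouring arguments in the Hochschild
    differential become omissions of an entry. *)
Lemma hom_d n (F : ('I_n -> A) -> A) s : hom (hoch_d F) s = sd (hom F) s.
Proof.
have [sz|nsz] := eqVneq (size s) n.+2; last first.
  rewrite /hom (negPf nsz) sdE big1// => i _.
  rewrite size_face// -eqSS prednK ?(leq_ltn_trans _ (ltn_ord i))//.
  by rewrite (negPf nsz) scaler0.
rewrite (homE _ sz) sdE sz big_ord_recl big_ord_recr /hoch_d.
have sf (i : nat) : (i < n.+2)%N -> size (face i s) = n.+1.
  by move=> lti; rewrite size_face sz.
rewrite !amulDr !amulDl -addrA; congr (_ + (_ + _)).
- rewrite scale1r homE ?sf// !nth_face ?sz//.
  rewrite -[X in _ ** X ** _]amulA tbKV.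
  congr (_ ** F _ ** _); apply: funext => i.
  by rewrite !nth_face ?sz// /bump !leq0n !add1n.
- rewrite (big_morph _ (amulDr _) (amulx0 _)).
  rewrite (big_morph (fun x => x ** _) (fun x y => amulDl x y _) (amul0x _)).
  apply: eq_bigr => i _; rewrite amulZr amulZl; congr (_ *: _).
  have lti := ltn_ord i.
  have bi : (bump 0 i < size s)%N by rewrite sz /bump; lia.
  rewrite homE ?sf -?sz// !nth_face//.
  rewrite (_ : bump (bump 0 i) 0 = 0%N); last by rewrite /bump; lia.
  rewrite (_ : bump (bump 0 i) n = n.+1); last by rewrite /bump; lia.
  congr (_ ** F _ ** _); apply: funext => j.
  rewrite !nth_face// /contract -val_eqE /=.
  case: (ltngtP j i) => ji.
  + rewrite (_ : bump (bump 0 i) j = j); last by rewrite /bump; lia.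
    by rewrite (_ : bump (bump 0 i) j.+1 = j.+1); last by rewrite /bump; lia.
  + rewrite (_ : bump (bump 0 i) j = j.+1); last by rewrite /bump; lia.
    by rewrite (_ : bump (bump 0 i) j.+1 = j.+2); last by rewrite /bump; lia.
  + rewrite (_ : bump (bump 0 i) j = j); last by rewrite /bump; lia.
    rewrite (_ : bump (bump 0 i) j.+1 = j.+2); last by rewrite /bump; lia.
    by rewrite -amulA tbKV.
- rewrite amulZr amulZl; congr (_ *: _).
  rewrite homE ?sf// !nth_face ?sz// /bump.
  rewrite (_ : (n.+1 <= 0)%N = false)// (_ : (n.+1 <= n)%N = false) ?ltnn//.
  rewrite -!amulA tbbV amulx1; congr (_ ** (F _ ** _)).
  apply: funext => i; have lti := ltn_ord i.
  rewrite !nth_face ?sz//.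
  rewrite (_ : bump n.+1 i = i); last by rewrite /bump; lia.
  by rewrite (_ : bump n.+1 i.+1 = i.+1); last by rewrite /bump; lia.
Qed.

(** Translating all entries by [g] changes the arguments of [F] by quotients of
    cocycle values, whose product telescopes. *)
Lemma hom_equivariant n (F : ('I_n -> A) -> A) :
  multilinear F -> equivariant (hom F).
Proof.
move=> mF g s; rewrite /hom size_map; case: eqP => [sz|_]; last by rewrite linear0.
rewrite !(nth_map 1%g) ?sz//.
set p := tb_cocycle u g.
have p0 h : p h != 0 by exact: tb_cocycle_neq0.
have -> : (fun i : 'I_n => tbi u (nth 1%g [seq (g * h)%g | h <- s] i)
              ** u (nth 1%g [seq (g * h)%g | h <- s] i.+1))
   = (fun i : 'I_n => (p (nth 1%g s i) / p (nth 1%g s i.+1)) *: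
         (tbi u (nth 1%g s i) ** u (nth 1%g s i.+1))).
  apply: funext => i; have lti := ltn_ord i.
  rewrite !(nth_map 1%g) ?sz ?ltnS ?(ltnW lti)//.
  rewrite tbME tbiM amulZl amulZr scalerA; congr (_ *: _).
  by rewrite -amulA tbVK.
rewrite multilinear_scale// /ad tbME tbiM !(amulZl, amulZr) !scalerA -!amulA.
rewrite (_ : \prod_i _ = p (nth 1%g s 0) / p (nth 1%g s n)).
  by rewrite -/p mulrA mulfVK// mulfV// scale1r.
elim: (n) => [|m IHm]; first by rewrite big_ord0 divff.
by rewrite big_ord_recr IHm /= mulrA divfK.
Qed.

(** ** From homogeneous cochains back to multilinear functions *)

Fixpoint tbprod s : A := if s is g :: t then u g ** tbprod t else aone.

(** The products [tbi u a ** u b] are multiples of basis elements.  Prescribing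
    [f t ** tbprod t] instead of [f t] absorbs the scalars. *)
Lemma mext_scaled n (f : seq G -> A) g s : size s = n ->
  mext u (fun t => f t ** tbprod t)
    (fun i : 'I_n => tbi u (nth 1%g (g :: s) i) ** u (nth 1%g s i))
  = f (pairmap (fun a b => a^-1 * b)%g g s) ** (tbi u g ** u (last g s)).
Proof.
elim: s n f g => [|h s IHs] [|n] f g //= => [_|[sz]].
  by rewrite tbVb.
have := IHs n (fun t => f ((g^-1 * h)%g :: t) ** u (g^-1 * h)%g) h sz.
have e : tbi u g ** u h = (tb_cocycle u g (g^-1 * h)%g)^-1 *: u (g^-1 * h)%g.
  by rewrite -[X in _ ** u X](mulVKg g h) (tbME u g (g^-1 * h)) amulZr tbVK.
rewrite e linearZ tb_coordU linearZ /= lextU.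
have -> : (fun t => f ((g^-1 * h)%g :: t) ** (u (g^-1 * h)%g ** tbprod t))
  = (fun t => f ((g^-1 * h)%g :: t) ** u (g^-1 * h)%g ** tbprod t).
  by apply: funext => t; rewrite amulA.
move=> ->; rewrite -amulZl -amulZr -e -!amulA; congr (_ ** (_ ** _)).
by rewrite tbKV.
Qed.

(** The inverse of [hom]: the steps [t] are summed up to the vertices of a
    simplex starting at the neutral element. *)
Definition dehom n (f : seq G -> A) : ('I_n -> A) -> A :=
  mext u (fun t => f (1%g :: scanl (fun a b => a * b)%g 1%g t) ** tbprod t).

Fact scanl_pairmap (x g : G) s :
  scanl (fun a b => a * b)%g x (pairmap (fun a b => a^-1 * b)%g g s)
  = [seq (x * g^-1 * h)%g | h <- s].
Proof.
elim: s x g => //= h s IHs x g; rewrite IHs mulgA; congr (_ :: _).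
by apply: eq_map => k; rewrite mulgK.
Qed.

Lemma hom_dehom n (f : seq G -> A) s :
  equivariant f -> size s = n.+1 -> hom (@dehom n f) s = f s.
Proof.
move=> ef sz; rewrite homE//; case: s sz => // g s [sz].
rewrite /dehom mext_scaled// scanl_pairmap.
rewrite (_ : (1 :: _)%g = [seq (g^-1 * h)%g | h <- g :: s]); last first.
  by rewrite /= mulVg; congr (_ :: _); apply: eq_map => h; rewrite mul1g.
rewrite ef -sz nth_last /=; set y := f _.
have := adK u g^-1%g y; rewrite invgK => {2}<-.
move: (ad u _ y) => z; rewrite /ad.
by rewrite -!amulA tbbV amulx1.
Qed.

(** Multilinearity reduces to arguments in the basis, and these are, up to
    nonzero scalars, the steps between consecutive partial products. *)
Lemma hom_inj n (F1 F2 : ('I_n -> A) -> A) : multilinear F1 -> multilinear F2 ->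
  (forall s, size s = n.+1 -> hom F1 s = hom F2 s) -> F1 = F2.
Proof.
move=> m1 m2 e; apply: (multilinear_eq (u := u)) => // g.
pose p := fix p i := if i is j.+1 then (p j * oapp g 1 (insub j))%g else 1%g.
have := e (mkseq p n.+1) (size_mkseq _ _).
rewrite !homE ?size_mkseq// => /(congr1 (amul (tbi u (nth 1%g (mkseq p n.+1) 0)))).
rewrite -!amulA !tbVK => /(congr1 (fun x => x ** u (nth 1%g (mkseq p n.+1) n))).
rewrite -!amulA !tbVb !amulx1.
pose c (i : 'I_n) := tb_cocycle u (p i) (g i).
have -> : (fun i : 'I_n => tbi u (nth 1%g (mkseq p n.+1) i)
                           ** u (nth 1%g (mkseq p n.+1) i.+1))
        = (fun i => (c i)^-1 *: (u \o g) i).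
  apply: funext => i; have lti := ltn_ord i.
  by rewrite !nth_mkseq ?ltnS ?(ltnW lti)//= valK /= tbME amulZr tbVK.
rewrite !multilinear_scale// => /(scalerI _); apply.
by apply/prodf_neq0 => i _; rewrite invr_eq0 tb_cocycle_neq0.
Qed.

Lemma cob_of_hom n (F : ('I_n.+1 -> A) -> A) (h : seq G -> A) :
  multilinear F -> equivariant h ->
  (forall s, size s = n.+2 -> hom F s = sd h s) -> is_coboundary F.
Proof.
move=> mF eh e; have mh : multilinear (@dehom n h) by exact: mext_multilinear.
exists (dehom h) => //; apply: hom_inj => // [|s sz].
  exact: hoch_d_multilinear.
rewrite hom_d e//; apply: sd_eq => t; rewrite sz => szt.
by rewrite hom_dehom.
Qed.

Lemma hom_of_cob n (F : ('I_n.+1 -> A) -> A) : is_coboundary F ->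
  exists2 h, equivariant h & forall s, hom F s = sd h s.
Proof.
by move=> [g mg ->]; exists (hom g); [exact: hom_equivariant|exact: hom_d].
Qed.

Lemma hom_cocycle n (F : ('I_n -> A) -> A) : F \in cocycle (n := n) ->
  equivariant (hom F) /\ forall s, sd (hom F) s = 0.
Proof.
move=> /asboolP[mF dF]; split; first exact: hom_equivariant.
by move=> s; rewrite -hom_d dF /hom; case: eqP => // _; rewrite amulx0 amul0x.
Qed.

Lemma dehom_cocycle n (f : seq G -> A) : equivariant f ->
  (forall s, size s = n.+2 -> sd f s = 0) -> @dehom n f \in cocycle (n := n).
Proof.
move=> ef df; have mf : multilinear (@dehom n f) by exact: mext_multilinear.
apply/asboolP; split=> //; apply: hom_inj => [||s sz].
- exact: hoch_d_multilinear.
- by move=> *; rewrite scaler0 addr0.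
- rewrite hom_d [RHS]homE// amulx0 amul0x -[RHS](df s sz).
  by apply: sd_eq => t; rewrite sz => szt; rewrite hom_dehom.
Qed.

(** Vanishing of Hochschild cohomology is a statement on equivariant
    homogeneous cochains. *)
Lemma HH_eq0 n :
  (forall f, equivariant f -> (forall s, sd f s = 0) ->
     exists2 h, equivariant h & forall s, size s = n.+2 -> f s = sd h s) ->
  forall x : HH A n.+1, x = 0.
Proof.
move=> H; apply: lmod_quot_eq0 => F; apply/asboolP.
have [eF dF] := hom_cocycle (valP F).
have /asboolP[mF _] := valP F.
have [h eh e] := H _ eF dF.
exact: cob_of_hom mF eh e.
Qed.

End Homogeneous.

(** * Identities in abelian groups *)

(** A decision procedure by reflection: two expressions are compared through
    the integer coefficients of their atoms. *)
Section ZmodReflection.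
Variable V : zmodType.

Inductive zexp := ZVar of nat | ZZero | ZAdd of zexp & zexp | ZOpp of zexp.

Fixpoint zeval (env : seq V) e : V :=
  match e with
  | ZVar i => env`_i
  | ZZero => 0
  | ZAdd e1 e2 => zeval env e1 + zeval env e2
  | ZOpp e1 => - zeval env e1
  end.

Fixpoint zcoef e (i : nat) : int :=
  match e with
  | ZVar j => (i == j)%:Z
  | ZZero => 0
  | ZAdd e1 e2 => zcoef e1 i + zcoef e2 i
  | ZOpp e1 => - zcoef e1 i
  end.

Lemma zeval_coef env e : zeval env e = \sum_(i < size env) env`_i *~ zcoef e i.
Proof.
elim: e => [j||e1 IH1 e2 IH2|e1 IH1] /=.
- have [ltj|lej] := ltnP j (size env); last first.
    rewrite nth_default// big1// => i _.
    by rewrite ltn_eqF ?mulr0z// (leq_trans (ltn_ord i)).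
  rewrite (bigD1 (Ordinal ltj))//= eqxx mulr1z big1 ?addr0// => i.
  by rewrite -val_eqE /= => /negPf ->; rewrite mulr0z.
- by rewrite big1// => i _; rewrite mulr0z.
- by rewrite IH1 IH2 -big_split; apply: eq_bigr => i _; rewrite mulrzDr.
- by rewrite IH1 -sumrN; apply: eq_bigr => i _; rewrite mulrNz.
Qed.

Lemma zmodP env e1 e2 :
  all (fun i => zcoef e1 i == zcoef e2 i) (iota 0 (size env)) ->
  zeval env e1 = zeval env e2.
Proof.
move=> /allP e; rewrite !zeval_coef; apply: eq_bigr => i _.
by rewrite (eqP (e i _))// mem_iota ltn_ord.
Qed.

End ZmodReflection.

Ltac zmod_atom env t :=
  match env with
  | nil => constr:(t :: env)
  | ?a :: ?env' =>
    let _ := match goal with _ => first [constr_eq a t | unify a t] end in constr:(env)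
  | ?a :: ?env' => let r := zmod_atom env' t in constr:(a :: r)
  end.
Ltac zmod_atoms env t :=
  lazymatch t with
  | @Algebra.add _ ?a ?b =>
    let env1 := zmod_atoms env a in zmod_atoms env1 b
  | @Algebra.opp _ ?a => zmod_atoms env a
  | @Algebra.zero _ => env
  | _ => zmod_atom env t
  end.
Ltac zmod_index env t :=
  match env with
  | ?a :: _ => let _ := match goal with _ => first [constr_eq a t | unify a t] end in constr:(0%N)
  | _ :: ?env' => let n := zmod_index env' t in constr:(S n)
  end.
Ltac zmod_reify env t :=
  lazymatch t with
  | @Algebra.add _ ?a ?b =>
    let e1 := zmod_reify env a in
    let e2 := zmod_reify env b in constr:(ZAdd e1 e2)
  | @Algebra.opp _ ?a => let e1 := zmod_reify env a in constr:(ZOpp e1)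
  | @Algebra.zero _ => constr:(ZZero)
  | _ => let n := zmod_index env t in constr:(ZVar n)
  end.
Ltac zmod :=
  lazymatch goal with
  | |- @eq ?T ?l ?r =>
    let env0 := constr:(@nil T) in
    let env1 := zmod_atoms env0 l in
    let env := zmod_atoms env1 r in
    let e1 := zmod_reify env l in
    let e2 := zmod_reify env r in
    exact (@zmodP _ env e1 e2 isT)
  end.

(** Proves an equation that is a consequence of the linear relation [a = b]. *)
Lemma zmod_by (V : zmodType) (a b x y : V) : a = b -> x - y = a - b -> x = y.
Proof. by move=> ->; rewrite subrr => /subr0_eq. Qed.

(** * The prism homotopy *)

Section Prism.
Variables (X : Type) (K : comNzRingType) (V : lmodType K).

(** A chain map of the simplicial chains of [X] to themselves that vanishes in
    degrees above two, described by duality: [ts1 a b F] is the value of the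
    cochain [F] on the chain that replaces the simplex [(a, b)], and so on.
    [ts_aug] says that the map respects the augmentation, the last three
    fields that it commutes with the differentials. *)
Record truncated_system := TruncatedSystem {
  ts0 : X -> (X -> V) -> V;
  ts1 : X -> X -> (X -> X -> V) -> V;
  ts2 : X -> X -> X -> (X -> X -> X -> V) -> V;
  ts0B : forall a F1 F2, ts0 a (fun x => F1 x - F2 x) = ts0 a F1 - ts0 a F2;
  ts1B : forall a b F1 F2,
    ts1 a b (fun x y => F1 x y - F2 x y) = ts1 a b F1 - ts1 a b F2;
  ts2B : forall a b c F1 F2, ts2 a b c (fun x y z => F1 x y z - F2 x y z)
    = ts2 a b c F1 - ts2 a b c F2;
  ts_aug : forall a v, ts0 a (fun=> v) = v;
  ts_d1 : forall a b F,
    ts1 a b (fun x y => F y - F x) = ts0 b F - ts0 a F;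
  ts_d2 : forall a b c F,
    ts2 a b c (fun x y z => F y z - F x z + F x y)
    = ts1 b c F - ts1 a c F + ts1 a b F;
  ts_d3 : forall a b c d F,
    ts2 b c d F - ts2 a c d F + ts2 a b d F - ts2 a b c F = 0
}.

Variable P : truncated_system.
Implicit Types F : seq X -> V.

(** Evaluation of [F] on a replaced front face followed by the back face [t]. *)
Definition cap0 F a t := ts0 P a (fun x => F (x :: t)).
Definition cap1 F a b t := ts1 P a b (fun x y => F [:: x, y & t]).
Definition cap2 F a b c t := ts2 P a b c (fun x y z => F [:: x, y, z & t]).

Lemma ts00 a : ts0 P a (fun=> 0) = 0.
Proof. by rewrite ts_aug. Qed.
Lemma ts10 a b : ts1 P a b (fun _ _ => 0) = 0.
Proof. by have := ts1B P a b (fun _ _ => 0) (fun _ _ => 0); rewrite !subrr. Qed.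
Lemma ts20 a b c : ts2 P a b c (fun _ _ _ => 0) = 0.
Proof. by have := ts2B P a b c (fun _ _ _ => 0) (fun _ _ _ => 0); rewrite !subrr. Qed.

Fact sd_ts0 a (H : X -> seq X -> V) t :
  sd (fun t => ts0 P a (fun x => H x t)) t = ts0 P a (fun x => sd (H x) t).
Proof.
by elim: t H => [|z t IH] H /=; rewrite ?ts00// IH ts0B.
Qed.
Fact sd_ts1 a b (H : X -> X -> seq X -> V) t :
  sd (fun t => ts1 P a b (fun x y => H x y t)) t
  = ts1 P a b (fun x y => sd (H x y) t).
Proof.
by elim: t H => [|z t IH] H /=; rewrite ?ts10// IH ts1B.
Qed.
Fact sd_ts2 a b c (H : X -> X -> X -> seq X -> V) t :
  sd (fun t => ts2 P a b c (fun x y z => H x y z t)) t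
  = ts2 P a b c (fun x y z => sd (H x y z) t).
Proof.
by elim: t H => [|w t IH] H /=; rewrite ?ts20// IH ts2B.
Qed.

Section Cocycle.
Variable F : seq X -> V.
Hypothesis dF : forall s, sd F s = 0.

Lemma sd_cap0 a t : sd (cap0 F a) t = F t.
Proof.
rewrite sd_ts0 -[RHS](ts_aug P a); congr ts0; apply: funext => x.
by have := dF (x :: t) => /= /subr0_eq.
Qed.

Lemma sd_cap1 a b t : sd (cap1 F a b) t = cap0 F a t - cap0 F b t.
Proof.
rewrite sd_ts1 -[RHS]opprB -(ts_d1 P a b (fun x => F (x :: t))).
rewrite -[RHS]add0r -[X in X - _](ts10 a b) -ts1B; congr ts1.
apply: funext => x; apply: funext => y.
by apply: (zmod_by (dF [:: x, y & t])) => /=; zmod.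
Qed.

Lemma sd_cap2 a b c t :
  sd (cap2 F a b c) t = cap1 F b c t - cap1 F a c t + cap1 F a b t.
Proof.
rewrite sd_ts2 -(ts_d2 P a b c (fun x y => F [:: x, y & t])); congr ts2.
apply: funext => x; apply: funext => y; apply: funext => z.
by apply: (zmod_by (esym (dF [:: x, y, z & t]))) => /=; zmod.
Qed.

(** The homotopy between the identity and the chain map: alternating sum over
    all ways to replace a front face [s0 ... si] and to keep the back face
    [si ... sn], the vertex [si] being repeated. *)
Definition prism s : V :=
  match s with
  | [::] => 0
  | [:: a] => cap0 F a [:: a]
  | [:: a; b] => cap0 F a [:: a; b] - cap1 F a b [:: b]
  | [:: a, b & (c :: _) as t] =>
    cap0 F a [:: a, b & t] - cap1 F a b (b :: t) + cap2 F a b c t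
  end.

Lemma prism1 a b : F [:: a; b] = sd prism [:: a; b] + ts1 P a b (fun x y => F [:: x; y]).
Proof.
have e0 := sd_cap0 a [:: a; b]; have e1 := sd_cap1 a b [:: b].
rewrite /= /cap1 in e0 e1 *.
apply: (zmod_by (congr2 +%R (esym e0) (esym e1))) => /=.
by rewrite /=; zmod.
Qed.

Lemma prism2 a b c : F [:: a; b; c]
  = sd prism [:: a; b; c] + ts2 P a b c (fun x y z => F [:: x; y; z]).
Proof.
have e0 := sd_cap0 a [:: a; b; c]; have e1 := sd_cap1 a b [:: b; c].
have e2 := sd_cap2 a b c [:: c].
rewrite /= in e0 e1 e2 *.
apply: (zmod_by (congr2 +%R (congr2 +%R (esym e0) (esym e1)) (esym e2))) => /=.
by rewrite /cap2; zmod.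
Qed.

Lemma prism_ge3 a b c d s : F [:: a, b, c, d & s] = sd prism [:: a, b, c, d & s].
Proof.
have e0 := sd_cap0 a [:: a, b, c, d & s].
have e1 := sd_cap1 a b [:: b, c, d & s].
have e2 := sd_cap2 a b c [:: c, d & s].
have e3 := ts_d3 P a b c d (fun x y z => F [:: x, y, z, d & s]).
have expand t : sd (fun t => prism [:: a, b, c & t]) t
   = sd (fun t => cap0 F a [:: a, b, c & t]) t
     - sd (fun t => cap1 F a b [:: b, c & t]) t
     + sd (fun t => cap2 F a b c (c :: t)) t.
  rewrite !sdE -sumrB -big_split; apply: eq_bigr => i _ /=.
  by rewrite scalerDr scalerBr.
have e : sd prism [:: a, b, c, d & s] =
   prism [:: b, c, d & s] - prism [:: a, c, d & s] + prism [:: a, b, d & s]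
   - sd (fun t => prism [:: a, b, c & t]) (d :: s).
  by rewrite /=; zmod.
rewrite e expand.
move: e0 e1 e2 e3 {e expand}; rewrite -!/(cap2 F _ _ _ _).
change (sd (cap0 F a) [:: a, b, c, d & s]) with
  (cap0 F a [:: b, c, d & s] - (cap0 F a [:: a, c, d & s]
   - (cap0 F a [:: a, b, d & s] - sd (fun t => cap0 F a [:: a, b, c & t]) (d :: s)))).
change (sd (cap1 F a b) [:: b, c, d & s]) with
  (cap1 F a b [:: c, d & s] - (cap1 F a b [:: b, d & s]
   - sd (fun t => cap1 F a b [:: b, c & t]) (d :: s))).
change (sd (cap2 F a b c) [:: c, d & s]) with
  (cap2 F a b c [:: d & s] - sd (fun t => cap2 F a b c (c :: t)) (d :: s)).
rewrite [prism]lock.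
move=> e0 e1 e2 e3; rewrite -lock.
rewrite -[prism [:: b, c, d & s]]/(
  cap0 F b [:: b, c, d & s] - cap1 F b c [:: c, d & s] + cap2 F b c d (d :: s)).
rewrite -[prism [:: a, c, d & s]]/(
  cap0 F a [:: a, c, d & s] - cap1 F a c [:: c, d & s] + cap2 F a c d (d :: s)).
rewrite -[prism [:: a, b, d & s]]/(
  cap0 F a [:: a, b, d & s] - cap1 F a b [:: b, d & s] + cap2 F a b d (d :: s)).
apply: (zmod_by (congr2 +%R (congr2 +%R (congr2 +%R (esym e0) (esym e1)) (esym e2)) (esym e3))).
by zmod.
Qed.

End Cocycle.
End Prism.

(** * Signed sums over integer intervals *)

Section IntervalSum.
Variable V : zmodType.
Implicit Types (f : int -> V) (a b c n t : int).

(** The primitive of [f] that vanishes at zero.  Sums over intervals are defined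
    by differences of it, so that they are additive for all orders of the
    bounds. *)
Definition iprim f n : V :=
  match n with
  | Posz m => \sum_(i < m) f i%:Z
  | Negz m => - \sum_(i < m.+1) f (Negz i)
  end.

Lemma iprimS f n : iprim f (n + 1) = iprim f n + f n.
Proof.
case: n => [m|[|m]].
- by rewrite /= addn1 big_ord_recr.
- by rewrite /= big_ord0 big_ord1 addNr.
- rewrite (_ : Negz m.+1 + 1 = Negz m); last by rewrite !NegzE; lia.
  by rewrite /= [in RHS]big_ord_recr /= opprD subrK.
Qed.

Definition isum f a b : V := iprim f b - iprim f a.

Lemma int_shift_const (T : Type) (d : int -> T) :
  (forall n, d (n + 1) = d n) -> forall n, d n = d 0.
Proof.
move=> dS n; elim: n => [//|m IH|m IH]; first by rewrite -IH -[RHS]dS; congr d; lia.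
by rewrite -IH -[LHS]dS; congr d; lia.
Qed.

(** A primitive is determined by its increments up to a constant, so identities
    on signed sums reduce to identities between increments. *)
Lemma isum_uniq f (F : int -> V) a b :
  (forall n, F (n + 1) - F n = f n) -> isum f a b = F b - F a.
Proof.
move=> FS; have e := @int_shift_const V (fun n => iprim f n - F n).
have {}e n : iprim f n - F n = iprim f 0 - F 0.
  by apply: e => m; rewrite iprimS -FS; zmod.
by apply: (zmod_by (congr2 +%R (e b) (esym (e a)))); rewrite /isum; zmod.
Qed.

Lemma isum_shift f a b t : isum (fun i => f (i + t)) a b = isum f (a + t) (b + t).
Proof.
rewrite (isum_uniq (F := fun n => iprim f (n + t))) => [//|n].
by rewrite -addrA [1 + t]addrC addrA iprimS; zmod.
Qed.

Lemma isumB f1 f2 a b :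
  isum (fun i => f1 i - f2 i) a b = isum f1 a b - isum f2 a b.
Proof.
rewrite (isum_uniq (F := fun n => iprim f1 n - iprim f2 n)) => [|n].
  by rewrite /isum; zmod.
by rewrite !iprimS; zmod.
Qed.

Lemma isum_diff (F : int -> V) a b : isum (fun i => F (i + 1) - F i) a b = F b - F a.
Proof. exact: isum_uniq. Qed.

Lemma isum_const v a b : isum (fun=> v) a b = v *~ (b - a).
Proof.
rewrite (isum_uniq (F := fun n => v *~ n)) => [|n]; first by rewrite mulrzBr.
by rewrite mulrzDr mulr1z; zmod.
Qed.

End IntervalSum.

Lemma isum_additive (V W : zmodType) (L : {additive V -> W}) f a b :
  L (isum f a b) = isum (fun i => L (f i)) a b.
Proof.
rewrite (isum_uniq (F := fun n => L (iprim f n))) => [|n].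
  by rewrite -raddfB.
by rewrite -raddfB iprimS; congr (L _); zmod.
Qed.

(** * Rotation extensions of the plane lattice *)

Definition vec : Type := (int * int)%type.
HB.instance Definition _ := GRing.Zmodule.on vec.

Definition linv (m : (int * int) * (int * int)) (v : vec) : vec :=
  (m.1.1 * v.1 + m.1.2 * v.2, m.2.1 * v.1 + m.2.2 * v.2).

(** The exponent [rord.+2] is at least two, so that the residues that index the
    powers of the rotation form a ring [ 'I_(rord.+2) ]. *)
Record rotation := Rotation {
  rord : nat;
  rmx : (int * int) * (int * int);
  rdet : rmx.1.1 * rmx.2.2 - rmx.1.2 * rmx.2.1 = 1;
  rordP : forall v, iter rord.+2 (linv rmx) v = v
}.

Section Crystal.
Variable r : rotation.
Local Notation ell := (rord r).+2.
Local Notation index := 'I_ell.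

Definition rot (k : nat) (v : vec) : vec := iter k (linv (rmx r)) v.

Lemma rotD k v w : rot k (v + w) = rot k v + rot k w.
Proof.
elim: k => //= k ->; rewrite /linv /=.
by congr (_, _); rewrite !mulrDr addrACA.
Qed.

Lemma rot_add j k v : rot (j + k) v = rot j (rot k v).
Proof. exact: iterD. Qed.

Lemma rot_modn k v : rot (k %% ell) v = rot k v.
Proof.
rewrite [in RHS](divn_eq k ell); elim: (k %/ ell)%N => // m IHm.
by rewrite mulSn -addnA rot_add -IHm; rewrite [in RHS]/rot rordP.
Qed.

Lemma rotDi (j k : index) v : rot (j + k)%R v = rot j (rot k v).
Proof. by rewrite /= rot_modn rot_add. Qed.

Lemma rot0 v : rot (0%R : index) v = v. Proof. by []. Qed.

Lemma rotK (j : index) v : rot j (rot (- j)%R v) = v.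
Proof. by rewrite -rotDi subrr. Qed.
Lemma rotVK (j : index) v : rot (- j)%R (rot j v) = v.
Proof. by rewrite -rotDi addNr. Qed.

Fact rot_additive k : additive (rot k).
Proof.
move=> v w; apply/esym.
by rewrite -[X in rot k X - _](addrNK w v) rotD addrK.
Qed.
HB.instance Definition _ k := GRing.isAdditive.Build vec vec (rot k) (rot_additive k).

(** The semidirect product of the lattice by the powers of the rotation. *)
Definition crystal : Type := (vec * index)%type.
HB.instance Definition _ := Choice.on crystal.

Definition cryst_mul (g h : crystal) : crystal :=
  (g.1 + rot g.2 h.1, g.2 + h.2).
Definition cryst_inv (g : crystal) : crystal := (- rot (- g.2)%R g.1, - g.2).
Definition cryst_one : crystal := (0, 0).

Fact cryst_mulA : associative cryst_mul.
Proof.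
move=> [v i] [w j] [x k]; rewrite /cryst_mul /=; congr (_, _); last exact: addrA.
by rewrite rotD -rotDi addrA.
Qed.
Fact cryst_mul1g : left_id cryst_one cryst_mul.
Proof. by move=> [v i]; rewrite /cryst_mul /= add0r add0r. Qed.
Fact cryst_mulg1 : right_id cryst_one cryst_mul.
Proof. by move=> [v i]; rewrite /cryst_mul /= raddf0 !addr0. Qed.
Fact cryst_mulVg : left_inverse cryst_one cryst_inv cryst_mul.
Proof. by move=> [v i]; rewrite /cryst_mul /cryst_inv /= !addNr. Qed.
Fact cryst_mulgV : right_inverse cryst_one cryst_inv cryst_mul.
Proof. by move=> [v i]; rewrite /cryst_mul /cryst_inv /= raddfN /= rotK !subrr. Qed.

HB.instance Definition _ := isGroup.Build crystal cryst_mulA cryst_mul1g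
  cryst_mulg1 cryst_mulVg cryst_mulgV.

Lemma crystM (g h : crystal) : (g * h)%g = (g.1 + rot g.2 h.1, g.2 + h.2).
Proof. by []. Qed.

(** ** The truncated system of lattice paths and rectangles *)

Section Paths.
Variables (K : fieldType) (V : lmodType K).
Hypothesis ell_neq0 : ell%:R != 0 :> K.
Implicit Types (i : index) (a b c d g : crystal).

(** The frame [i] is the standard frame turned by [rot i]; [pt] is the group
    element with given coordinates in the frame, and [loc] reads the
    coordinates. *)
Definition pt i (x y : int) : crystal := (rot i (x, y), i).
Definition loc i a : vec := rot (- i)%R a.1.

Definition avg (f : index -> V) : V := ell%:R^-1 *: \sum_i f i.

Definition path0 i a (F : crystal -> V) : V := F (a.1, i).

(** The lattice path from [a] to [b] that goes first along the first axis of the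
    frame, then along the second. *)
Definition path1 i a b (F : crystal -> crystal -> V) : V :=
  isum (fun x => F (pt i x (loc i a).2) (pt i (x + 1) (loc i a).2))
    (loc i a).1 (loc i b).1
  + isum (fun y => F (pt i (loc i b).1 y) (pt i (loc i b).1 (y + 1)))
    (loc i a).2 (loc i b).2.

Definition square i x y (F : crystal -> crystal -> crystal -> V) : V :=
  F (pt i x y) (pt i x (y + 1)) (pt i (x + 1) (y + 1))
  - F (pt i x y) (pt i (x + 1) y) (pt i (x + 1) (y + 1)).

(** The path from [a] to [c] through [b] and the direct path differ by the
    boundary of a rectangle, spanned by the second segment of [a -> b] and
    the first segment of [b -> c]. *)
Definition path2 i a b c (F : crystal -> crystal -> crystal -> V) : V :=
  isum (fun x => isum (fun y => square i x y F) (loc i a).2 (loc i b).2)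
    (loc i b).1 (loc i c).1.

Lemma avgB f1 f2 : avg (fun i => f1 i - f2 i) = avg f1 - avg f2.
Proof. by rewrite /avg sumrB scalerBr. Qed.
Lemma avgD f1 f2 : avg (fun i => f1 i + f2 i) = avg f1 + avg f2.
Proof. by rewrite /avg big_split scalerDr. Qed.
Lemma avg_const v : avg (fun=> v) = v.
Proof.
by rewrite /avg sumr_const card_ord -scaler_nat scalerA mulVf// scale1r.
Qed.
Lemma avg_eq f1 f2 : f1 =1 f2 -> avg f1 = avg f2.
Proof. by move=> e; rewrite /avg (eq_bigr _ (fun i _ => e i)). Qed.

Lemma pt_loc i a : pt i (loc i a).1 (loc i a).2 = (a.1, i).
Proof. by rewrite /pt -surjective_pairing /loc rotK. Qed.

Lemma isum_eq (f1 f2 : int -> V) x y : f1 =1 f2 -> isum f1 x y = isum f2 x y.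
Proof. by move=> /funext ->. Qed.

Lemma path1_d i a b F :
  path1 i a b (fun x y => F y - F x) = path0 i b F - path0 i a F.
Proof.
rewrite /path1 (isum_diff (fun x => F (pt i x (loc i a).2))).
rewrite (isum_diff (fun y => F (pt i (loc i b).1 y))).
by rewrite !pt_loc /path0; zmod.
Qed.

(** Stokes for a rectangle divided into unit squares. *)
Lemma path2_d i a b c F :
  path2 i a b c (fun x y z => F y z - F x z + F x y)
  = path1 i b c F - path1 i a c F + path1 i a b F.
Proof.
rewrite /path2 /path1.
move: (loc i a) (loc i b) (loc i c) => [a1 a2] [b1 b2] [c1 c2] /=.
pose E1 y x := F (pt i x y) (pt i (x + 1) y).
pose E2 x y := F (pt i x y) (pt i x (y + 1)).
have sq x : isum (fun y => square i x y (fun x y z => F y z - F x z + F x y)) a2 b2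
   = (E1 b2 x - E1 a2 x) - (isum (E2 (x + 1)) a2 b2 - isum (E2 x) a2 b2).
  rewrite -isumB -(isum_diff (fun y => E1 y x)) -isumB; apply: isum_eq => y.
  by rewrite /square /E1 /E2; zmod.
rewrite (isum_eq _ _ sq) isumB.
rewrite (isum_diff (fun x => isum (E2 x) a2 b2)).
rewrite isumB /isum -!/(E1 _ _) -!/(E2 _ _).
rewrite -[fun x : int => F _ _]/(E1 _).
zmod.
Qed.

(** The plane has no cycles of degree two: the four signed rectangles cancel. *)
Lemma path2_d3 i a b c d F :
  path2 i b c d F - path2 i a c d F + path2 i a b d F - path2 i a b c F = 0.
Proof.
rewrite /path2.
move: (loc i a) (loc i b) (loc i c) (loc i d)
  => [a1 a2] [b1 b2] [c1 c2] [d1 d2] /=.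
pose S (y : int) x := iprim (fun y => square i x y F) y.
have e y1 y2 x1 x2 : isum (fun x => isum (fun y => square i x y F) y1 y2) x1 x2
  = isum (S y2) x1 x2 - isum (S y1) x1 x2 by rewrite -isumB.
by rewrite !e /isum; zmod.
Qed.

(** A single frame is not invariant under the rotations; the average over all
    frames is. *)
Definition lattice_system : truncated_system crystal V.
Proof.
exists (fun a F => avg (fun i => path0 i a F))
       (fun a b F => avg (fun i => path1 i a b F))
       (fun a b c F => avg (fun i => path2 i a b c F)).
- by move=> a F1 F2; rewrite -avgB.
- move=> a b F1 F2; rewrite -avgB; apply: avg_eq => i.
  by rewrite /path1 !isumB; zmod.
- move=> a b c F1 F2; rewrite -avgB; apply: avg_eq => i.
  rewrite /path2 -isumB; apply: isum_eq => x; rewrite -isumB.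
  by apply: isum_eq => y; rewrite /square; zmod.
- by move=> a v; rewrite avg_const.
- by move=> a b F; rewrite -avgB; apply: avg_eq => i; exact: path1_d.
- by move=> a b c F; rewrite -avgB -avgD; apply: avg_eq => i; exact: path2_d.
- move=> a b c d F; rewrite -avgB -avgD -avgB -[RHS](avg_const 0).
  by apply: avg_eq => i; exact: path2_d3.
Defined.

(** *** Equivariance *)

Lemma avg_reindex j f : avg f = avg (fun i => f (j + i)).
Proof.
rewrite /avg (reindex_onto (fun i => j + i) (fun i => i - j)) => [|i _].
  congr (_ *: _); apply: eq_bigl => i.
  by rewrite addrAC subrr add0r eqxx.
by rewrite addrC subrK.
Qed.

Lemma loc_mul g i a : loc (g.2 + i) (g * a)%g = loc (g.2 + i) g + loc i a.
Proof.
rewrite /loc (_ : (g * a)%g.1 = g.1 + rot g.2 a.1)// rotD; congr (_ + _).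
by rewrite -rotDi opprD addrAC addNr add0r.
Qed.

Lemma pt_mul g i x y :
  (g * pt i x y)%g = pt (g.2 + i) (x + (loc (g.2 + i) g).1) (y + (loc (g.2 + i) g).2).
Proof.
rewrite crystM /pt.
set w := loc _ _; have -> : (x + w.1, y + w.2) = (x, y) + w :> vec by case: w.
congr (_, _); change (g.1 + rot g.2 (rot i (x, y)) = rot (g.2 + i)%R ((x, y) + w)).
by rewrite rotD [rot _ w]rotK addrC rotDi.
Qed.

Lemma path0_mul g i a F :
  path0 (g.2 + i) (g * a)%g F = path0 i a (fun x => F (g * x)%g).
Proof. by []. Qed.

Lemma path1_mul g i a b F : path1 (g.2 + i) (g * a)%g (g * b)%g F
  = path1 i a b (fun x y => F (g * x)%g (g * y)%g).
Proof.
rewrite /path1 !loc_mul.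
move: (loc i a) (loc i b) => [a1 a2] [b1 b2].
have := pt_mul g i; case: (loc (g.2 + i) g) => t1 t2 /= pm.
rewrite ![t1 + _]addrC ![t2 + _]addrC -!isum_shift.
congr (_ + _); apply: isum_eq => x; rewrite !pm.
- by rewrite addrAC.
- by rewrite [_ + 1 + _]addrAC.
Qed.

Lemma path2_mul g i a b c F : path2 (g.2 + i) (g * a)%g (g * b)%g (g * c)%g F
  = path2 i a b c (fun x y z => F (g * x)%g (g * y)%g (g * z)%g).
Proof.
rewrite /path2 !loc_mul.
move: (loc i a) (loc i b) (loc i c) => [a1 a2] [b1 b2] [c1 c2].
have := pt_mul g i; case: (loc (g.2 + i) g) => t1 t2 /= pm.
rewrite ![t1 + _]addrC ![t2 + _]addrC -!isum_shift.
apply: isum_eq => x; rewrite -isum_shift; apply: isum_eq => y.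
by rewrite /square !pm ![_ + 1 + _]addrAC.
Qed.

Lemma system0_mul g a F : ts0 lattice_system (g * a)%g F
  = ts0 lattice_system a (fun x => F (g * x)%g).
Proof.
by rewrite /= (avg_reindex g.2); apply: avg_eq => i; exact: path0_mul.
Qed.
Lemma system1_mul g a b F : ts1 lattice_system (g * a)%g (g * b)%g F
  = ts1 lattice_system a b (fun x y => F (g * x)%g (g * y)%g).
Proof.
by rewrite /= (avg_reindex g.2); apply: avg_eq => i; exact: path1_mul.
Qed.
Lemma system2_mul g a b c F : ts2 lattice_system (g * a)%g (g * b)%g (g * c)%g F
  = ts2 lattice_system a b c (fun x y z => F (g * x)%g (g * y)%g (g * z)%g).
Proof.
by rewrite /= (avg_reindex g.2); apply: avg_eq => i; exact: path2_mul.
Qed.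

Lemma avg_lin (L : {linear V -> V}) f : L (avg f) = avg (fun i => L (f i)).
Proof. by rewrite /avg linearZ linear_sum. Qed.

Lemma system0_lin (L : {linear V -> V}) a F : L (ts0 lattice_system a F)
  = ts0 lattice_system a (fun x => L (F x)).
Proof. exact: avg_lin. Qed.
Lemma system1_lin (L : {linear V -> V}) a b F : L (ts1 lattice_system a b F)
  = ts1 lattice_system a b (fun x y => L (F x y)).
Proof.
by rewrite /= avg_lin; apply: avg_eq => i; rewrite /path1 linearD !isum_additive.
Qed.
Lemma system2_lin (L : {linear V -> V}) a b c F : L (ts2 lattice_system a b c F)
  = ts2 lattice_system a b c (fun x y z => L (F x y z)).
Proof.
rewrite /= avg_lin; apply: avg_eq => i; rewrite /path2 isum_additive.
apply: isum_eq => x; rewrite isum_additive; apply: isum_eq => y.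
by rewrite /square raddfB.
Qed.

End Paths.
End Crystal.

(** * Vanishing above degree two *)

Lemma sd_sd (X : Type) (K : comNzRingType) (V : lmodType K) (f : seq X -> V) s :
  sd (sd f) s = 0.
Proof.
elim: s f => //= x s IH f.
have -> : sd (fun t => f t - sd (fun t' => f (x :: t')) t) s
  = sd f s - sd (sd (fun t' => f (x :: t'))) s.
  rewrite !sdE -sumrB; apply: eq_bigr => i _; by rewrite scalerBr.
by rewrite IH subr0 subrr.
Qed.

Section PrismEquivariance.
Variables (K : fieldType) (A : assocAlgType K) (r : rotation).
Hypothesis ell_neq0 : (rord r).+2%:R != 0 :> K.
Local Notation LS := (lattice_system A ell_neq0).
Variable u : twisted_basis A (crystal r).

Lemma prism_equivariant (f : seq (crystal r) -> A) :
  equivariant u f -> equivariant u (prism LS f).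
Proof.
move=> ef g.
have e0 a s : cap0 LS f (g * a)%g [seq (g * h)%g | h <- s]
  = ad u g (cap0 LS f a s).
  rewrite /cap0 system0_mul (system0_lin _ (ad u g)); congr ts0.
  by apply: funext => x; exact: (ef g (x :: s)).
have e1 a b s : cap1 LS f (g * a)%g (g * b)%g [seq (g * h)%g | h <- s]
  = ad u g (cap1 LS f a b s).
  rewrite /cap1 system1_mul (system1_lin _ (ad u g)); congr ts1.
  by apply: funext => x; apply: funext => y; exact: (ef g [:: x, y & s]).
have e2 a b c s : cap2 LS f (g * a)%g (g * b)%g (g * c)%g [seq (g * h)%g | h <- s]
  = ad u g (cap2 LS f a b c s).
  rewrite /cap2 system2_mul (system2_lin _ (ad u g)); congr ts2.
  apply: funext => x; apply: funext => y; apply: funext => z.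
  exact: (ef g [:: x, y, z & s]).
move=> [|a [|b [|c s]]].
- by rewrite /= linear0.
- exact: (e0 a [:: a]).
- apply: etrans (congr2 (fun x y => x - y) (e0 a [:: a; b]) (e1 a b [:: b])) _.
  by rewrite -linearB.
- apply: etrans (congr2 +%R (congr2 (fun x y => x - y) (e0 a [:: a, b, c & s])
    (e1 a b [:: b, c & s])) (e2 a b c (c :: s))) _.
  by rewrite -linearB -linearD.
Qed.

(** Cohomology stops in degree two because the lattice system does. *)
Lemma HH_ge3_eq0 n (x : HH A n.+3) : x = 0.
Proof.
apply: (@HH_eq0 _ _ _ u) => f ef df.
exists (prism LS f); first exact: prism_equivariant.
by move=> [|a [|b [|c [|d s]]]] // _; apply: prism_ge3.
Qed.

End PrismEquivariance.

Section Extension.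
Variables (K : fieldType) (A : assocAlgType K) (G : groupType).
Variable u : twisted_basis A G.

Definition tb_ext (V : lmodType K) (T : G -> V) : A -> V := lext T \o tb_coord u.
HB.instance Definition _ V T := GRing.Linear.on (@tb_ext V T).

Lemma tb_extU (V : lmodType K) (T : G -> V) g : tb_ext T (u g) = T g.
Proof. by rewrite /tb_ext /= tb_coordU lextU. Qed.

Definition coef g (m : A) : K^o := (tb_coord u m)@_g.
Fact coef_linear g : linear (coef g).
Proof. by move=> k x y; rewrite /coef linearP /= mcoeffD mcoeffZ. Qed.
HB.instance Definition _ g :=
  GRing.isLinear.Build K A K^o *:%R (coef g) (coef_linear g).

Lemma coefU g h : coef g (u h) = (h == g)%:R.
Proof. by rewrite /coef tb_coordU mcoeffU. Qed.

Lemma coef_eq m n : (forall g, coef g m = coef g n) -> m = n.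
Proof. by move=> e; apply: (@tb_coord_inj _ _ _ u); apply/malgP. Qed.

(** Otherwise the support of [m] would contain the infinitely many [p n]. *)
Lemma coef_orbit0 m (p : nat -> G) : injective p ->
  (forall n, coef (p n.+1) m = coef (p n) m) -> coef (p 0) m = 0.
Proof.
move=> injp e; apply/eqP; apply: contraT => nz.
have {}e n : coef (p n) m = coef (p 0) m by elim: n => // n <-.
have : (size (map p (iota 0 (size (msupp (tb_coord u m))).+1))
        <= size (msupp (tb_coord u m)))%N.
  apply: uniq_leq_size; first by rewrite map_inj_uniq ?iota_uniq.
  by move=> g /mapP[n _ ->]; rewrite -mcoeff_neq0 -[_@__]/(coef _ _) e.
by rewrite size_map size_iota ltnn.
Qed.

End Extension.

(** * Monomial actions of the plane groups *)

Definition mkc (r : rotation) (v : vec) (k : 'I_(rord r).+2) : crystal r := (v, k).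
Definition e1 : vec := (1, 0).
Definition e2 : vec := (0, 1).

Lemma vec_mulrn_inj (w : vec) : w != 0 -> injective (fun n => w *+ n).
Proof.
move=> w0 n n' /= e.
have c1 k : (w *+ k).1 = w.1 *+ k by elim: k => // k IH; rewrite !mulrS -IH.
have c2 k : (w *+ k).2 = w.2 *+ k by elim: k => // k IH; rewrite !mulrS -IH.
have := congr1 fst e; have := congr1 snd e; rewrite !c1 !c2 {e c1 c2}.
case: w w0 => a b; rewrite -[_ == 0]/((a == 0) && (b == 0)) negb_and /=.
rewrite -(mulr_natr a n) -(mulr_natr a n') -(mulr_natr b n) -(mulr_natr b n').
case/orP => [/mulfI inj _ /inj|/mulfI inj /inj + _];
  by move/eqP; rewrite Num.Theory.eqr_nat => /eqP.
Qed.

Lemma mulr_fix0 (K : fieldType) (a b : K) : a * b = b -> a != 1 -> b = 0.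
Proof.
move=> /eqP; rewrite -subr_eq0 -{2}[b]mul1r -mulrBl mulf_eq0 subr_eq0.
by case/orP => [->|/eqP].
Qed.

Lemma divf_fix0 (K : fieldType) (a b : K) : a != 1 ->
  b + (- (a * ((a - 1)^-1 * b)) - - ((a - 1)^-1 * b)) = 0.
Proof. by rewrite -subr_eq0 => a1; field. Qed.

(** All that the computation of the cohomology uses of the algebra.
    Conjugation permutes the basis elements up to characters on the translations
    ([ma_ad0]) and without scalars elsewhere ([ma_ad]).  The map [ma_quo] follows
    the translations along their orbits on the basis elements of rotation [k]:
    it witnesses that these orbits are free. *)
Record monomial_action (K : fieldType) (A : assocAlgType K) (r : rotation)
    (u : twisted_basis A (crystal r)) := MonomialAction {
  ma_char : vec -> vec -> K;
  ma_quo : nat -> vec -> vec;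
  ma_ell : (rord r).+2%:R != 0 :> K;
  ma_char1 : forall w, ma_char w 0 = 1;
  ma_char_e1 : forall v : vec, (ma_char e1 v == 1) = (v.2 == 0);
  ma_char_e2 : forall v : vec, (ma_char e2 v == 1) = (v.1 == 0);
  ma_ad0 : forall (w : vec) (j : 'I_(rord r).+2) (v : vec),
    ad u (mkc w j) (u (mkc v 0)) = ma_char w (rot r j v) *: u (mkc (rot r j v) 0);
  ma_ad : forall (w : vec) (j : 'I_(rord r).+2) (v : vec) (k : 'I_(rord r).+2),
    k != 0 -> ad u (mkc w j) (u (mkc v k))
    = u (mkc (rot r j v + (w - rot r k w)) k);
  ma_quoE : forall (k : 'I_(rord r).+2) (v w : vec), k != 0 ->
    ma_quo k (v + (w - rot r k w)) = ma_quo k v + w;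
  ma_rot_sum : forall v : vec, \sum_(j < (rord r).+2) rot r j v = 0
}.

Section Cohomology.
Variables (K : fieldType) (A : assocAlgType K) (r : rotation).
Variable u : twisted_basis A (crystal r).
Variable M : monomial_action u.
Local Notation ell := (rord r).+2.
Local Notation index := 'I_ell.
Local Notation chi := (ma_char M).
Local Notation quo := (ma_quo M).
Implicit Types (k j : index) (v w : vec) (m : A).

Definition tx : crystal r := mkc e1 0.
Definition ty : crystal r := mkc e2 0.
Definition tsl w : crystal r := mkc w 0.

Lemma txyC : (tx * ty = ty * tx)%g.
Proof. by []. Qed.

Local Notation X := (ad u tx).
Local Notation Y := (ad u ty).

Lemma ad_tsl0 w v : ad u (tsl w) (u (mkc v 0)) = chi w v *: u (mkc v 0).
Proof. by rewrite (ma_ad0 M) rot0. Qed.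

Lemma ad_tsl w v k : k != 0 ->
  ad u (tsl w) (u (mkc v k)) = u (mkc (v + (w - rot r k w)) k).
Proof. by move=> k0; rewrite (ma_ad M). Qed.

Lemma adC g h m : (g * h = h * g)%g -> ad u g (ad u h m) = ad u h (ad u g m).
Proof. by rewrite -!adM => ->. Qed.

Lemma ad_one g : ad u g aone = aone.
Proof. by rewrite /ad amulx1 tbbV. Qed.

Lemma crystal_lin_eq (V : lmodType K) (f1 f2 : {linear A -> V}) :
  (forall v k, f1 (u (mkc v k)) = f2 (u (mkc v k))) -> f1 =1 f2.
Proof. by move=> e; apply: (tb_lin_eq (u := u)) => -[v k]; exact: e. Qed.

Lemma mkc_eq v w j k : (mkc v j == mkc w k :> crystal r) = (v == w) && (j == k).
Proof. by []. Qed.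

Lemma coef_tsl0 w v m : coef u (mkc v 0) (ad u (tsl w) m) = chi w v * coef u (mkc v 0) m.
Proof.
pose f1 : {linear A -> K^o} := coef u (mkc v 0) \o ad u (tsl w).
pose f2 : {linear A -> K^o} := chi w v \*: coef u (mkc v 0).
move: m; apply: (@crystal_lin_eq K^o f1 f2) => v' k; rewrite /f1 /f2 /=.
have [->|k0] := eqVneq k 0.
  rewrite ad_tsl0 linearZ /= !coefU !mkc_eq eqxx andbT.
  by case: eqP => [->//|_]; rewrite !scaler0.
by rewrite ad_tsl// !coefU !mkc_eq (negPf k0) !andbF scaler0.
Qed.

Lemma coef_tsl w v k m : k != 0 ->
  coef u (mkc (v + (w - rot r k w)) k) (ad u (tsl w) m) = coef u (mkc v k) m.
Proof.
move=> k0.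
pose f1 : {linear A -> K^o} := coef u (mkc (v + (w - rot r k w)) k) \o ad u (tsl w).
move: m; apply: (@crystal_lin_eq K^o f1 (coef u (mkc v k))) => v' k'; rewrite /f1 /=.
have [->|k0'] := eqVneq k' 0.
  by rewrite ad_tsl0 linearZ /= !coefU !mkc_eq [0 == k]eq_sym (negPf k0) !andbF scaler0.
rewrite ad_tsl// !coefU !mkc_eq; have [->|//] := eqVneq k' k.
  by rewrite (inj_eq (addIr _)).
by rewrite !andbF.
Qed.

(** Outside the translation lattice a translation moves the basis elements along
    infinite orbits without scalars, which is incompatible with the finite
    support of a fixed element. *)
Lemma fix_tsl_coef w m v k : w != 0 -> k != 0 -> ad u (tsl w) m = m ->
  coef u (mkc v k) m = 0.
Proof.
move=> w0 k0 fm; pose p n : crystal r := mkc (v + (w - rot r k w) *+ n) k.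
rewrite -[v]addr0 -[X in v + X](mulr0n (w - rot r k w)).
apply: (@coef_orbit0 _ _ _ u m p) => [n n' /(congr1 fst)/addrI e|n].
  have q i : quo k ((w - rot r k w) *+ i) = quo k 0 + w *+ i.
    elim: i => [|i IH]; first by rewrite mulr0n addr0.
    by rewrite mulrS addrC ma_quoE// IH mulrSr addrA.
  have /addrI : quo k 0 + w *+ n = quo k 0 + w *+ n' by rewrite -!q e.
  exact: vec_mulrn_inj.
by rewrite -[in LHS]fm /p mulrSr addrA coef_tsl.
Qed.

Lemma fixX_coef m v k : X m = m -> (k != 0) || (v.2 != 0) -> coef u (mkc v k) m = 0.
Proof.
move=> fm; have [->/=|k0 _] := eqVneq k 0; last exact: (@fix_tsl_coef e1).
move=> v0; have := coef_tsl0 e1 v m; rewrite -/tx fm => /esym/mulr_fix0.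
by apply; apply: contraNN v0 => h; rewrite -(ma_char_e1 M); exact: h.
Qed.

Lemma fixY_coef m v k : Y m = m -> (k != 0) || (v.1 != 0) -> coef u (mkc v k) m = 0.
Proof.
move=> fm; have [->/=|k0 _] := eqVneq k 0; last exact: (@fix_tsl_coef e2).
move=> v0; have := coef_tsl0 e2 v m; rewrite -/ty fm => /esym/mulr_fix0.
by apply; apply: contraNN v0 => h; rewrite -(ma_char_e2 M); exact: h.
Qed.

Lemma scalar_of_coef m :
  (forall v k, mkc v k != 1%g -> coef u (mkc v k) m = 0) ->
  m = coef u 1%g m *: aone.
Proof.
move=> z; apply: (coef_eq (u := u)) => -[v k]; rewrite linearZ /= -(tb1 u) coefU.
have [<-|ne] := eqVneq 1%g ((v, k) : crystal r); first by rewrite [RHS]mulr1.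
by rewrite [RHS]mulr0; apply: z; rewrite eq_sym.
Qed.

Lemma fixXY_scalar m : X m = m ->
  (forall v, v.2 = 0 -> v.1 != 0 -> coef u (mkc v 0) m = 0) ->
  m = coef u 1%g m *: aone.
Proof.
move=> fX z; apply: scalar_of_coef => v k ne.
have [h|] := boolP ((k != 0) || (v.2 != 0)); first exact: fixX_coef.
rewrite negb_or !negbK => /andP[/eqP k0 /eqP v2]; subst k; apply: z => //.
apply: contra ne => /eqP v1; apply/eqP.
by rewrite [v]surjective_pairing v1 v2.
Qed.

(** ** Degree zero *)

Lemma HH0_iso : lmod_iso (HH A 0) K^o.
Proof.
pose pt0 : 'I_0 -> A := fun=> 0.
pose t (F : cocycles A 0) : K^o := coef u 1%g (\val F pt0).
have lt : linear t by move=> c F1 F2; rewrite /t linearP.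
pose T : {linear cocycles A 0 -> K^o} := HB.pack t (GRing.isLinear.Build K _ _ *:%R t lt).
have const (F : ('I_0 -> A) -> A) a : F a = F pt0.
  by congr F; apply: funext => -[].
have inv (F : cocycles A 0) g : ad u g (\val F pt0) = \val F pt0.
  have [eF dF] := hom_cocycle u (valP F).
  have := dF [:: 1%g; g] => /=; rewrite !homE//= !subr0 => /subr0_eq.
  by rewrite -!/(ad u _ _) ad1 !const.
apply: (@lmod_quot_iso _ _ _ K^o T) => [F|c].
  split=> [tF|/asboolP F0]; last first.
    change (coef u 1%g (\val F pt0) = 0).
    by rewrite (F0 : \val F = 0) linear0.
  apply/asboolP => /=; apply: funext => a; rewrite const.
  rewrite (fixXY_scalar (inv F tx)) => [|v v2 v1].
    by rewrite -[coef u _ _]/(T F) tF scale0r.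
  by apply: fixY_coef; [exact: inv|rewrite v1].
pose F : ('I_0 -> A) -> A := fun=> c *: aone.
have cF : F \in cocycle (n := 0).
  apply/asboolP; split; first by case.
  apply: funext => a; rewrite /hoch_d big_ord0 addr0 expr1 scaleN1r /F.
  by rewrite amulZl amulZr amulx1 amul1x (ord1 ord_max) subrr.
exists (exist _ F cF); rewrite /T /= /t /= linearZ /= -(tb1 u) coefU eqxx.
exact: mulr1.
Qed.

(** ** Degree one *)

(** Division by [X - 1] with remainder.  On the basis element of a translation,
    [X - 1] is a scalar, zero or invertible.  Elsewhere [reduceX] is a point on
    each orbit of [X], and the difference between a basis element and the one
    at that point is a telescoping sum. *)
Definition reduceX k v : vec := v - ((e1 - rot r k e1) *~ (quo k v).1).

Definition projX : A -> A := tb_ext u (fun g : crystal r =>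
  if g.2 == 0 then (if g.1.2 == 0 then u g else 0) else u (mkc (reduceX g.2 g.1) g.2)).
HB.instance Definition _ := GRing.Linear.on projX.

Definition divX : A -> A := tb_ext u (fun g : crystal r =>
  if g.2 == 0 then (if g.1.2 == 0 then 0 else (chi e1 g.1 - 1)^-1 *: u g)
  else isum (fun n => u (mkc (reduceX g.2 g.1 + (e1 - rot r g.2 e1) *~ n) g.2))
         0 (quo g.2 g.1).1).
HB.instance Definition _ := GRing.Linear.on divX.

Definition divY : A -> A := tb_ext u (fun g : crystal r =>
  if (g.2 == 0) && (g.1.1 != 0) then (chi e2 g.1 - 1)^-1 *: u g else 0).
HB.instance Definition _ := GRing.Linear.on divY.

Lemma divXE m : m - projX m = X (divX m) - divX m.
Proof.
pose f1 : {linear A -> A} := idfun \- projX.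
pose f2 : {linear A -> A} := (X \o divX) \- divX.
move: m; apply: (@crystal_lin_eq A f1 f2) => v k; rewrite /f1 /f2 /= /projX /divX !tb_extU /=.
have [->|k0] := eqVneq k 0.
  have [v2|v2] := eqVneq v.2 0; first by rewrite subrr linear0 subrr.
  rewrite subr0 linearZ /= ad_tsl0 scalerA -scalerBl -{2}[_^-1]mulr1 -mulrBr.
  by rewrite mulVf ?scale1r// subr_eq0 ma_char_e1.
set F := fun n : int => u _.
have -> : X (isum F 0 (quo k v).1) = isum (fun n => F (n + 1)) 0 (quo k v).1.
  rewrite (isum_additive X); congr isum; apply: funext => n.
  rewrite -[LHS]/(ad u (tsl e1) (u (mkc _ _))) ad_tsl// /F.
  by rewrite -addrA mulrzDr.
rewrite -isumB isum_diff /F mulr0z addr0; congr (u (mkc _ _) - _).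
by rewrite /reduceX subrK.
Qed.

Lemma projX_X m : projX (X m) = projX m.
Proof.
pose f1 : {linear A -> A} := projX \o X.
move: m; apply: (@crystal_lin_eq A f1 projX) => v k; rewrite /f1 /=.
have [->|k0] := eqVneq k 0.
  rewrite ad_tsl0 linearZ /= /projX tb_extU /=.
  case: ifP => [|_]; rewrite ?scaler0// -(ma_char_e1 M).
  by move=> /eqP ->; rewrite scale1r.
rewrite ad_tsl// /projX !tb_extU /= (negPf k0); congr (u (mkc _ _)).
rewrite /reduceX ma_quoE// [(quo k v + _).1]/(_ + 1) mulrzDr mulr1z opprD.
by rewrite addrACA [_ - _ in LHS]addrC addrACA; zmod.
Qed.

Lemma projX_Y m : projX (Y m) = Y (projX m).
Proof.
pose f1 : {linear A -> A} := projX \o Y; pose f2 : {linear A -> A} := Y \o projX.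
move: m; apply: (@crystal_lin_eq A f1 f2) => v k; rewrite /f1 /f2 /=.
have [->|k0] := eqVneq k 0.
  rewrite ad_tsl0 linearZ /= /projX tb_extU /=.
  by case: ifP => _; rewrite ?scaler0 ?linear0// ad_tsl0.
rewrite ad_tsl// /projX !tb_extU /= (negPf k0) ad_tsl//; congr (u (mkc _ _)).
by rewrite /reduceX ma_quoE// [(quo k v + _).1]addr0; zmod.
Qed.

Lemma coef_projX v m : v.2 != 0 -> coef u (mkc v 0) (projX m) = 0.
Proof.
move=> v2; pose f1 : {linear A -> K^o} := coef u (mkc v 0) \o projX.
pose f2 : {linear A -> K^o} := \0.
move: m; apply: (@crystal_lin_eq K^o f1 f2) => v' k; rewrite /f1 /f2 /= /projX tb_extU /=.
case: eqP => [->|/eqP k0]; last by rewrite coefU mkc_eq (negPf k0) andbF.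
case: eqP => [v'2|_]; last by rewrite linear0.
rewrite coefU mkc_eq; case: eqP => // e; by rewrite -e v'2 eqxx in v2.
Qed.

Lemma divY_X m : divY (X m) = X (divY m).
Proof.
pose f1 : {linear A -> A} := divY \o X; pose f2 : {linear A -> A} := X \o divY.
move: m; apply: (@crystal_lin_eq A f1 f2) => v k; rewrite /f1 /f2 /=.
have [->|k0] := eqVneq k 0.
  rewrite ad_tsl0 linearZ /= /divY tb_extU /=.
  case: ifP => _; rewrite ?scaler0 ?linear0//. rewrite [RHS]linearZ /= ad_tsl0.
  by rewrite !scalerA mulrC.
by rewrite ad_tsl// /divY !tb_extU /= (negPf k0) linear0.
Qed.

Lemma coef_divY v m : v.1 != 0 -> coef u (mkc v 0) (divY m)
  = (chi e2 v - 1)^-1 * coef u (mkc v 0) m.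
Proof.
move=> v1; pose f1 : {linear A -> K^o} := coef u (mkc v 0) \o divY.
pose f2 : {linear A -> K^o} := (chi e2 v - 1)^-1 \*: coef u (mkc v 0).
move: m; apply: (@crystal_lin_eq K^o f1 f2) => v' k; rewrite /f1 /f2 /= /divY tb_extU /=.
rewrite coefU mkc_eq.
have [->|k0] /= := eqVneq k 0; last by rewrite andbF linear0 scaler0.
case: ifP => v'1.
  rewrite linearZ /= coefU mkc_eq eqxx andbT.
  by case: eqP => [->//|_]; rewrite !scaler0.
rewrite linear0; case: eqP => [e|_]; last by rewrite scaler0.
by rewrite e v1 in v'1.
Qed.

(** The commuting operators [X - 1] and [Y - 1] define a Koszul complex.
    Dividing first by [X - 1], then the remainders by [Y - 1], leaves remainders
    fixed by both, that is, scalars: the first cohomology of the translation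
    lattice consists of homomorphisms into the scalars. *)
Lemma lattice_H1 m1 m2 : X m2 - m2 = Y m1 - m1 ->
  exists m c1 c2, m1 = X m - m + c1 *: aone /\ m2 = Y m - m + c2 *: aone.
Proof.
move=> e12; pose n := projX m1.
have Yn : Y n = n.
  by apply: subr0_eq; rewrite -projX_Y -linearB -e12 linearB /= projX_X subrr.
have [c1 nE] : exists c1, n = c1 *: aone.
  exists (coef u 1%g n); apply: scalar_of_coef => v k ne.
  have [h|] := boolP ((k != 0) || (v.1 != 0)); first exact: fixY_coef.
  rewrite negb_or !negbK => /andP[/eqP k0 /eqP v1]; subst k.
  apply: coef_projX; apply: contra ne => /eqP v2; apply/eqP.
  by rewrite [v]surjective_pairing v1 v2.
have [p pE] : exists p, p = m2 - (Y (divX m1) - divX m1) by eexists.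
have m1E : m1 = X (divX m1) - divX m1 + n by rewrite -divXE subrK.
have Xp : X p = p.
  apply: subr0_eq; rewrite pE !linearB /= (adC _ txyC).
  have : Y m1 = Y (X (divX m1)) - Y (divX m1) + n.
    by rewrite {1}m1E linearD linearB /= Yn.
  move=> Ym1; apply: (zmod_by (congr2 +%R e12 (congr2 +%R Ym1 (esym m1E)))).
  by zmod.
have [s sdef] : exists s, s = p - (Y (divY p) - divY p) by eexists.
have Xs : X s = s by rewrite sdef !linearB /= Xp (adC _ txyC) -divY_X Xp.
have sE : s = coef u 1%g s *: aone.
  apply: fixXY_scalar => // v v2 v1; rewrite sdef !linearB /= coef_tsl0 coef_divY//.
  apply: divf_fix0; apply: contraNN v1 => h; rewrite -(ma_char_e2 M); exact: h.
exists (divX m1 + divY p), c1, (coef u 1%g s).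
rewrite -sE -nE !linearD /= -[X (divY p)]divY_X Xp; split.
  by apply: (zmod_by m1E); zmod.
by rewrite sdef pE; zmod.
Qed.

End Cohomology.

(** ** The symplectic form *)

Definition om (v w : vec) : int := v.1 * w.2 - v.2 * w.1.

Lemma om_rot (r : rotation) k v w : om (rot r k v) (rot r k w) = om v w.
Proof.
elim: k => //= k <-; move: (rot r k v) (rot r k w) => [a b] [c d].
case: r => ell [[p q] [s t]] /= det _; rewrite /om /=.
rewrite -[RHS]mul1r -det; ring.
Qed.

Section Cohomology2.
Variables (K : fieldType) (A : assocAlgType K) (r : rotation).
Variable u : twisted_basis A (crystal r).
Variable M : monomial_action u.
Local Notation ell := (rord r).+2.
Local Notation index := 'I_ell.
Local Notation LS := (lattice_system A (ma_ell M)).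
Implicit Types (i j k : index) (v w : vec) (m : A) (a b c : crystal r).
Local Notation tx := (tx r).
Local Notation ty := (ty r).
Local Notation tsl := (@tsl r).
Local Notation X := (ad u tx).
Local Notation Y := (ad u ty).
Local Notation avg := (@avg r K A).

Lemma pt_x i x y : pt i (x + 1) y = (pt i x y * tx)%g.
Proof.
rewrite crystM /pt /tx /mkc -rotD; congr (rot _ _ _, _); last by rewrite [RHS]addr0.
by congr (_, _); rewrite addr0.
Qed.

Lemma pt_y i x y : pt i x (y + 1) = (pt i x y * ty)%g.
Proof.
rewrite crystM /pt /ty /mkc -rotD; congr (rot _ _ _, _); last by rewrite [RHS]addr0.
by congr (_, _); rewrite addr0.
Qed.

Lemma equivariant1 f g a : equivariant u f -> f [:: g; (g * a)%g] = ad u g (f [:: 1%g; a]).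
Proof. by move=> /(_ g [:: 1%g; a]) /=; rewrite mulg1. Qed.

Lemma equivariant2 f g a b : equivariant u f ->
  f [:: g; (g * a)%g; (g * b)%g] = ad u g (f [:: 1%g; a; b]).
Proof. by move=> /(_ g [:: 1%g; a; b]) /=; rewrite mulg1. Qed.

Definition orbit1 m (s : seq (crystal r)) : A := if s is [:: g] then ad u g m else 0.

Lemma orbit1_equivariant m : equivariant u (orbit1 m).
Proof. by move=> g [|a [|b s]] /=; rewrite ?linear0 ?adM. Qed.

Lemma sd_sub (f1 f2 : seq (crystal r) -> A) s : sd (fun t => f1 t - f2 t) s = sd f1 s - sd f2 s.
Proof. by rewrite !sdE -sumrB; apply: eq_bigr => i _; rewrite scalerBr. Qed.
Lemma sd_add (f1 f2 : seq (crystal r) -> A) s : sd (fun t => f1 t + f2 t) s = sd f1 s + sd f2 s.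
Proof. by rewrite !sdE -big_split; apply: eq_bigr => i _; rewrite scalerDr. Qed.

Lemma equivariant_add f1 f2 : equivariant u f1 -> equivariant u f2 ->
  equivariant u (fun s => f1 s + f2 s).
Proof. by move=> q1 q2 g s; rewrite q1 q2 linearD. Qed.
Lemma equivariant_sub f1 f2 : equivariant u f1 -> equivariant u f2 ->
  equivariant u (fun s => f1 s - f2 s).
Proof. by move=> q1 q2 g s; rewrite q1 q2 linearB. Qed.

Lemma sd_equivariant f : equivariant u f -> equivariant u (sd f).
Proof.
move=> ef g s; rewrite sd_map (sd_linear (ad u g)); congr sd.
by apply: funext => t; exact: ef.
Qed.

(** By [lattice_H1] a cocycle can be corrected by an inner derivation so as to be
    scalar on the two translations.  The prism homotopy then leaves the average
    over the frames of a homomorphism from the lattice to the scalars, and the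
    sum of the rotations kills it. *)
Lemma HH1_eq0 (x : HH A 1) : x = 0.
Proof.
move: x; apply: (@HH_eq0 _ _ _ u) => f ef df.
have [m [c1 [c2 [m1E m2E]]]] : exists m (c1 c2 : K),
    f [:: 1%g; tx] = X m - m + c1 *: aone /\ f [:: 1%g; ty] = Y m - m + c2 *: aone.
  apply: (lattice_H1 M); rewrite -!(equivariant1 _ _ ef).
  have := df [:: 1%g; tx; (tx * ty)%g]; have := df [:: 1%g; ty; (ty * tx)%g].
  rewrite -txyC /= !subr0 => d2 d1.
  by apply: (zmod_by (congr2 (fun x y => x - y) d1 d2)); zmod.
pose f' s := f s - sd (orbit1 m) s.
have ef' : equivariant u f'.
  by apply: equivariant_sub => //; apply: sd_equivariant; exact: orbit1_equivariant.
have df' s : sd f' s = 0 by rewrite sd_sub df sd_sd subrr.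
have fx : f' [:: 1%g; tx] = c1 *: aone by rewrite /f' /= m1E ad1; zmod.
have fy : f' [:: 1%g; ty] = c2 *: aone by rewrite /f' /= m2E ad1; zmod.
exists (fun s => orbit1 m s + prism LS f' s).
  by apply: equivariant_add; [exact: orbit1_equivariant|exact: prism_equivariant].
move=> [|a [|b [|c s]]] // _; rewrite sd_add.
have p1 := prism1 LS df' a b.
suff z : ts1 LS a b (fun x y => f' [:: x; y]) = 0.
  by move: p1; rewrite z /f' => p1; apply: (zmod_by p1); zmod.
rewrite [LHS]/=.
transitivity (avg (fun i => (c1 *~ (rot r (- i)%R (b.1 - a.1)).1
                 + c2 *~ (rot r (- i)%R (b.1 - a.1)).2) *: (aone : A))).
  apply: avg_eq => i; rewrite raddfB scalerDl /path1; congr (_ + _).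
  - rewrite (_ : (fun _ => _) = fun=> c1 *: aone).
      by rewrite isum_const scalerMzl.
    by apply: funext => z; rewrite pt_x equivariant1// fx linearZ /= ad_one.
  - rewrite (_ : (fun _ => _) = fun=> c2 *: aone).
      by rewrite isum_const scalerMzl.
    by apply: funext => z; rewrite pt_y equivariant1// fy linearZ /= ad_one.
have rs : \sum_(i : index) rot r (- i)%R (b.1 - a.1) = 0.
  apply: etrans (ma_rot_sum M (b.1 - a.1)).
  by rewrite [RHS](reindex_inj (@oppr_inj index)).
rewrite /avg -scaler_suml big_split /= -!mulrz_sumr.
rewrite -(raddf_sum (@fst int int)) -(raddf_sum (@snd int int)) rs /=.
by rewrite !mulr0z addr0 scale0r scaler0.
Qed.

(** ** Degree two *)

(** The value of a cochain on the fundamental cycle of the torus. *)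
Definition theta (f : seq (crystal r) -> A) : A :=
  f [:: 1%g; tx; (tx * ty)%g] - f [:: 1%g; ty; (ty * tx)%g].

(** The image of [X - 1] and [Y - 1], the boundaries of degree zero of the Koszul
    complex.  By Poincare duality on the torus the second cohomology of the
    lattice is the quotient by it. *)
Definition boundary m := exists n1 n2, m = (X n1 - n1) + (Y n2 - n2).

Lemma boundary0 : boundary 0.
Proof. by exists 0, 0; rewrite !linear0; zmod. Qed.

Lemma boundaryP (c : K) m n : boundary m -> boundary n -> boundary (c *: m + n).
Proof.
move=> [p1 [p2 ->]] [q1 [q2 ->]]; exists (c *: p1 + q1), (c *: p2 + q2).
by rewrite !linearP /= !scalerDr !scalerN; zmod.
Qed.

Lemma boundaryD m n : boundary m -> boundary n -> boundary (m + n).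
Proof. by move=> bm bn; rewrite -[m]scale1r; exact: boundaryP. Qed.
Lemma boundaryZ (c : K) m : boundary m -> boundary (c *: m).
Proof. by move=> bm; rewrite -[_ *: _]addr0; apply: boundaryP => //; exact: boundary0. Qed.
Lemma boundaryN m : boundary m -> boundary (- m).
Proof. by rewrite -scaleN1r; exact: boundaryZ. Qed.
Lemma boundaryB m n : boundary m -> boundary n -> boundary (m - n).
Proof. by move=> bm bn; apply: boundaryD => //; exact: boundaryN. Qed.
Lemma boundary_sum (I : Type) (s : seq I) (f : I -> A) :
  (forall x, boundary (f x)) -> boundary (\sum_(x <- s) f x).
Proof. by move=> bf; elim/big_ind: _ => // *; [exact: boundary0|exact: boundaryD]. Qed.
Lemma boundary_avg f : (forall i, boundary (f i)) -> boundary (avg f).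
Proof. by move=> bf; apply: boundaryZ; exact: boundary_sum. Qed.
Lemma boundary_isum (f : int -> A) x y :
  (forall z, boundary (f z)) -> boundary (isum f x y).
Proof.
move=> bf; have b z : boundary (iprim f z).
  by case: z => n; rewrite /iprim; [|apply: boundaryN]; exact: boundary_sum.
exact: boundaryB.
Qed.

Lemma tslD v w : tsl (v + w) = (tsl v * tsl w)%g.
Proof. by rewrite crystM /tsl /mkc /= add0r. Qed.

Lemma boundaryX n : boundary (X n - n).
Proof. by exists n, 0; rewrite linear0; zmod. Qed.
Lemma boundaryY n : boundary (Y n - n).
Proof. by exists 0, n; rewrite linear0; zmod. Qed.

Lemma vecE w : w = e1 *~ w.1 + e2 *~ w.2.
Proof.
rewrite [LHS]surjective_pairing [RHS]surjective_pairing; congr (_, _).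
  by rewrite [RHS]raddfD !(raddfMz (@fst int int)) /= mul0rz addr0 intz.
by rewrite [RHS]raddfD !(raddfMz (@snd int int)) /= mul0rz add0r intz.
Qed.

(** A translation is a product of steps along the axes, and each step changes an
    element by a boundary. *)
Lemma boundary_tsl w m : boundary (ad u (tsl w) m - m).
Proof.
have step (t : vec) (z : int) : tsl (t *~ (z + 1)) = (tsl t * tsl (t *~ z))%g.
  by rewrite -tslD mulrzDr mulr1z addrC.
have aux (t : vec) (n : A) (b : int) : (forall n', boundary (ad u (tsl t) n' - n')) ->
    boundary (ad u (tsl (t *~ b)) n - n).
  move=> bt; have := isum_diff (fun z => ad u (tsl (t *~ z)) n) 0 b.
  rewrite mulr0z [tsl 0]/(1%g : crystal r) ad1 => <-; apply: boundary_isum => z.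
  by rewrite step adM.
have bx n' : boundary (ad u (tsl e1) n' - n') by exact: boundaryX.
have by' n' : boundary (ad u (tsl e2) n' - n') by exact: boundaryY.
rewrite [w]vecE tslD adM -[_ - m](subrKA (ad u (tsl (e2 *~ w.2)) m)).
by apply: boundaryD; exact: aux.
Qed.

(** The cocycle that integrates the translates of [m] over the rectangle of a
    triple; the sign makes [m] its value on the fundamental cycle ([theta_area]),
    up to averaging and boundaries. *)
Definition area m a b c : A :=
  avg (fun i => isum (fun x => isum (fun y => - ad u (pt i x y) m)
    (loc i a).2 (loc i b).2) (loc i b).1 (loc i c).1).

(** By equivariance a cochain is, on each unit square, a translate of its value
    on the fundamental cycle. *)
Lemma area_theta f a b c : equivariant u f ->
  ts2 LS a b c (fun x y z => f [:: x; y; z]) = area (theta f) a b c.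
Proof.
move=> ef; apply: avg_eq => i; rewrite /path2; apply: isum_eq => x.
apply: isum_eq => y; rewrite /square /theta linearB /= opprB.
rewrite -!(equivariant2 _ _ _ ef).
have pxy : (pt i x y * (tx * ty))%g = pt i (x + 1) (y + 1).
  by rewrite mulgA -pt_x -pt_y.
by rewrite -txyC pxy -pt_x -pt_y.
Qed.

(** Stokes: if [m = (X n1 - n1) + (Y n2 - n2)], then the sum of the translates
    of [m] over a rectangle is the sum along its boundary of the translates of
    [n1] and [n2]. *)
Lemma area_boundary m : boundary m ->
  exists2 h, equivariant u h & forall a b c, area m a b c = sd h [:: a; b; c].
Proof.
move=> [n1 [n2 mE]].
pose F (g g' : crystal r) : A := if g' == (g * tx)%g then - ad u g n2
  else if g' == (g * ty)%g then ad u g n1 else 0.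
have xy : tx != ty by [].
have Fx g : F g (g * tx)%g = - ad u g n2 by rewrite /F eqxx.
have Fy g : F g (g * ty)%g = ad u g n1.
  by rewrite /F (inj_eq (mulgI _)) eq_sym (negPf xy) eqxx.
have FM g a b : F (g * a)%g (g * b)%g = ad u g (F a b).
  rewrite /F -!mulgA !(inj_eq (mulgI _)) !adM.
  by case: ifP => _; [rewrite linearN|case: ifP => _; rewrite ?linear0].
pose h s : A := if s is [:: a; b] then ts1 LS a b F else 0.
exists h => [g [|a [|b [|c s]]]|a b c]; rewrite ?linear0//.
  rewrite [LHS]/= -[LHS]/(ts1 LS (g * a)%g (g * b)%g F) system1_mul.
  rewrite (system1_lin _ (ad u g)); congr ts1.
  by apply: funext => x; apply: funext => y; exact: FM.
transitivity (ts1 LS b c F - ts1 LS a c F + ts1 LS a b F); last by rewrite /=; zmod.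
rewrite -ts_d2; apply: avg_eq => i; apply: isum_eq => x; apply: isum_eq => y.
rewrite /square.
have pyx : pt i (x + 1) (y + 1) = (pt i x (y + 1) * tx)%g by rewrite -pt_x.
have pxy : pt i (x + 1) (y + 1) = (pt i (x + 1) y * ty)%g by rewrite -pt_y.
rewrite {1}pyx {2}pxy Fx Fy.
rewrite [F (pt i x y) (pt i x (y + 1))](_ : _ = ad u (pt i x y) n1); last by rewrite pt_y Fy.
rewrite [F (pt i x y) (pt i (x + 1) y)](_ : _ = - ad u (pt i x y) n2); last by rewrite pt_x Fx.
rewrite [pt i (x + 1) y]pt_x [pt i x (y + 1)]pt_y !adM mE linearD !linearB /=.
by zmod.
Qed.

Definition area_cochain m (s : seq (crystal r)) : A :=
  if s is [:: a; b; c] then area m a b c else 0.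

(** The area cocycle is the pullback, along the lattice system, of a cochain
    concentrated on one of the two triangles of each unit square; its
    equivariance and closedness follow from those of the system. *)
Lemma area_system m a b c : exists F : crystal r -> crystal r -> crystal r -> A,
  (forall g x y z, F (g * x)%g (g * y)%g (g * z)%g = ad u g (F x y z)) /\
  forall a b c, area m a b c = ts2 LS a b c F.
Proof.
pose F (x y z : crystal r) : A := if (y == (x * ty)%g) && (z == (x * (tx * ty))%g)
  then - ad u x m else 0.
exists F; split=> [g x y z|a' b' c'].
  rewrite /F -!mulgA !(inj_eq (mulgI _)) adM.
  by case: ifP => _; rewrite ?linearN ?linear0.
apply: avg_eq => i; apply: isum_eq => x; apply: isum_eq => y.
have ne : (pt i (x + 1) y == pt i x (y + 1)) = false.
  by rewrite pt_x pt_y (inj_eq (mulgI _)).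
have pxy : (pt i x y * (tx * ty))%g = pt i (x + 1) (y + 1).
  by rewrite mulgA -pt_x -pt_y.
by rewrite /square /F -pt_y pxy !eqxx ne subr0.
Qed.

Lemma area_equivariant m : equivariant u (area_cochain m).
Proof.
have [F [FM aE]] := area_system m 1%g 1%g 1%g.
move=> g [|a [|b [|c [|d s]]]] /=; rewrite ?linear0// !aE system2_mul.
rewrite (system2_lin _ (ad u g)); congr ts2.
by apply: funext => x; apply: funext => y; apply: funext => z; exact: FM.
Qed.

Lemma area_closed m s : sd (area_cochain m) s = 0.
Proof.
have [F [_ aE]] := area_system m 1%g 1%g 1%g.
have [|s4] := eqVneq (size s) 4.
  case: s => [|a [|b [|c [|d [|e s]]]]] // _ /=; rewrite !aE subr0.
  by apply: (zmod_by (ts_d3 LS a b c d F)); zmod.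
rewrite (sd_eq (f2 := fun=> 0)) => [|t tE].
  by rewrite sdE big1// => i _; rewrite scaler0.
by move: t tE s4 => [|? [|? [|? [|? ?]]]] //=; case: s => // ? s /= <-.
Qed.

Lemma boundary_isum_const (f : int -> A) n x y :
  (forall z, boundary (f z - n)) -> boundary (isum f x y - n *~ (y - x)).
Proof. by move=> bf; rewrite -isum_const -isumB; exact: boundary_isum. Qed.

Lemma boundary_pt i x y m : boundary (ad u (pt i x y) m - ad u (mkc 0 i) m).
Proof.
have -> : pt i x y = (tsl (rot r i (x, y)) * mkc 0 i)%g.
  by rewrite crystM /tsl /mkc /= addr0 add0r.
by rewrite adM; exact: boundary_tsl.
Qed.

Lemma boundary_area i m x1 x2 y1 y2 :
  boundary (isum (fun x => isum (fun y => - ad u (pt i x y) m) y1 y2) x1 x2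
            + ad u (mkc 0 i) m *~ ((y2 - y1) * (x2 - x1))).
Proof.
rewrite -[X in _ + X]opprK -mulNrz mulrzA; apply: boundary_isum_const => x.
apply: boundary_isum_const => y.
by rewrite -opprD; apply: boundaryN; exact: boundary_pt.
Qed.

(** Up to boundaries all translates of [m] are equal, so in each frame the area
    cocycle takes on the unit square a multiple of the rotated [m].  The
    multiple is the area of the square computed in that frame, a determinant. *)
Lemma theta_area m :
  boundary (theta (area_cochain m) - avg (fun i => ad u (mkc 0 i) m)).
Proof.
rewrite /theta /= /area -!avgB; apply: boundary_avg => i.
have [p pE] : exists p, p = rot r (- i)%R e1 by eexists.
have [q qE] : exists q, q = rot r (- i)%R e2 by eexists.
have l1 : loc i (1%g : crystal r) = 0 by rewrite /loc raddf0.
have lx : loc i tx = p by [].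
have ly : loc i ty = q by [].
have lxy : loc i (tx * ty)%g = p + q by rewrite /loc pE qE -rotD.
rewrite -txyC l1 lx ly lxy.
have det : p.2 * q.1 - q.2 * p.1 = -1.
  by have := om_rot r (- i)%R e1 e2; rewrite -pE -qE /om /=; lia.
set S1 := isum _ _ _; set S2 := isum _ _ _.
have b1 := boundary_area i m p.1 (p + q).1 0 p.2.
have b2 := boundary_area i m q.1 (p + q).1 0 q.2.
have := boundaryB b1 b2; rewrite -/S1 -/S2.
suff -> : S1 + ad u (mkc 0 i) m *~ ((p.2 - 0) * ((p + q).1 - p.1))
    - (S2 + ad u (mkc 0 i) m *~ ((q.2 - 0) * ((p + q).1 - q.1)))
  = S1 - S2 - ad u (mkc 0 i) m by [].
have s1 : (p + q).1 = p.1 + q.1 :> int by [].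
have -> : (p + q).1 - p.1 = q.1 by rewrite s1; lia.
have -> : (p + q).1 - q.1 = p.1 by rewrite s1; lia.
rewrite !subr0.
have -> : p.2 * q.1 = q.2 * p.1 - 1 by lia.
by rewrite mulrzBr mulr1z; zmod.
Qed.

Section Traces.
Variables (N : nat) (tau : {linear A -> 'rV[K]_N}).
Hypothesis tau_ad : forall g m, tau (ad u g m) = tau m.
Hypothesis tau_surj : forall t, exists m, tau m = t.
Hypothesis tau_ker : forall m, tau m = 0 ->
  boundary (avg (fun i => ad u (mkc 0 i) m)).

Lemma tau_boundary m : boundary m -> tau m = 0.
Proof.
by move=> [n1 [n2 ->]]; rewrite linearD !linearB /= !tau_ad !subrr addr0.
Qed.

Lemma tau_avg m : tau (avg (fun i => ad u (mkc 0 i) m)) = tau m.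
Proof.
rewrite /avg linearZ linear_sum /= (eq_bigr (fun=> tau m)) => [|i _]; last exact: tau_ad.
by rewrite sumr_const card_ord -scaler_nat scalerA mulVf ?scale1r// (ma_ell M).
Qed.

Lemma tau_theta_area m : tau (theta (area_cochain m)) = tau m.
Proof.
by apply/subr0_eq; rewrite -(tau_avg m) -linearB tau_boundary//; exact: theta_area.
Qed.

(** By the prism homotopy the area cocycle of [m] is cohomologous to that of its
    own value on the fundamental cycle.  Up to boundaries this value is the
    average of [m], a boundary by assumption, and [area_boundary] applies. *)
Lemma area_coboundary m : tau m = 0 ->
  exists2 h, equivariant u h & forall a b c, area m a b c = sd h [:: a; b; c].
Proof.
move=> tm; have bm : boundary (theta (area_cochain m)).
  by rewrite -[theta _](subrK (avg (fun i => ad u (mkc 0 i) m))); apply: boundaryD;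
    [exact: theta_area|exact: tau_ker].
have [h eh hE] := area_boundary bm.
exists (fun s => prism LS (area_cochain m) s + h s).
  by apply: equivariant_add => //; apply: prism_equivariant; exact: area_equivariant.
move=> a b c; rewrite sd_add -hE -(area_theta _ _ _ (area_equivariant m)).
exact: (prism2 LS (area_closed m) a b c).
Qed.

(** The isomorphism evaluates a cocycle on the fundamental cycle and takes the
    trace [tau]; the area cocycles realize all values. *)
Lemma HH2_iso : lmod_iso (HH A 2) 'rV[K]_N.
Proof.
pose t (F : cocycles A 2) := tau (theta (hom u (\val F))).
have lt : linear t.
  move=> c F1 F2; rewrite /t linearP hom_linear -linearP; apply: (congr1 tau).
  by rewrite /theta !fctE scalerBr; zmod.
pose T : {linear cocycles A 2 -> 'rV[K]_N} := HB.pack t (GRing.isLinear.Build K _ _ *:%R t lt).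
apply: (@lmod_quot_iso _ _ _ _ T) => [F|w].
  have [eF dF] := hom_cocycle u (valP F); have /asboolP[mF _] := valP F.
  rewrite -[T F]/(t F) /t; split=> [t0|/asboolP cF].
    apply/asboolP; have [h eh hE] := area_coboundary t0.
    apply: (@cob_of_hom _ _ _ u _ _ (fun s => prism LS (hom u (\val F)) s + h s)) => //.
      by apply: equivariant_add => //; exact: prism_equivariant.
    move=> [|a [|b [|c [|d s]]]] // _; rewrite sd_add -hE -area_theta//.
    exact: (prism2 LS dF).
  have [h eh hE] := hom_of_cob u cF.
  apply: tau_boundary; exists (h [:: 1%g; ty]), (- h [:: 1%g; tx]).
  rewrite /theta !hE /= !subr0 linearN /= -!(equivariant1 _ _ eh) -txyC.
  by zmod.
have [m mE] := tau_surj w.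
have cF : dehom u (area_cochain m) \in cocycle (n := 2).
  by apply: dehom_cocycle => [|s _]; [exact: area_equivariant|exact: area_closed].
exists (exist _ (dehom u (area_cochain m)) cF).
rewrite -[T _]/(t _) /t /= -mE -[RHS]tau_theta_area; apply: (congr1 tau).
by rewrite /theta !hom_dehom//; exact: area_equivariant.
Qed.

End Traces.

End Cohomology2.

(** * Traces from conjugacy classes *)

Section ClassTrace.
Variables (K : fieldType) (A : assocAlgType K) (r : rotation).
Variable u : twisted_basis A (crystal r).
Variable M : monomial_action u.
Local Notation tsl := (@tsl r).
Implicit Types (j k : 'I_(rord r).+2) (v w : vec) (m : A) (g h : crystal r).

(** A numbering of the conjugacy classes of torsion elements: the identity and
    the proper rotations.  Nonzero translations have no class, since conjugation
    multiplies their basis elements by nontrivial scalars and no trace is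
    supported there. *)
Record class_function (N : nat) := ClassFunction {
  cls : crystal r -> option 'I_N;
  cls0 : forall v, isSome (cls (mkc v 0)) = (v == 0);
  cls_inv : forall w j v k, k != 0 ->
    cls (mkc (rot r j v + (w - rot r k w)) k) = cls (mkc v k);
  cls_surj : forall i : 'I_N, exists g, cls g = Some i;
  cls_some : forall v k, k != 0 -> isSome (cls (mkc v k));
  cls_conj : forall v v' k k', cls (mkc v k) = cls (mkc v' k') ->
    k != 0 -> k = k' /\ exists j w, v' = rot r j v + (w - rot r k w)
}.

Variables (N : nat) (C : class_function N).
Local Notation cl := (cls C).

Definition trace : A -> 'rV[K]_N := tb_ext u (fun g => oapp (delta_mx 0) 0 (cl g)).
HB.instance Definition _ := GRing.Linear.on trace.

Lemma traceU g : trace (u g) = oapp (delta_mx 0) 0 (cl g).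
Proof. exact: tb_extU. Qed.

Lemma rot_eq0 j v : (rot r j v == 0) = (v == 0).
Proof.
apply/eqP/eqP => [e|->]; last exact: raddf0.
by rewrite -[v](rotVK j) e raddf0.
Qed.

Lemma trace_ad g m : trace (ad u g m) = trace m.
Proof.
pose f1 : {linear A -> 'rV[K]_N} := trace \o ad u g.
move: m; apply: (@crystal_lin_eq _ _ _ u _ f1 trace) => v k; rewrite /f1 /=.
case: g {f1} => w j; rewrite -[(w, j)]/(mkc w j).
have [->|k0] := eqVneq k 0; last by rewrite (ma_ad M)// !traceU cls_inv.
rewrite (ma_ad0 M) linearZ /= !traceU.
have [->|v0] := eqVneq v 0; first by rewrite !raddf0 ma_char1 scale1r.
have nz v' : v' != 0 -> cl (mkc v' 0) = None.
  move=> nv; apply/eqP; rewrite -[_ == _]negbK.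
  by case: (cl _) (cls0 C v') => // ?; rewrite (negPf nv).
by rewrite !nz ?rot_eq0// scaler0.
Qed.

Lemma trace_surj t : exists m, trace m = t.
Proof.
have rep i : exists g, cl g == Some i by have [g /eqP ?] := cls_surj C i; exists g.
exists (\sum_i t 0 i *: u (xchoose (rep i))).
rewrite linear_sum [RHS]row_sum_delta; apply: eq_bigr => i _.
by rewrite linearZ /= traceU (eqP (xchooseP (rep i))).
Qed.

Local Notation av m := (@avg r K A (fun i => ad u (mkc 0 i) m)).

Lemma boundary_u0 v : v != 0 -> boundary u (u (mkc v 0)).
Proof.
move=> v0; have : (v.1 != 0) || (v.2 != 0).
  by rewrite -negb_and; apply: contra v0 => /andP[/eqP a /eqP b]; rewrite [v]surjective_pairing a b.
have aux w : ma_char M w v != 1 -> u (mkc v 0)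
    = (ma_char M w v - 1)^-1 *: (ad u (tsl w) (u (mkc v 0)) - u (mkc v 0)).
  move=> ne; rewrite (ad_tsl0 M).
  rewrite (_ : _ - u _ = (ma_char M w v - 1) *: u (mkc v 0)); last by rewrite scalerBl scale1r.
  by rewrite scalerA mulVf ?scale1r// subr_eq0.
case/orP => vi.
  by rewrite (aux e2) ?ma_char_e2//; apply: boundaryZ; exact: boundaryY.
by rewrite (aux e1) ?ma_char_e1//; apply: boundaryZ; exact: boundaryX.
Qed.

Lemma boundary_av_ad g m : boundary u (av (ad u g m) - av m).
Proof.
case: g => w j; rewrite -[(w, j)]/(mkc w j) [X in _ - X](avg_reindex j) -avgB.
apply: boundary_avg => i; rewrite -adM.
have -> : (mkc 0 i * mkc w j = tsl (rot r i w) * mkc 0 (j + i)%R)%g.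
  rewrite !crystM; congr (_, _); first by rewrite [LHS]add0r [RHS]addr0.
  by rewrite [RHS]add0r [RHS]addrC.
by rewrite adM; exact: boundary_tsl.
Qed.

(** Modulo boundaries the average of a basis element depends on its class only,
    and it vanishes for a nonzero translation; so the average of [m] is a
    combination of averages of representatives with the coordinates of
    [trace m] as coefficients. *)
Lemma trace_ker m : trace m = 0 -> boundary u (av m).
Proof.
have rep i : exists g, cl g == Some i by have [g /eqP ?] := cls_surj C i; exists g.
pose R i := u (xchoose (rep i)).
pose f1 : {linear A -> A} := tb_ext u (fun g => oapp (fun i => av (R i)) 0 (cl g)).
have f1E m' : f1 m' = \sum_i trace m' 0 i *: av (R i).
  pose f2 m' := \sum_i trace m' 0 i *: av (R i).
  have l2 : linear f2.
    move=> c x y; rewrite /f2 scaler_sumr -big_split; apply: eq_bigr => i _ /=.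
    by rewrite linearP !mxE scalerDl -scalerA.
  pose F2 : {linear A -> A} := HB.pack f2 (GRing.isLinear.Build K _ _ *:%R f2 l2).
  apply: (@tb_lin_eq _ _ _ u _ f1 F2) => g; rewrite /f1 /F2 /= /f2 tb_extU traceU.
  case: (cl g) => [i|] /=; last by rewrite big1// => i _; rewrite mxE scale0r.
  rewrite (bigD1 i)//= mxE !eqxx scale1r big1 ?addr0// => i' ne.
  by rewrite mxE (negPf ne) andbF scale0r.
have key : boundary u (av m - f1 m).
  move: m; apply: (tb_ind (u := u)) => [|c x y bx by'|[v k]].
  - rewrite linear0 subr0 /avg big1 ?scaler0; first exact: boundary0.
    by move=> i _; rewrite linear0.
  - have -> : av (c *: x + y) - f1 (c *: x + y) = c *: (av x - f1 x) + (av y - f1 y).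
      rewrite linearP scalerBr /avg (eq_bigr _ (fun i _ => linearP _ c x y)) /= big_split /=.
      by rewrite -scaler_sumr scalerDr !scalerA [_ * c]mulrC; zmod.
    exact: boundaryP.
  - rewrite -[(v, k)]/(mkc v k) /f1 /= tb_extU.
    case E : (cl (mkc v k)) => [i|] /=; last first.
      have k0 : k = 0.
        by apply/eqP; apply: contraT => /(cls_some C v); rewrite E.
      have v0 : v != 0 by rewrite -(cls0 C) -k0 E.
      rewrite subr0; apply: boundary_avg => j; rewrite k0 (ma_ad0 M).
      by apply: boundaryZ; apply: boundary_u0; rewrite rot_eq0.
    have [g gE] : exists g, ad u g (R i) = u (mkc v k).
      rewrite /R; move: (xchoose _) (eqP (xchooseP (rep i))) => [v' k'].
      rewrite -[(v', k')]/(mkc v' k') => E'.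
      have [k'0|k'0] := eqVneq k' 0; last first.
        have [<- [j [w ->]]] := cls_conj (etrans E' (esym E)) k'0.
        by exists (mkc w j); rewrite (ma_ad M).
      have k0 : k = 0.
        apply/eqP; apply: contraT => kn.
        by have [kk _] := cls_conj (etrans E (esym E')) kn; rewrite kk k'0 eqxx in kn.
      subst k k'; move: (cls0 C v) (cls0 C v'); rewrite E E' /= => /esym/eqP -> /esym/eqP ->.
      by exists 1%g; rewrite ad1.
    by rewrite -gE; exact: boundary_av_ad.
move=> t0; move: key; rewrite f1E t0 big1 ?subr0// => i _.
by rewrite mxE scale0r.
Qed.

Lemma HH2_iso_classes : lmod_iso (HH A 2) 'rV[K]_N.
Proof. exact: (HH2_iso M trace_ad trace_surj trace_ker). Qed.

End ClassTrace.

(** * The normalized basis *)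

Section IntegerCocycle.
Variables (r : rotation) (L : int).
Local Notation ell := (rord r).+2.
Local Notation index := 'I_ell.
Implicit Types (j k : 'I_(rord r).+2) (v w : vec) (g h : crystal r).

Lemma vecD1 v w : (v + w).1 = v.1 + w.1. Proof. by []. Qed.
Lemma vecD2 v w : (v + w).2 = v.2 + w.2. Proof. by []. Qed.
Lemma vecN1 v : (- v).1 = - v.1. Proof. by []. Qed.
Lemma vecN2 v : (- v).2 = - v.2. Proof. by []. Qed.

Lemma omDl v1 v2 w : om (v1 + v2) w = om v1 w + om v2 w.
Proof. by rewrite /om vecD1 vecD2; ring. Qed.
Lemma omDr v w1 w2 : om v (w1 + w2) = om v w1 + om v w2.
Proof. by rewrite /om vecD1 vecD2; ring. Qed.
Lemma om0l v : om 0 v = 0. Proof. by rewrite /om !mul0r. Qed.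
Lemma omC v w : om v w = - om w v. Proof. by rewrite /om; ring. Qed.
Lemma omvv v : om v v = 0. Proof. by rewrite /om; ring. Qed.

(** The determinant of [1 - rot k]. *)
Definition disc (k : nat) : int := 2 - ((rot r k e1).1 + (rot r k e2).2).

(** The exponent by which the product of a Weyl element and a power of the
    rotation has to be rescaled for conjugation to act without scalars.  For a
    translation [disc] is zero, but so is [om g.1 g.1]. *)
Definition mu g : int := (L %/ disc g.2)%Z * om g.1 (rot r g.2 g.1).

(** The cocycle of the rescaled basis, as an exponent of [z]: the Weyl cocycle
    [L om] plus the coboundary of [mu]. *)
Definition cexp g h : int := mu (g * h)%g - mu g - mu h + L * om g.1 (rot r g.2 h.1).

Lemma mu0 v : mu (mkc v 0) = 0.
Proof. by rewrite /mu rot0 omvv mulr0. Qed.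

Lemma cexpA f g h : cexp f g + cexp (f * g)%g h = cexp g h + cexp f (g * h)%g.
Proof.
have e1 : (f * g)%g.1 = f.1 + rot r f.2 g.1 by [].
have e2 : (g * h)%g.1 = g.1 + rot r g.2 h.1 by [].
have e3 v : rot r (f * g)%g.2 v = rot r f.2 (rot r g.2 v) by exact: rotDi.
have e4 : om g.1 (rot r g.2 h.1) = om (rot r f.2 g.1) (rot r f.2 (rot r g.2 h.1)).
  by rewrite om_rot.
rewrite /cexp e1 e2 e3 rotD e4 omDl omDr mulgA; ring.
Qed.

Lemma cexp1 g : cexp 1%g g = 0.
Proof. by rewrite /cexp mul1g -[mu 1%g]/(mu (mkc 0 0)) mu0 om0l; ring. Qed.

Lemma rotC (j k : nat) v : rot r j (rot r k v) = rot r k (rot r j v).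
Proof. by rewrite -!rot_add addnC. Qed.

Lemma rot_lin (k : nat) v : rot r k v = rot r k e1 *~ v.1 + rot r k e2 *~ v.2.
Proof. by rewrite {1}(vecE v) raddfD !raddfMz. Qed.

Lemma vec_mulz v (n : int) : v *~ n = (v.1 * n, v.2 * n).
Proof.
by rewrite [LHS]surjective_pairing (raddfMz (@fst int int)) (raddfMz (@snd int int)) /= !mulrzz.
Qed.

Lemma rot_mx (k : nat) : exists p q s t : int, [/\ p * t - q * s = 1,
  disc k = 2 - (p + t) &
  forall v, rot r k v = (p * v.1 + q * v.2, s * v.1 + t * v.2)].
Proof.
exists (rot r k e1).1, (rot r k e2).1, (rot r k e1).2, (rot r k e2).2; split=> //.
  by apply: etrans (om_rot r k e1 e2); rewrite /om; ring.
by move=> v; rewrite [LHS]rot_lin !vec_mulz; congr (_, _); rewrite /=; ring.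
Qed.

(** The variation of the quadratic form [om v (rot k v)] along an orbit of the
    translations is [disc k] times the exponent that the Weyl relations produce
    when a translation is moved across a rotation.  This is what makes the
    choice of [mu] work. *)
Lemma om_orbit (k : nat) y w : om (y + (w - rot r k w)) (rot r k (y + (w - rot r k w)))
   - om y (rot r k y) + disc k * (om w y - om (y + (w - rot r k w)) (rot r k w)) = 0.
Proof.
have [p [q [s [t [det dE rE]]]]] := rot_mx k.
rewrite {}dE !{}rE; case: y w => [y1 y2] [w1 w2]; rewrite /om.
rewrite !(vecD1, vecD2, vecN1, vecN2) /=.
(* The identity holds modulo the determinant relation, with this cofactor. *)
transitivity ((p * t - q * s - 1)
  * (w1 * (s * w1 + t * w2) - w2 * (p * w1 + q * w2) - 2 * (w1 * y2 - w2 * y1))).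
  ring.
by rewrite det subrr mul0r.
Qed.

Definition integral_rotation := forall k, k != 0 -> disc k != 0 /\ (disc k %| L)%Z.

(** Solves [v = w - rot k w] by Cramer's rule, rounding down: the error is
    constant on the orbits of the translations. *)
Definition quotient (k : nat) v : vec :=
  let a := rot r k e1 in let b := rot r k e2 in
  ((((1 - b.2) * v.1 + b.1 * v.2) %/ disc k)%Z,
   ((a.2 * v.1 + (1 - a.1) * v.2) %/ disc k)%Z).

Lemma quotientE (k : nat) v w : disc k != 0 ->
  quotient k (v + (w - rot r k w)) = quotient k v + w.
Proof.
move=> d0; have det := om_rot r k e1 e2; rewrite /om in det.
have -> : rot r k w = ((rot r k e1).1 * w.1 + (rot r k e2).1 * w.2,
                       (rot r k e1).2 * w.1 + (rot r k e2).2 * w.2).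
  by rewrite rot_lin !vec_mulz; congr (_, _); rewrite /=; ring.
rewrite /quotient /disc in d0 *.
move: (rot r k e1) (rot r k e2) det d0 => [p s] [q t] /= det d0.
case: v w => [v1 v2] [w1 w2] /=.
have e1 : (1 - t) * (v1 + (w1 - (p * w1 + q * w2))) + q * (v2 + (w2 - (s * w1 + t * w2)))
  = w1 * (2 - (p + t)) + ((1 - t) * v1 + q * v2) + (p * t - s * q - 1) * w1 by ring.
have e2 : s * (v1 + (w1 - (p * w1 + q * w2))) + (1 - p) * (v2 + (w2 - (s * w1 + t * w2)))
  = w2 * (2 - (p + t)) + (s * v1 + (1 - p) * v2) + (p * t - s * q - 1) * w2 by ring.
have z : p * t - s * q - 1 = 0 by rewrite det /=; ring.
congr (_, _); rewrite /=.
  by rewrite e1 z mul0r addr0 divzMDl// addrC.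
by rewrite e2 z mul0r addr0 divzMDl// addrC.
Qed.

Section Action.
Variables (K : fieldType) (A : assocAlgType K) (z : K).
Variable u : twisted_basis A (crystal r).
Hypothesis z_neq0 : z != 0.
Hypothesis z_not_root : forall n : nat, (0 < n)%N -> z ^+ n != 1.
Hypothesis L_neq0 : L != 0.
Hypothesis integral : integral_rotation.
Hypothesis uE : forall g h, tb_cocycle u g h = z ^ cexp g h.

Lemma expz_eq1 n : (z ^ n == 1) = (n == 0).
Proof.
case: n => [[|n]|n]; first by rewrite expr0z !eqxx.
  by apply/negbTE; exact: z_not_root.
by rewrite NegzE -invr_expz invr_eq1; apply/negbTE; exact: z_not_root.
Qed.

Lemma ad_basis g h :
  ad u g (u h) = z ^ (cexp g h - cexp (g * h * g^-1)%g g) *: u (g * h * g^-1)%g.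
Proof.
set h' := (g * h * g^-1)%g.
have gh : (h' * g = g * h)%g by rewrite /h' mulgVK.
have : u h' ** u g = z ^ (cexp h' g) *: u (g * h)%g by rewrite tbM uE gh.
move=> e; rewrite /ad tbM uE.
have -> : u (g * h)%g = z ^ (- cexp h' g) *: (u h' ** u g).
  by rewrite e scalerA -expfzDr// addNr expr0z scale1r.
by rewrite scalerA -expfzDr// amulZl -amulA tbbV amulx1.
Qed.

Lemma conj_mkc w j v k :
  (mkc w j * mkc v k * (mkc w j)^-1)%g = mkc (rot r j v + (w - rot r k w)) k :> crystal r.
Proof.
apply: (mulIg (mkc w j)); rewrite mulgVK !crystM; congr (_, _); last exact: addrC.
by rewrite -[RHS]/(rot r j v + (w - rot r k w) + rot r k w) addrA subrK addrC.
Qed.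

Lemma action_exp w j v k :
  cexp (mkc w j) (mkc v k) - cexp (mkc (rot r j v + (w - rot r k w)) k) (mkc w j)
  = mu (mkc (rot r j v + (w - rot r k w)) k) - mu (mkc v k)
    + L * (om w (rot r j v) - om (rot r j v + (w - rot r k w)) (rot r k w)).
Proof.
have gh : (mkc (rot r j v + (w - rot r k w)) k * mkc w j = mkc w j * mkc v k)%g.
  by rewrite -conj_mkc mulgVK.
by rewrite /cexp gh /=; ring.
Qed.

Lemma action_exp0 w j v k : k != 0 ->
  cexp (mkc w j) (mkc v k) - cexp (mkc (rot r j v + (w - rot r k w)) k) (mkc w j) = 0.
Proof.
move=> k0; rewrite action_exp; have [d0 dL] := integral k0.
have := om_orbit k (rot r j v) w; set v' : vec := rot r j v + _; move=> orb.
have -> : L * (om w (rot r j v) - om v' (rot r k w))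
  = (L %/ disc k)%Z * (disc k * (om w (rot r j v) - om v' (rot r k w))).
  by rewrite mulrA divzK.
rewrite /mu /= -[om v _](om_rot r j) [rot r j (rot r k v)]rotC -mulrBr -mulrDr.
by rewrite orb mulr0.
Qed.

(** Since [z] is not a root of unity, the characters [z ^ (2 L om w v)] of the
    lattice are trivial only where the exponents vanish. *)
Lemma lattice_action : ell%:R != 0 :> K ->
  (forall v, \sum_(j < ell) rot r j v = 0) -> monomial_action u.
Proof.
move=> ell0 rs.
have chi n : L * (2 * n) = 0 <-> n = 0.
  split=> [/eqP|->]; last by rewrite !mulr0.
  by rewrite !mulf_eq0 (negPf L_neq0) /= => /eqP.
apply: (@MonomialAction _ _ _ _ (fun w v => z ^ (L * (2 * om w v))) quotient) => //.
- by move=> w; rewrite (_ : om w 0 = 0) ?mulr0 ?expr0z// /om /= !mulr0.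
- move=> v; rewrite expz_eq1; apply/eqP/eqP => [/chi|v0].
    by rewrite /om /= mul1r mul0r subr0.
  by apply/chi; rewrite /om /= v0; ring.
- move=> v; rewrite expz_eq1; apply/eqP/eqP => [/chi|v0].
    by rewrite /om /= mul1r mul0r sub0r => /eqP; rewrite oppr_eq0 => /eqP.
  by apply/chi; rewrite /om /= v0; ring.
- move=> w j v; have e : rot r j v + (w - rot r (0%R : index) w) = rot r j v.
    by rewrite rot0 subrr addr0.
  rewrite ad_basis conj_mkc action_exp e !mu0; congr (z ^ _ *: _).
  by rewrite rot0 (omC (rot r j v)); ring.
- move=> w j v k k0; rewrite ad_basis conj_mkc action_exp0//.
  by rewrite expr0z scale1r.
- by move=> k v w /integral[d0 _]; exact: quotientE.
Qed.

End Action.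
End IntegerCocycle.

(** * A basis for an algebra given by generators and relations *)

Section QuotientLift.
Variables (K : pzRingType) (V W : lmodType K) (S : submodClosed V).
Variable t : {linear V -> W}.
Definition qlift of (forall x, x \in S -> t x = 0) := fun (x : lmod_quot S) => t (repr x) : W.

Hypothesis tS : forall x, x \in S -> t x = 0.

Lemma qlift_pi x : qlift tS (lmod_pi S x) = t x.
Proof.
by apply/subr0_eq; rewrite -linearB; apply: tS; apply/lmod_piP; exact: lmod_piE.
Qed.

Fact qlift_linear : linear (qlift tS).
Proof.
move=> c x y; rewrite -(lmod_piE x) -(lmod_piE y).
by rewrite [c *: _]lmod_piZ -lmod_piD !qlift_pi linearP.
Qed.
HB.instance Definition _ := GRing.isLinear.Build K _ _ *:%R (qlift tS) qlift_linear.
End QuotientLift.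

Section Presentation.
Variables (I : choiceType) (G : groupType).
Variable c : G -> G -> int.
Hypothesis cA : forall f g h, c f g + c (f * g)%g h = c g h + c f (g * h)%g.
Hypothesis c1 : forall g, c 1%g g = 0.

Variable letter : I -> G.

(** The value of a word in the central extension of [G] by [int] with cocycle
    [c]. *)
Fixpoint word (s : seq I) : int * G :=
  if s is i :: s' then
    ((word s').1 + c (letter i) (word s').2, (letter i * (word s').2)%g)
  else (0, 1%g).

Lemma word_cat s t : word (s ++ t) =
  ((word s).1 + (word t).1 + c (word s).2 (word t).2, ((word s).2 * (word t).2)%g).
Proof.
elim: s => [|i s IH] /=.
  by rewrite c1 mul1g add0r addr0; case: (word t).
rewrite IH /= mulgA; congr (_, _).
have := cA (letter i) (word s).2 (word t).2; lia.
Qed.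

Variables (K : fieldType) (z : K).
Hypothesis z_neq0 : z != 0.

Definition word_elt (w : {fmonom I}) : {malg K[G]} :=
  z ^ (word w).1 *: << (word w).2 >>.

(** The candidate for the coordinate map.  The twisted product on the target is
    only used through the multiplications [lmul_word] and [rmul_word] by
    words, which suffices to see that the kernel of [value] is an ideal. *)
Definition value : free_alg K I -> {malg K[G]} := lext word_elt.
HB.instance Definition _ := GRing.Linear.on value.

Lemma valueP k x y : value (k *: x + y) = k *: value x + value y.
Proof. exact: (linearP value). Qed.

Definition monom (w : {fmonom I}) : free_alg K I := << w >>.

Lemma free_alg_ind (P : free_alg K I -> Prop) :
  P 0 -> (forall (k : K) x y, P x -> P y -> P (k *: x + y)) ->
  (forall w, P (monom w)) -> forall x, P x.
Proof. exact: malg_ind. Qed.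

Lemma free_alg_mulPr (k : K) (a x y : free_alg K I) :
  a * (k *: x + y) = k *: (a * x) + a * y.
Proof. by rewrite mulrDr; congr (_ + _); rewrite -free_alg_scalerAr. Qed.

Lemma free_alg_mulPl (k : K) (a x y : free_alg K I) :
  (k *: x + y) * a = k *: (x * a) + y * a.
Proof. by rewrite mulrDl; congr (_ + _); rewrite [RHS]scalerAl. Qed.

Lemma valueU w : value (monom w) = word_elt w.
Proof. exact: lextU. Qed.

Lemma monomM (w1 w2 : {fmonom I}) :
  monom w1 * monom w2 = monom (mmul w1 w2).
Proof. by rewrite [LHS]malgM_def fgmulUU mulr1. Qed.

Definition lmul_word (w : {fmonom I}) : {malg K[G]} -> {malg K[G]} :=
  lext (fun g => z ^ ((word w).1 + c (word w).2 g) *: << ((word w).2 * g)%g >>).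
Definition rmul_word (w : {fmonom I}) : {malg K[G]} -> {malg K[G]} :=
  lext (fun g => z ^ ((word w).1 + c g (word w).2) *: << (g * (word w).2)%g >>).
HB.instance Definition _ w := GRing.Linear.on (lmul_word w).
HB.instance Definition _ w := GRing.Linear.on (rmul_word w).

Lemma lmul_wordP w k x y : lmul_word w (k *: x + y) = k *: lmul_word w x + lmul_word w y.
Proof. exact: (linearP (lmul_word w)). Qed.
Lemma rmul_wordP w k x y : rmul_word w (k *: x + y) = k *: rmul_word w x + rmul_word w y.
Proof. exact: (linearP (rmul_word w)). Qed.

Lemma value_lmul w x : value (monom w * x) = lmul_word w (value x).
Proof.
move: x; apply: free_alg_ind => [|k x y ex ey|w'].
- by rewrite mulr0 !linear0.
- by rewrite free_alg_mulPr !valueP lmul_wordP; exact: (congr2 (fun s t => k *: s + t) ex ey).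
- rewrite monomM !valueU /word_elt fmM word_cat /= linearZ /= /lmul_word lextU.
  by rewrite scalerA -expfzDr//; congr (z ^ _ *: _); lia.
Qed.

Lemma value_rmul w x : value (x * monom w) = rmul_word w (value x).
Proof.
move: x; apply: free_alg_ind => [|k x y ex ey|w'].
- by rewrite mul0r !linear0.
- by rewrite free_alg_mulPl !valueP rmul_wordP; exact: (congr2 (fun s t => k *: s + t) ex ey).
- rewrite monomM !valueU /word_elt fmM word_cat /= linearZ /= /rmul_word lextU.
  by rewrite scalerA -expfzDr//; congr (z ^ _ *: _); lia.
Qed.

Variable rel : set (free_alg K I).
Hypothesis value_rel : forall x, rel x -> value x = 0.

Lemma value_ideal x : x \in gen_ideal rel -> value x = 0.
Proof.
move=> /asboolP/(_ [set y | value y = 0]%classic); apply; split; last exact: value_rel.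
have lmul0 a y : value y = 0 -> value (a * y) = 0.
  move=> y0; move: a; apply: free_alg_ind => [|k a b ea eb|w].
  - by rewrite mul0r linear0.
  - rewrite free_alg_mulPl valueP; apply: etrans (congr2 (fun s t => k *: s + t) ea eb) _.
    by rewrite scaler0 addr0.
  - by rewrite value_lmul y0 linear0.
have rmul0 a y : value y = 0 -> value (y * a) = 0.
  move=> y0; move: a; apply: free_alg_ind => [|k a b ea eb|w].
  - by rewrite mulr0 linear0.
  - rewrite free_alg_mulPr valueP; apply: etrans (congr2 (fun s t => k *: s + t) ea eb) _.
    by rewrite scaler0 addr0.
  - by rewrite value_rmul y0 linear0.
split=> [|x1 x2 /= e1 e2|a y b /= e]; rewrite /= ?linear0//.
  by rewrite linearD /= e1 e2 addr0.
exact/rmul0/lmul0.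
Qed.

Local Notation Q := (alg_quot rel).
Local Notation pi := (@alg_pi K (free_alg K I) rel).

Fact alg_pi_linear : linear (pi : free_alg K I -> Q).
Proof. by move=> k x y; rewrite [LHS]lmod_piD -lmod_piZ. Qed.
HB.instance Definition _ := GRing.isLinear.Build K _ _ *:%R pi alg_pi_linear.

Variable u : G -> Q.
Hypothesis u1 : u 1%g = pi 1.
Hypothesis uM : forall g h, u g ** u h = z ^ c g h *: u (g * h)%g.
Hypothesis u_letter : forall i, pi (free_gen K i) = u (letter i).
Hypothesis word_surj : forall g, exists s, (word s).2 = g.

Lemma monomE (s : seq I) : monom (FMonom s) = \prod_(i <- s) free_gen K i.
Proof.
elim: s => [|i s IH]; first by rewrite big_nil /monom -fmoneE.
rewrite big_cons -IH -[free_gen K i]/(monom (fmu i)) monomM; congr monom.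
by apply/eqP; rewrite fmP; apply/eqP; rewrite fmM fmU.
Qed.

Lemma pi_word (s : seq I) : pi (monom (FMonom s)) = z ^ (word s).1 *: u (word s).2.
Proof.
rewrite monomE; elim: s => [|i s IH] /=.
  by rewrite big_nil expr0z scale1r u1.
rewrite big_cons -[LHS]alg_piM.
rewrite -[LHS]/(pi (free_gen K i) ** pi (\prod_(j <- s) free_gen K j)) IH u_letter.
have -> : u (letter i) ** (z ^ (word s).1 *: u (word s).2)
  = z ^ (word s).1 *: (u (letter i) ** u (word s).2) by exact: amulZr.
apply: etrans (congr1 (fun y => z ^ (word s).1 *: y) (uM _ _)) _.
apply: etrans (scalerA _ _ _) _.
exact: (congr1 (fun k => k *: _) (esym (expfzDr _ _ z_neq0))).
Qed.

Definition coord : Q -> {malg K[G]} := qlift (t := value) value_ideal.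
HB.instance Definition _ := GRing.Linear.on coord.

Lemma coord_pi x : coord (pi x) = value x.
Proof. exact: qlift_pi. Qed.

Lemma coordU g : coord (u g) = << g >>.
Proof.
have [s <-] := word_surj g.
have -> : u (word s).2 = z ^ (- (word s).1) *: pi (monom (FMonom s)).
  by rewrite pi_word scalerA -expfzDr// addNr expr0z scale1r.
rewrite linearZ /= coord_pi valueU /word_elt scalerA -expfzDr//.
by rewrite addNr expr0z scale1r.
Qed.

Lemma coordK : cancel coord (lext u).
Proof.
move=> x; rewrite -(lmod_piE x); move: (repr x) => {}x.
rewrite -[lmod_pi _ _]/(pi x) coord_pi; move: x.
apply: free_alg_ind => [|k x y ex ey|w].
- by rewrite !linear0.
- by rewrite !linearP /= ex ey.
- by rewrite valueU /word_elt lext_scaleU -pi_word fmK.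
Qed.

(** In the quotient, words are multiples of the [u g], so that these span; they
    are independent because [value] factors through the quotient and separates
    them. *)
Definition presented_basis : twisted_basis Q G.
Proof.
apply: (@TwistedBasis _ _ _ u coord (fun g h => z ^ c g h)) => //.
- exact: coordU.
- exact: can_inj coordK.
- by move=> g h; exact: expfz_neq0.
Defined.

End Presentation.

(** * Weyl relations in a group *)

Section IntegerPowers.
Variable H : groupType.
Implicit Types (a b x y : H) (m n : int).
Local Open Scope group_scope.

Definition gz x n : H :=
  match n with Posz k => x ^+ k | Negz k => x ^- k.+1 end.

Lemma gzS x n : gz x (n + 1)%R = gz x n * x.
Proof.
case: n => [k|[|k]].
- by rewrite -[(Posz k + 1)%R]/(Posz (k + 1)) addn1 /= expgSr.
- by rewrite /= expg1 mulVg.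
- rewrite (_ : (Negz k.+1 + 1)%R = Negz k); last by rewrite !NegzE; lia.
  by rewrite /= [x ^+ k.+2]expgS invgM mulgVK.
Qed.

(** Identities on integer powers follow by comparing the factors acquired at
    each step. *)
Lemma gz_uniq (F : int -> H) a n : (forall m, F (m + 1)%R = F m * a) -> F n = F 0%R * gz a n.
Proof.
move=> FS; have e : F n / gz a n = F 0%R / gz a 0.
  apply: (@int_shift_const H (fun m => F m / gz a m)) => m.
  by rewrite FS gzS invgM mulgA mulgK.
by rewrite -[LHS](mulgVK (gz a n)) e -[gz a 0]/(1 : H) divg1.
Qed.

Lemma gz0 x : gz x 0 = 1. Proof. by []. Qed.

Lemma gzD x m n : gz x (m + n)%R = gz x m * gz x n.
Proof.
rewrite (@gz_uniq (fun k => gz x (m + k)%R) x n) ?addr0// => k.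
by rewrite addrA gzS.
Qed.

Lemma gz_conj x a n : gz (x * a * x^-1) n = x * gz a n * x^-1.
Proof.
rewrite [RHS](@gz_uniq (fun n => x * gz a n * x^-1) (x * a * x^-1)) => [|m].
  by rewrite gz0 mulg1 mulgV mul1g.
by rewrite gzS !mulgA mulgVK.
Qed.

Lemma gz_comm x a n : commute x a -> commute x (gz a n).
Proof.
move=> xa; have := gz_conj x a n; rewrite xa mulgK => /(congr1 ( *%g^~ x)).
by rewrite mulgVK /commute => ->.
Qed.

Lemma gzM a b n : commute a b -> gz (a * b) n = gz a n * gz b n.
Proof.
move=> ab; apply/esym.
rewrite [LHS](@gz_uniq (fun n => gz a n * gz b n) (a * b)) ?mul1g// => m.
rewrite !gzS !mulgA; congr (_ * _); rewrite -!mulgA; congr (_ * _).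
exact: gz_comm.
Qed.

Lemma gz_gz a m n : gz (gz a m) n = gz a (m * n)%R.
Proof.
rewrite [RHS](@gz_uniq (fun n => gz a (m * n)%R) (gz a m)) ?mulr0 ?mul1g// => k.
by rewrite mulrDr mulr1 gzD.
Qed.

End IntegerPowers.

Section Weyl.
Variables (H : groupType) (zeta X Y rho : H) (r : rotation) (L : int).
Local Notation ell := (rord r).+2.
Local Open Scope group_scope.

Hypothesis zetaC : forall x, commute x zeta.

Local Notation Z n := (gz zeta n%R).

Lemma ZC n x : x * Z n = Z n * x.
Proof. exact/gz_comm/zetaC. Qed.

Lemma ZCA n x y : x * (Z n * y) = Z n * (x * y).
Proof. by rewrite !mulgA ZC. Qed.

Hypothesis XY : X * Y = Z (2 * L) * (Y * X).

(** The symmetric ordering of [X ^ v.1 Y ^ v.2].  The power of [zeta] makes the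
    product rule [weylM] depend on the symplectic form only, hence
    compatible with rotations. *)
Definition weyl (v : vec) : H := Z (- (L * (v.1 * v.2))) * (gz X v.1 * gz Y v.2).

Lemma gz_twist a b m t : b * a = Z t * (a * b) ->
  b * gz a m = Z (t * m) * (gz a m * b).
Proof.
move=> ba; have e : b * a * b^-1 = Z t * a by rewrite ba !mulgA mulgK.
have := gz_conj b a m; rewrite e gzM; last by rewrite /commute ZC.
by rewrite gz_gz => /(congr1 ( *%g^~ b)); rewrite mulgVK !mulgA => <-.
Qed.

Lemma YX_powers m n : gz Y m * gz X n = Z (- (2 * L * (m * n))) * (gz X n * gz Y m).
Proof.
have YX : Y * X = Z (- (2 * L)) * (X * Y).
  by rewrite XY mulgA -gzD addNr gz0 mul1g.
have := gz_twist n YX => e1.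
have : gz X n * Y = Z (2 * L * n) * (Y * gz X n).
  by rewrite e1 mulgA -gzD (_ : (_ + _)%R = 0%R) ?gz0 ?mul1g//; ring.
move=> /(gz_twist m) ->; rewrite mulgA -gzD (_ : (_ + _)%R = 0%R) ?gz0 ?mul1g//.
by ring.
Qed.

Lemma shuffle (a b t x1 y1 x2 y2 : H) :
  (forall x, x * b = b * x) -> (forall x, x * t = t * x) ->
  y1 * x2 = t * (x2 * y1) ->
  (a * (x1 * y1)) * (b * (x2 * y2)) = (a * b * t) * ((x1 * x2) * (y1 * y2)).
Proof.
move=> bC tC e; rewrite -!mulgA; congr (_ * _).
rewrite (mulgA y1 b) bC -mulgA (mulgA y1 x2) e -!mulgA.
by rewrite (mulgA x1 b) bC -mulgA (mulgA x1 t) tC -!mulgA.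
Qed.

Lemma weylM v w : weyl v * weyl w = Z (L * om v w) * weyl (v + w)%R.
Proof.
rewrite /weyl (@shuffle _ _ _ _ _ _ _ (ZC _) (ZC _) (YX_powers _ _)) -!gzD [RHS]mulgA -gzD.
congr (gz _ _ * _); rewrite /om vecD1 vecD2; ring.
Qed.

Lemma weyl0 : weyl 0%R = 1.
Proof.
rewrite /weyl -[gz X _]/(1 : H) -[gz Y _]/(1 : H) !mulg1.
by rewrite (_ : (- _)%R = 0%R)//=; ring.
Qed.

Lemma om_mulz v w m n : om (v *~ m)%R (w *~ n)%R = (om v w * (m * n))%R.
Proof. by rewrite !vec_mulz /om /=; ring. Qed.

Lemma gz_weyl w n : gz (weyl w) n = weyl (w *~ n)%R.
Proof.
rewrite [RHS](@gz_uniq H (fun n => weyl (w *~ n)%R) (weyl w)).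
  by rewrite mulr0z weyl0 mul1g.
move=> m; rewrite weylM -[w in om _ w](mulr1z w) om_mulz omvv mul0r mulr0 gz0 mul1g.
by rewrite mulrzDr mulr1z.
Qed.

Hypothesis rho_ord : rho ^+ ell = 1.
Hypothesis rhoX : rho * X * rho^-1 = weyl (linv (rmx r) e1).
Hypothesis rhoY : rho * Y * rho^-1 = weyl (linv (rmx r) e2).

(** Both sides are multiplicative up to the same powers of [zeta], because the
    rotation preserves [om]; so the two generators decide. *)
Lemma weyl_rot1 v : rho * weyl v * rho^-1 = weyl (rot r 1 v).
Proof.
rewrite [weyl v]/weyl ZCA -mulgA.
rewrite (_ : rho * _ * rho^-1 = (rho * gz X v.1 * rho^-1) * (rho * gz Y v.2 * rho^-1)).
  rewrite -!gz_conj rhoX rhoY !gz_weyl weylM om_mulz mulgA -gzD.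
  rewrite -[linv _ e1]/(rot r 1 e1) -[linv _ e2]/(rot r 1 e2) om_rot -rot_lin.
  rewrite [om e1 e2](_ : _ = 1%R)// (_ : (_ + _)%R = 0%R) ?gz0 ?mul1g//.
  by ring.
by rewrite !mulgA mulgVK.
Qed.

Lemma weyl_rot k v : rho ^+ k * weyl v = weyl (rot r k v) * rho ^+ k.
Proof.
elim: k => [|k IH]; first by rewrite expg0 mul1g mulg1.
rewrite expgS -[LHS]mulgA IH mulgA -[rho * _](mulgVK rho) weyl_rot1.
by rewrite -mulgA.
Qed.

Lemma rho_modn n : rho ^+ (n %% ell) = rho ^+ n.
Proof. by rewrite [in RHS](divn_eq n ell) expgnDr mulnC expgnA rho_ord expg1n mul1g. Qed.

Definition weyl_basis (g : crystal r) : H :=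
  Z (- mu L g) * (weyl g.1 * rho ^+ g.2).

Lemma weyl_basis1 : weyl_basis 1 = 1.
Proof.
by rewrite /weyl_basis -[mu L 1]/(mu L (mkc 0 0)) mu0 weyl0 expg0 oppr0 gz0 !mulg1.
Qed.

Lemma shuffle_twist (a b x1 x2 x3 y1 y2 : H) :
  (forall x, x * b = b * x) -> y1 * x2 = x3 * y1 ->
  (a * (x1 * y1)) * (b * (x2 * y2)) = (a * b) * ((x1 * x3) * (y1 * y2)).
Proof.
move=> bC e; rewrite -!mulgA; congr (_ * _).
by rewrite (mulgA y1 b) bC -mulgA (mulgA y1 x2) e -!mulgA (mulgA x1 b) bC -!mulgA.
Qed.

Lemma weyl_basisM (g h : crystal r) :
  weyl_basis g * weyl_basis h = Z (cexp L g h) * weyl_basis (g * h).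
Proof.
rewrite /weyl_basis.
rewrite (@shuffle_twist _ _ _ _ (weyl (rot r g.2 h.1)) _ _ (ZC _) (weyl_rot _ _)).
rewrite weylM -expgnDr -[rho ^+ (_ + _)]rho_modn.
rewrite -[weyl (g * h).1]/(weyl (g.1 + rot r g.2 h.1)); move: (weyl _) => W.
rewrite !mulgA -!gzD -!mulgA; congr (gz _ _ * _); rewrite /cexp; ring.
Qed.

End Weyl.

(** * The group of invertible elements *)

Section RingUnits.
Variable R : pzRingType.

(** Inverses are part of the data, so that the construction applies to every
    ring, the zero ring included. *)
Definition runit : Type := {p : R * R | (p.1 * p.2 == 1) && (p.2 * p.1 == 1)}.
HB.instance Definition _ := Choice.on runit.

Definition rval (x : runit) : R := (\val x).1.

Lemma runit_inj (x y : runit) : rval x = rval y -> x = y.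
Proof.
case: x y => [[x x'] /= p] [[y y'] /= p'] e; apply: val_inj => /=.
move: e; rewrite /rval /= => e; move: p; rewrite e => /andP[_ /eqP p].
case/andP: p' => /eqP p' _; congr (_, _).
by rewrite -[x']mulr1 -p' mulrA p mul1r.
Qed.

Lemma runitVP (x : runit) : (\val x).1 * (\val x).2 = 1.
Proof. by have /andP[/eqP] := valP x. Qed.
Lemma runitPV (x : runit) : (\val x).2 * (\val x).1 = 1.
Proof. by have /andP[_ /eqP] := valP x. Qed.

Fact runit_one_proof :
  ((1 : R, 1 : R).1 * (1 : R, 1 : R).2 == 1) && ((1 : R, 1 : R).2 * (1 : R, 1 : R).1 == 1).
Proof. by rewrite /= mulr1 eqxx. Qed.
Definition runit_one : runit := exist _ (1, 1) runit_one_proof.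
Fact runit_inv_proof (x : runit) : let p := ((\val x).2, (\val x).1) in
  (p.1 * p.2 == 1) && (p.2 * p.1 == 1).
Proof. by rewrite /= runitVP runitPV eqxx. Qed.
Definition runit_inv x : runit := exist _ ((\val x).2, (\val x).1) (runit_inv_proof x).
Fact runit_mul_proof (x y : runit) :
  let p := ((\val x).1 * (\val y).1, (\val y).2 * (\val x).2) in
  (p.1 * p.2 == 1) && (p.2 * p.1 == 1).
Proof.
rewrite /= -!mulrA (mulrA (\val y).1) runitVP mul1r runitVP eqxx.
by rewrite (mulrA (\val x).2) runitPV mul1r runitPV eqxx.
Qed.
Definition runit_mul x y : runit :=
  exist _ ((\val x).1 * (\val y).1, (\val y).2 * (\val x).2) (runit_mul_proof x y).

Fact runit_mulA : associative runit_mul.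
Proof. by move=> x y w; apply: runit_inj; rewrite /rval /= mulrA. Qed.
Fact runit_mul1 : left_id runit_one runit_mul.
Proof. by move=> x; apply: runit_inj; rewrite /rval /= mul1r. Qed.
Fact runit_mulr1 : right_id runit_one runit_mul.
Proof. by move=> x; apply: runit_inj; rewrite /rval /= mulr1. Qed.
Fact runit_mulV : left_inverse runit_one runit_inv runit_mul.
Proof. by move=> x; apply: runit_inj; exact: runitPV. Qed.
Fact runit_mulrV : right_inverse runit_one runit_inv runit_mul.
Proof. by move=> x; apply: runit_inj; exact: runitVP. Qed.

HB.instance Definition _ := isGroup.Build runit runit_mulA runit_mul1
  runit_mulr1 runit_mulV runit_mulrV.

Lemma rvalM (x y : runit) : rval (x * y)%g = rval x * rval y.
Proof. by []. Qed.
Lemma rvalX (x : runit) n : rval (x ^+ n)%g = rval x ^+ n.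
Proof. by elim: n => // n IH; rewrite expgS exprS rvalM IH. Qed.
Lemma rval_prod (I : Type) (s : seq I) (F : I -> runit) :
  rval (\prod_(i <- s) F i)%g = \prod_(i <- s) rval (F i).
Proof. by elim/big_rec2: _ => // i y1 y2 _ <-; rewrite rvalM. Qed.

Lemma runit_of_order (x : R) n : x ^+ n.+1 = 1 -> exists y, rval y = x.
Proof.
move=> xn; suff p : let p := (x, x ^+ n) in (p.1 * p.2 == 1) && (p.2 * p.1 == 1).
  by exists (exist _ (x, x ^+ n) p).
by rewrite /= -exprS -exprSr xn eqxx.
Qed.

End RingUnits.

(** * Star-shaped presentations *)

(** What has to be checked for each diagram.  The first group of fields places
    the legs in a plane group so that the star relations hold in its central
    extension, [z ^ 24] playing the role of [q]; [sm_lift] recovers the Weyl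
    relations from the star relations in an arbitrary group; [sm_class] counts
    the torsion classes.  The exponent 24 is a multiple of 4, which makes the
    divisions of [sm_L] by the discriminants exact for all four diagrams. *)
Record star_model (D : diagram) := StarModel {
  sm_rot : rotation;
  sm_L : int;
  sm_leg : 'I_(nlegs D) -> crystal sm_rot;
  sm_L0 : sm_L != 0;
  sm_int : integral_rotation sm_rot sm_L;
  sm_sum : forall v : vec, \sum_(j < (rord sm_rot).+2) rot sm_rot j v = 0;
  sm_order : forall k, word (cexp sm_L) sm_leg (nseq (leg_order k) k) = (0, 1%g);
  sm_prod : word (cexp sm_L) sm_leg (index_enum 'I_(nlegs D)) = (24, 1%g);
  sm_gen : forall g, exists s, (word (cexp sm_L) sm_leg s).2 = g;
  sm_lift : forall (H : groupType) (zeta : H) (t : 'I_(nlegs D) -> H),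
    (forall x, commute x zeta) -> (forall k, t k ^+ leg_order k = 1)%g ->
    (\prod_k t k)%g = gz zeta 24 ->
    exists X Y rho, [/\ (X * Y = gz zeta (2 * sm_L)%R * (Y * X))%g,
      (rho ^+ (rord sm_rot).+2 = 1)%g,
      (rho * X * rho^-1)%g = weyl zeta X Y sm_L (linv (rmx sm_rot) e1),
      (rho * Y * rho^-1)%g = weyl zeta X Y sm_L (linv (rmx sm_rot) e2) &
      forall k, t k = weyl_basis zeta X Y rho sm_L (sm_leg k)];
  sm_class : class_function sm_rot (dynkin_rank D).+1
}.

Section Star.
Variables (D : diagram) (S : star_model D) (K : fieldType) (q z : K).
Hypothesis zq : z ^+ 24 = q.
Hypothesis q_neq0 : q != 0.
Hypothesis q_not_root : forall n : nat, (0 < n)%N -> q ^+ n != 1.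
Hypothesis char0 : forall n : nat, n.+1%:R != 0 :> K.
Local Notation r := (sm_rot S).
Local Notation L := (sm_L S).

Fact z_neq0 : z != 0.
Proof. by apply: contraNneq q_neq0 => z0; rewrite -zq z0 expr0n. Qed.

Fact z_not_root n : (0 < n)%N -> z ^+ n != 1.
Proof.
move=> n0; apply: contraNneq (q_not_root n0) => zn.
by rewrite -zq -exprM mulnC exprM zn expr1n.
Qed.

Local Notation Q := (alg_quot (@B_relators K D q)).
Local Notation pi := (@alg_pi K _ (@B_relators K D q)).
Local Notation T k := (free_gen K (k : 'I_(nlegs D))).
Local Notation value := (value (G := crystal r) (cexp L) (sm_leg S) z).

Lemma value_relators x : B_relators q x -> value x = 0.
Proof.
have one : value 1 = << 1%g >>.
  have -> : 1 = monom K (FMonom (Nil 'I_(nlegs D))) by rewrite monomE big_nil.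
  by rewrite valueU /word_elt /= expr0z scale1r.
case=> [[k ->]|->].
  have -> : T k ^+ leg_order k = monom K (FMonom (nseq (leg_order k) k)).
    by rewrite monomE big_nseq -iter_mulr_1.
  by rewrite linearB /= one valueU /word_elt sm_order expr0z scale1r subrr.
have -> : \prod_(k < nlegs D) T k = monom K (FMonom (index_enum 'I_(nlegs D))).
  by rewrite monomE.
rewrite linearB linearZ /= one valueU /word_elt /= sm_prod /=.
by rewrite -[z ^ _]/(z ^+ 24) zq subrr.
Qed.

Lemma alg_pi_mul x y : pi (x * y) = pi x * pi y :> Q.
Proof. by rewrite -[RHS]/(alg_quot_mul _ _) alg_piM. Qed.

Lemma alg_piZ (k : K) x : pi (k *: x) = (k *: pi x : Q).
Proof. by rewrite /alg_pi -lmod_piZ. Qed.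

Lemma alg_piX x n : pi (x ^+ n) = (pi x : Q) ^+ n.
Proof. by elim: n => // n IH; rewrite !exprS alg_pi_mul IH. Qed.

Lemma leg_order_gt0 k : exists n, leg_order (k : 'I_(nlegs D)) = n.+1.
Proof.
by case: D k => -[[|[|[|[|k]]]] lt] //; rewrite /leg_order /=; eexists.
Qed.

(** The star relations hold in the group of invertible elements of the algebra,
    where [zeta] is the scalar [z]; there [sm_lift] yields the candidate for the
    basis, whose independence comes from [presented_basis]. *)
Lemma star_basis : exists u : twisted_basis Q (crystal r),
  forall g h, tb_cocycle u g h = z ^ cexp L g h.
Proof.
have TX k : (pi (T k) : Q) ^+ leg_order k = 1.
  rewrite -alg_piX; apply/lmod_piP; apply/asboolP => J [_]; apply.
  by left; exists k.
have ex k : exists y : runit Q, rval y = pi (T k).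
  by have [n nE] := leg_order_gt0 k; apply: (@runit_of_order _ _ n); rewrite -nE.
pose t k := projT1 (cid (ex k)).
have tE k : rval (t k) = pi (T k) by rewrite /t; case: cid.
pose sc (a : K) : Q := a *: (1 : Q).
have scl a (x : Q) : sc a * x = (a *: x : Q).
  apply: etrans (amulZl a (1 : Q) x) _; congr (_ *: _); exact: amul1x.
have scr a (x : Q) : x * sc a = (a *: x : Q).
  apply: etrans (amulZr a x (1 : Q)) _; congr (_ *: _); exact: amulx1.
have zp : let p := (sc z, sc z^-1) in (p.1 * p.2 == 1) && (p.2 * p.1 == 1).
  have scM a b : a * b = 1 -> sc a * sc b == 1.
    move=> ab; apply/eqP; apply: etrans (scl a (sc b)) _.
    apply: etrans (scalerA a b (1 : Q)) _; rewrite ab; exact: scale1r.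
  by apply/andP; split; apply: scM; rewrite ?mulfV ?mulVf ?z_neq0.
pose zeta : runit Q := exist _ (sc z, sc z^-1) zp.
have zetaE x : rval zeta * x = (z *: x : Q) by exact: scl.
have zetaC x : commute x zeta.
  by apply: runit_inj; rewrite !rvalM zetaE; exact: scr.
have gzE n x : rval (gz zeta n) * x = (z ^ n *: x : Q).
  have nat m y : rval (zeta ^+ m)%g * y = (z ^+ m *: y : Q).
    elim: m => [|m IH]; first by rewrite mul1r scale1r.
    rewrite expgS rvalM -mulrA exprS.
    apply: etrans (congr1 (fun x => rval zeta * x) IH) _.
    apply: etrans (scl z _) _; exact: scalerA.
  case: n => n; first exact: nat.
  pose y : Q := z ^ Negz n *: x.
  have ay : rval (zeta ^+ n.+1)%g * y = x.
    apply: etrans (nat _ _) _; apply: etrans (scalerA _ _ _) _.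
    apply: etrans (congr1 (fun k => k *: (x : Q)) _) (scale1r _).
    by rewrite NegzE -[z ^+ _]/(z ^ n.+1) -expfzDr ?z_neq0// subrr expr0z.
  apply: etrans (congr1 (fun w => rval (gz zeta (Negz n)) * w) (esym ay)) _.
  by rewrite mulrA -rvalM mulVg mul1r.
have [||X [Y [rho [XY rho1 rhoX rhoY tw]]]] := sm_lift S (t := t) zetaC.
- by move=> k; apply: runit_inj; rewrite rvalX tE TX.
- apply: runit_inj; rewrite rval_prod (eq_bigr (fun k => pi (T k) : Q)) => [|k _].
    have prodE : pi (\prod_k T k) = \prod_k (pi (T k) : Q).
      by apply: (big_morph pi alg_pi_mul).
    rewrite -prodE; apply: etrans (_ : _ = pi (q *: 1)) _.
      by apply/lmod_piP; apply/asboolP => J [_]; apply; right.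
    apply: etrans (alg_piZ q 1) _; apply: esym.
    apply: etrans (esym (mulr1 _)) _; apply: etrans (gzE 24 1) _.
    exact: (congr1 (fun k => k *: (1 : Q)) zq).
  exact: tE.
pose u (g : crystal r) : Q := rval (weyl_basis zeta X Y rho L g).
have uM (g h : crystal r) : u g ** u h = z ^ cexp L g h *: u (g * h)%g.
  apply: etrans (congr1 (@rval Q) (weyl_basisM zetaC XY rho1 rhoX rhoY g h)) _.
  exact: gzE.
have ul k : pi (T k) = u (sm_leg S k) by rewrite /u -tw tE.
have u1 : u 1%g = pi 1 by exact: (congr1 (@rval Q) (weyl_basis1 _ _ _ _ _ _)).
exists (presented_basis (@cexpA _ _) (@cexp1 _ _) z_neq0 value_relators u1 uM ul (@sm_gen _ S)).
by [].
Qed.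

Lemma star_cohomology :
  [/\ lmod_iso (HH (B D q) 0) K^o,
      forall x : HH (B D q) 1, x = 0,
      lmod_iso (HH (B D q) 2) 'rV[K]_(dynkin_rank D).+1
    & forall i : nat, (2 < i)%N -> forall x : HH (B D q) i, x = 0].
Proof.
have [u uE] := star_basis.
have M := lattice_action z_neq0 z_not_root (sm_L0 S) (@sm_int _ S) uE (char0 _) (@sm_sum _ S).
split.
- exact: (HH0_iso M).
- exact: (HH1_eq0 M).
- exact: (HH2_iso_classes M (sm_class S)).
- by move=> [|[|[|i]]] // _; exact: (HH_ge3_eq0 (char0 _) u).
Qed.

End Star.

(** * Generation and classes in the plane groups *)

Section Generation.
Variables (r : rotation) (c : crystal r -> crystal r -> int) (I : choiceType).
Variable leg : I -> crystal r.
Hypothesis c1 : forall g, c 1%g g = 0.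
Hypothesis cA : forall f g h, c f g + c (f * g)%g h = c g h + c f (g * h)%g.

Definition reachable g := exists s, (word c leg s).2 = g.

Lemma reachableM g h : reachable g -> reachable h -> reachable (g * h)%g.
Proof. by move=> [s <-] [t <-]; exists (s ++ t); rewrite (word_cat cA c1). Qed.

Lemma reachable_gz (x : crystal r) n :
  reachable x -> reachable x^-1%g -> reachable (gz x n).
Proof.
move=> rx rx'; case: n => n /=.
  by elim: n => [|n IH]; [exists [::]|rewrite expgS; exact: reachableM].
rewrite -expVgn; elim: n => [|n IH]; first by rewrite expg1.
by rewrite expgS; exact: reachableM.
Qed.

Lemma mkc_power v n : gz (mkc v 0 : crystal r) n = mkc (v *~ n) 0.
Proof.
rewrite [RHS](@gz_uniq _ (fun n => mkc (v *~ n) 0 : crystal r) (mkc v 0)).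
  by rewrite mulr0z [mkc 0 0]/(1%g : crystal r) mul1g.
move=> m; rewrite crystM; congr (_, _); last by rewrite [RHS]addr0.
by rewrite [LHS]mulrzDr mulr1z.
Qed.

Lemma mkc_rho n : ((mkc 0 1%R : crystal r) ^+ n)%g = mkc 0 (inZp n) :> crystal r.
Proof.
elim: n => [|n IH].
  by rewrite expg0 (_ : inZp 0 = 0%R :> 'I_(rord r).+2)//; exact: ord_inj.
rewrite expgSr IH crystM; congr (_, _); first by rewrite [LHS]add0r raddf0.
by apply: val_inj; rewrite /= modnDml addn1.
Qed.

(** Inverses are asked for explicitly because words contain the letters only. *)
Lemma reachable_all : reachable (mkc e1 0) -> reachable (mkc e1 0)^-1%g ->
  reachable (mkc e2 0) -> reachable (mkc e2 0)^-1%g -> reachable (mkc 0 1%R) ->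
  forall g, reachable g.
Proof.
move=> x x' y y' z [v k].
have -> : (v, k) = (gz (mkc e1 0) v.1 * gz (mkc e2 0) v.2 * (mkc 0 1%R) ^+ k)%g :> crystal r.
  rewrite !mkc_power mkc_rho !crystM; congr (_, _).
    by rewrite {1}[v]vecE raddf0 [RHS]addr0.
  by change (k = (0 + 0) + inZp k :> 'I_(rord r).+2); rewrite !add0r valZpK.
apply: reachableM; first by apply: reachableM; exact: reachable_gz.
elim: (nat_of_ord k) => [|n IH]; first by exists [::].
by rewrite expgS; exact: reachableM.
Qed.

End Generation.

(** Class numbers of the proper rotations are given by a function [F k v] with
    values in [1 .. N]; the number zero is left for the identity. *)
Section ClassBuilder.
Variables (r : rotation) (N : nat) (F : nat -> vec -> nat) (rot_index : nat -> nat).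
Local Notation index := 'I_(rord r).+2.

Hypothesis F_bound : forall (k : index) v, k != 0 -> (0 < F k v < N.+1)%N.
Hypothesis F_rot : forall (k : index) v, k != 0 -> F k (rot r 1 v) = F k v.
Hypothesis F_trans : forall (k : index) v w, k != 0 ->
  F k (v + (w - rot r k w)) = F k v.
Hypothesis F_index : forall (k : index) v, k != 0 -> rot_index (F k v) = k.
Hypothesis F_conj : forall (k : index) v v', k != 0 -> F k v = F k v' ->
  exists (j : index) w, v' = rot r j v + (w - rot r k w).
Hypothesis F_surj : forall n, (0 < n < N.+1)%N ->
  exists (k : index) v, k != 0 /\ F k v = n.

Definition class_of (g : crystal r) : option 'I_N.+1 :=
  if g.2 == 0 then (if g.1 == 0 then Some ord0 else None)
  else Some (inord (F g.2 g.1)).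

Lemma class_builder : class_function r N.+1.
Proof.
exists class_of.
- by move=> v; rewrite /class_of eqxx /=; case: eqP.
- move=> w j v k k0; rewrite /class_of /= (negPf k0) F_trans//; congr (Some (inord _)).
  elim: (nat_of_ord j) => // n IH.
  by rewrite -[LHS]/(F k (rot r 1 (rot r n v))) F_rot.
- move=> i; have [i0|i0] := posnP i.
    exists (mkc 0 0); rewrite /class_of eqxx eqxx; congr Some; exact: val_inj.
  have [|k [v [k0 e]]] := @F_surj i; first by rewrite i0 ltn_ord.
  by exists (mkc v k); rewrite /class_of /= (negPf k0) e inord_val.
- by move=> v k k0; rewrite /class_of /= (negPf k0).
- move=> v v' k k'; rewrite /class_of /= => /[swap] k0; rewrite (negPf k0).
  have Fb := F_bound _ k0; have [k'0|k'0] := eqVneq k' 0.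
    case: eqP => // _ [] /(congr1 val); rewrite /= inordK; first by have := Fb v; lia.
    by have := Fb v; case/andP.
  move=> [] /(congr1 val); rewrite /= !inordK; last first.
  + by have /andP[] := Fb v.
  + by have /andP[] := F_bound v' k'0.
  move=> e; have kE : k = k'.
    by apply: val_inj; rewrite /= -(F_index v k0) e F_index.
  by split=> //; apply: F_conj => //; rewrite e kE.
Qed.

End ClassBuilder.

(** With [p] a rotation and [a] a translation, the power collects the conjugates
    of [a] on the left: a relation on the order of [a * p] becomes a relation
    between rotated translations. *)
Section Powers.
Variable H : groupType.
Implicit Types a p x : H.
Local Open Scope group_scope.

Lemma power2 a p : (a * p) ^+ 2 = a * (p * a * p^-1) * p ^+ 2.
Proof. by rewrite !expg2 !mulgA mulgVK. Qed.
Lemma power3 a p : (a * p) ^+ 3 = a * (p * a * p^-1) * (p * (p * a * p^-1) * p^-1) * p ^+ 3.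
Proof. by rewrite !expgS !expg0 !mulg1 !mulgA !mulgVK. Qed.
Lemma power4 a p : (a * p) ^+ 4 = a * (p * a * p^-1) * (p * (p * a * p^-1) * p^-1)
  * (p * (p * (p * a * p^-1) * p^-1) * p^-1) * p ^+ 4.
Proof. by rewrite !expgS !expg0 !mulg1 !mulgA !mulgVK. Qed.
End Powers.

(** * Weyl relations from the star relations *)

(** In each case the last leg is the rotation, and the translations are
    extracted from the other legs.  The order relations of the legs then
    express how the rotation acts on the translations and how these commute;
    the product relation determines the remaining leg. *)
Section Lifts.
Variables (H : groupType) (Z : int -> H).
Local Open Scope group_scope.
Hypothesis ZC : forall n x, x * Z n = Z n * x.
Hypothesis ZD : forall m n, Z (m + n)%R = Z m * Z n.
Implicit Types t x y : H.

Lemma Z0 : Z 0 = 1.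
Proof. by apply: (mulgI (Z 0)); rewrite -ZD mulg1. Qed.

Lemma ZDx m n x : Z m * (Z n * x) = Z (m + n)%R * x.
Proof. by rewrite mulgA -ZD. Qed.

Lemma ZCx n x y : x * (Z n * y) = Z n * (x * y).
Proof. by rewrite mulgA ZC mulgA. Qed.

Lemma ZN n : (Z n)^-1 = Z (- n)%R.
Proof. by apply: (mulgI (Z n)); rewrite mulgV -ZD subrr Z0. Qed.

Lemma ZX n x k : (Z n * x) ^+ k = Z (n *+ k)%R * x ^+ k.
Proof.
elim: k => [|k IH]; first by rewrite !expg0 mulr0n Z0 mulg1.
by rewrite !expgS IH -mulgA ZCx ZDx mulrS.
Qed.

Lemma Z_eq n x y : Z n * x = y -> x = Z (- n)%R * y.
Proof. by move=> <-; rewrite ZDx addNr Z0 mul1g. Qed.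

Lemma Z_conj n x y : y * (Z n * x) * y^-1 = Z n * (y * x * y^-1).
Proof. by rewrite ZCx -mulgA. Qed.

Lemma expg2_inv t : t ^+ 2 = 1 -> t^-1 = t.
Proof. by rewrite expg2 => e; apply: (mulgI t); rewrite mulgV e. Qed.

Lemma Z_inv n t x : t * x = Z n -> t^-1 = Z (- n)%R * x.
Proof. by move=> e; apply: Z_eq; rewrite -ZC -e mulKg. Qed.

Lemma extract_translation n t p : exists x, t = Z n * (x * p).
Proof.
exists (Z (- n)%R * (t * p^-1)).
by rewrite -mulgA ZDx addrN Z0 mul1g mulgVK.
Qed.

Lemma E7_lift t0 t1 t2 : t0 ^+ 2 = 1 -> t1 ^+ 4 = 1 -> t2 ^+ 4 = 1 ->
  t0 * t1 * t2 = Z 24 ->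
  exists X Y : H, [/\ X * Y = Z (- 96)%R * (Y * X), t2 * X * t2^-1 = Y,
    t2 * Y * t2^-1 = X^-1, t0 = X * t2 ^+ 2 & t1 = Z 24 * (X * t2)].
Proof.
move=> h0 h1 h2 hp.
have [X t1E] := extract_translation 24 t1 t2.
have [Y YE] : exists Y, Y = t2 * X * t2^-1 by eexists.
have t0E : t0 = X * t2 ^+ 2.
  rewrite -[LHS](expg2_inv h0) (@Z_inv 24 t0 (t1 * t2)) ?mulgA//.
  by rewrite t1E -!mulgA ZDx addNr Z0 mul1g.
have X2 : t2 * Y * t2^-1 = X^-1.
  have := h0; rewrite t0E power2 -expgnA h2 mulg1 expg2 => e.
  by apply: (mulgI X); rewrite mulgV -[RHS]e YE invgM !mulgA.
exists X, Y; split=> //.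
have := h1; rewrite t1E ZX power4 h2 mulg1 -YE X2.
have -> : t2 * X^-1 * t2^-1 = Y^-1 by rewrite YE !invgM invgK !mulgA.
move=> /Z_eq; rewrite mulg1 => e.
by rewrite -[X * Y](mulgVK X) -[X * Y * _](mulgVK Y) e -!mulgA.
Qed.

Lemma E6_lift t0 t1 t2 : t0 ^+ 3 = 1 -> t1 ^+ 3 = 1 -> t2 ^+ 3 = 1 ->
  t0 * t1 * t2 = Z 24 ->
  exists X Y : H, [/\ X * Y = Z (- 72)%R * (Y * X), t2 * X * t2^-1 = Y,
    t2 * Y * t2^-1 = Z 36 * (X^-1 * Y^-1), t0 = Z 12 * (Y^-1 * t2) & t1 = Z 12 * (X * t2)].
Proof.
move=> h0 h1 h2 hp.
have [X t1E] := extract_translation 12 t1 t2.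
have [Y YE] : exists Y, Y = t2 * X * t2^-1 by eexists.
have t2V : t2 * t2 = t2^-1 by apply: (mulgI t2); rewrite mulgV -h2 !expgS expg0 mulg1.
have t0E : t0 = Z 12 * (Y^-1 * t2).
  have -> : Y^-1 * t2 = t2 * X^-1 by rewrite YE !invgM invgK -!mulgA mulVg mulg1.
  rewrite -[LHS]invgK (@Z_inv 24 t0 (t1 * t2)) ?mulgA//.
  by rewrite t1E -!mulgA ZDx t2V !invgM ZN ZC invgK.
have [X2 X2D] : exists X2, X2 = t2 * Y * t2^-1 by eexists.
have X3 : t2 * X2 * t2^-1 = X.
  have -> : t2 * X2 * t2^-1 = t2 ^+ 3 * X * (t2 ^+ 3)^-1.
    by rewrite X2D YE !expgS expg0 !invgM invg1 !mulg1 mul1g !mulgA.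
  by rewrite h2 invg1 mulg1 mul1g.
have X2E : X2 = Z (- 36)%R * (Y^-1 * X^-1).
  have := h1; rewrite t1E ZX power3 h2 mulg1 -YE -X2D => /Z_eq; rewrite mulg1 => e.
  by rewrite -invgM -ZC -e mulKg.
have XY : X * Y = Z (- 72)%R * (Y * X).
  have := h0; rewrite t0E ZX power3 h2 mulg1.
  rewrite (_ : t2 * Y^-1 * t2^-1 = X2^-1); last by rewrite X2D !invgM invgK !mulgA.
  rewrite (_ : t2 * X2^-1 * t2^-1 = X^-1); last by rewrite -X3 !invgM invgK !mulgA.
  move=> /Z_eq; rewrite mulg1 -!invgM => /(congr1 (fun x => x^-1)).
  rewrite invgK X2E ZN opprK -!mulgA ZCx => /Z_eq; rewrite -ZD => e.
  have e2 : X^-1 * Y = Z 72 * (Y * X^-1).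
    apply: (mulgI (X * Y^-1)); rewrite -mulgA e ZCx.
    by rewrite -mulgA mulKg mulgV mulg1.
  apply: Z_eq; apply: esym; rewrite -{1}[Y](mulVKg X) e2 ZCx -!mulgA.
  by rewrite mulVg mulg1.
exists X, Y; split=> //; rewrite -X2D X2E -!invgM XY (invgM (Z _)) ZN ZC.
by rewrite ZDx.
Qed.

Lemma E8_lift t0 t1 t2 : t0 ^+ 2 = 1 -> t1 ^+ 3 = 1 -> t2 ^+ 6 = 1 ->
  t0 * t1 * t2 = Z 24 ->
  exists X Y : H, [/\ X * Y = Z (- 144)%R * (Y * X), t2 * X * t2^-1 = Y,
    t2 * Y * t2^-1 = Z (- 72)%R * (X^-1 * Y), t0 = X * t2 ^+ 3 &
    t1 = Z 24 * (X * t2 ^+ 2)].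
Proof.
move=> h0 h1 h2 hp.
have [X t1E] := extract_translation 24 t1 (t2 ^+ 2).
have [Y YE] : exists Y, Y = t2 * X * t2^-1 by eexists.
have [X2 X2D] : exists X2, X2 = t2 * Y * t2^-1 by eexists.
have t0E : t0 = X * t2 ^+ 3.
  rewrite -[LHS](expg2_inv h0) (@Z_inv 24 t0 (t1 * t2)) ?mulgA//.
  by rewrite t1E -!mulgA ZDx addNr Z0 mul1g.
have conj3 x : t2 ^+ 3 * x * (t2 ^+ 3)^-1 = t2 * (t2 * (t2 * x * t2^-1) * t2^-1) * t2^-1.
  by rewrite !expgS expg0 !invgM invg1 !mulg1 mul1g !mulgA.
have conj2 x : t2 ^+ 2 * x * (t2 ^+ 2)^-1 = t2 * (t2 * x * t2^-1) * t2^-1.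
  by rewrite expg2 invgM !mulgA.
have X3 : t2 * X2 * t2^-1 = X^-1.
  have := h0; rewrite t0E power2 -expgnA h2 mulg1 conj3 -YE -X2D => e.
  by apply: (mulgI X); rewrite mulgV.
have X2E : X2 = Z (- 72)%R * (X^-1 * Y).
  have := h1; rewrite t1E ZX power3 -expgnA h2 mulg1 !conj2 -YE -X2D X3.
  rewrite (_ : t2 * X^-1 * t2^-1 = Y^-1); last by rewrite YE !invgM invgK !mulgA.
  move=> /Z_eq; rewrite mulg1 => e.
  by apply: (mulgI X); apply: (mulIg Y^-1); rewrite e ZCx mulVKg -mulgA mulgV mulg1.
exists X, Y; split=> //.
have := congr1 (fun x => t2 * x * t2^-1) X2E; rewrite /= X3 Z_conj.
have cXY : t2 * (X^-1 * Y) * t2^-1 = Y^-1 * X2.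
  have Yv : Y^-1 = t2 * X^-1 * t2^-1 by rewrite YE !invgM invgK !mulgA.
  by rewrite X2D Yv !mulgA mulgVK.
rewrite cXY X2E ZCx ZDx => e.
  have e' : Y * X^-1 = Z (- 144)%R * (X^-1 * Y) by rewrite {1}e ZCx mulVKg.
  transitivity (X * (Y * X^-1) * X); first by rewrite -!mulgA mulVg mulg1.
  by rewrite e' ZCx mulVKg -mulgA.
by rewrite -X2D.
Qed.

Lemma D4_lift t0 t1 t2 t3 : t0 ^+ 2 = 1 -> t1 ^+ 2 = 1 -> t2 ^+ 2 = 1 -> t3 ^+ 2 = 1 ->
  t0 * t1 * t2 * t3 = Z 24 ->
  exists X Y : H, [/\ X * Y = Z 48 * (Y * X), t3 * X * t3^-1 = X^-1,
    t3 * Y * t3^-1 = Y^-1 &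
    [/\ t0 = Y * t3, t1 = Z 24 * (Y * X) * t3 & t2 = X * t3]].
Proof.
move=> h0 h1 h2 h3 hp; exists (t2 * t3), (t0 * t3).
have i0 := expg2_inv h0; have i1 := expg2_inv h1.
have i2 := expg2_inv h2; have i3 := expg2_inv h3.
have s3 : t3 * t3 = 1 by rewrite -expg2.
have t1E : t1 = Z 24 * (t0 * t3 * t2).
  have -> : t1 = t0^-1 * (t0 * t1 * t2 * t3) * t3^-1 * t2^-1.
    by rewrite !mulgA mulVg mul1g !mulgK.
  by rewrite hp ZC i0 i2 i3 -!mulgA.
split.
- have e : Z 48 * (t0 * t3 * t2 * (t0 * t3 * t2)) = 1.
    by rewrite -h1 t1E ZX expg2.
  have -> : t2 * t3 * (t0 * t3) = (t0 * t3 * t2 * (t0 * t3 * t2))^-1 * (t0 * t3 * (t2 * t3)).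
    rewrite !invgM i0 i2 i3 !mulgA.
    have k t x : t^-1 = t -> x * t * t = x by move=> tV; rewrite -{2}tV mulgK.
    by rewrite (k t0)// (k t3)// (k t2).
  by have /Z_eq := e; rewrite mulg1 => ->; rewrite ZN opprK.
- by rewrite i3 invgM i2 i3 -!mulgA s3 mulg1.
- by rewrite i3 invgM i0 i3 -!mulgA s3 mulg1.
- by split; rewrite -!mulgA ?s3 ?mulg1// t1E -!mulgA.
Qed.

End Lifts.

(** * The four diagrams *)

Local Notation legi n i := (@Ordinal n i isT).

Lemma index_enum3 : index_enum 'I_3 = [:: legi 3 0; legi 3 1; legi 3 2].
Proof. by apply: (inj_map val_inj); rewrite [index_enum _]unlock -enumT; exact: val_enum_ord. Qed.
Lemma index_enum4 : index_enum 'I_4 = [:: legi 4 0; legi 4 1; legi 4 2; legi 4 3].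
Proof. by apply: (inj_map val_inj); rewrite [index_enum _]unlock -enumT; exact: val_enum_ord. Qed.

Lemma prod3 (H : groupType) (t : 'I_3 -> H) :
  (\prod_k t k = t (legi 3 0) * t (legi 3 1) * t (legi 3 2))%g.
Proof. by rewrite index_enum3 !big_cons big_nil mulg1 mulgA. Qed.
Lemma prod4 (H : groupType) (t : 'I_4 -> H) :
  (\prod_k t k = t (legi 4 0) * t (legi 4 1) * t (legi 4 2) * t (legi 4 3))%g.
Proof. by rewrite index_enum4 !big_cons big_nil mulg1 !mulgA. Qed.

Lemma ord3P (P : 'I_3 -> Prop) : P (legi 3 0) -> P (legi 3 1) -> P (legi 3 2) -> forall k, P k.
Proof. by move=> p0 p1 p2 [[|[|[|//]]] lt]; rewrite (bool_irrelevance lt isT). Qed.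
Lemma ord4P (P : 'I_4 -> Prop) : P (legi 4 0) -> P (legi 4 1) -> P (legi 4 2) ->
  P (legi 4 3) -> forall k, P k.
Proof. by move=> p0 p1 p2 p3 [[|[|[|[|//]]]] lt]; rewrite (bool_irrelevance lt isT). Qed.

Definition resz (n : int) (x : int) : nat := `|(x %% n)%Z|%N.

Lemma resz2 x : resz 2 x = 0%N \/ resz 2 x = 1%N.
Proof. rewrite /resz; lia. Qed.
Lemma resz3 x : [\/ resz 3 x = 0%N, resz 3 x = 1%N | resz 3 x = 2%N].
Proof.
have : (resz 3 x < 3)%N by rewrite /resz; lia.
by case: (resz 3 x) => [|[|[|//]]] _; [apply: Or31|apply: Or32|apply: Or33].
Qed.

Ltac nonzero_index :=
  let lt := fresh "lt" in
  case=> [[|[|[|[|[|[|[|?]]]]]]] lt] //;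
  try (exfalso; move: lt; rewrite /=; lia).
Ltac vec_simp :=
  rewrite /rot /linv ?(vecD1, vecD2, vecN1, vecN2) /= ?(vecD1, vecD2, vecN1, vecN2) /=.
Ltac cls_lia := repeat (case: ifP; move=> ?); lia.
(** The translation [(a, b)] solves [v' - rot j v = w - rot k w] for [w]. *)
Ltac conj_by j a b := exists (inZp j), (a, b); apply: injective_projections; vec_simp; lia.

(** ** The diagram D4 *)

Fact D4_rordP (v : vec) : iter 2 (linv ((-1, 0), (0, -1))) v = v.
Proof. by case: v => a b; rewrite /linv /=; congr (_, _); ring. Qed.
Definition D4_rot : rotation := @Rotation 0 ((-1, 0), (0, -1)) erefl D4_rordP.

(** The half turns about the halves of lattice vectors, one for each class. *)
Definition D4_leg (k : 'I_(nlegs D4)) : crystal D4_rot :=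
  nth 1%g [:: @mkc D4_rot (0, 1) (inZp 1); @mkc D4_rot (1, 1) (inZp 1);
    @mkc D4_rot (1, 0) (inZp 1); @mkc D4_rot 0 (inZp 1)] k.

Fact D4_order k : word (cexp 24) D4_leg (nseq (leg_order k) k) = (0, 1%g).
Proof. by move: k; apply: ord4P; apply/eqP; vm_compute. Qed.

Fact D4_prod : word (cexp 24) D4_leg (index_enum 'I_(nlegs D4)) = (24, 1%g).
Proof. by rewrite [index_enum _]index_enum4; apply/eqP; vm_compute. Qed.

Fact D4_integral : integral_rotation D4_rot 24.
Proof. by nonzero_index; move=> _; split; vm_compute. Qed.

Fact D4_sum (v : vec) : \sum_(j < 2) rot D4_rot j v = 0.
Proof.
rewrite !big_ord_recl big_ord0; case: v => a b; rewrite /rot /linv /=.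
by congr (_, _) => /=; ring.
Qed.

(** The unit translations and their inverses are combinations of a leg with
    powers of the rotation, which gives the words below. *)
Fact D4_gen g : exists s, (word (cexp 24) D4_leg s).2 = g.
Proof.
pose w s := map (fun i => nth (legi 4 0) [:: legi 4 0; legi 4 1; legi 4 2; legi 4 3] i) s.
apply: (reachable_all (@cexp1 _ _) (@cexpA _ _)).
- by exists (w [:: 2; 3]%N); apply/eqP; vm_compute.
- by exists (w [:: 3; 2]%N); apply/eqP; vm_compute.
- by exists (w [:: 0; 3]%N); apply/eqP; vm_compute.
- by exists (w [:: 3; 0]%N); apply/eqP; vm_compute.
- by exists (w [:: 3]%N); apply/eqP; vm_compute.
Qed.

(** Once the value of [mu] is known, the elements of the Weyl basis unfold by
    conversion to the products that appear in the lift. *)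
Fact D4_star_lift (H : groupType) (zeta : H) (t : 'I_(nlegs D4) -> H) :
    (forall x, commute x zeta) -> (forall k, t k ^+ leg_order k = 1)%g ->
    (\prod_k t k)%g = gz zeta 24 ->
    exists X Y rho, [/\ (X * Y = gz zeta (2 * 24)%R * (Y * X))%g,
      (rho ^+ 2 = 1)%g,
      (rho * X * rho^-1)%g = weyl zeta X Y 24 (linv (rmx D4_rot) e1),
      (rho * Y * rho^-1)%g = weyl zeta X Y 24 (linv (rmx D4_rot) e2) &
      forall k, t k = weyl_basis zeta X Y rho 24 (D4_leg k)].
Proof.
move=> zetaC tk; rewrite [LHS]prod4 => tp.
have [X [Y [XY rX rY [t0 t1 t2]]]] := D4_lift (fun n x => ZC zetaC n x) (gzD zeta)
  (tk (legi 4 0)) (tk (legi 4 1)) (tk (legi 4 2)) (tk (legi 4 3)) tp.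
exists X, Y, (t (legi 4 3)); split.
- exact: XY.
- exact: (tk (legi 4 3)).
- by rewrite rX -[RHS]/(1 * (X^-1 * 1))%g mul1g mulg1.
- by rewrite rY -[RHS]/(1 * (1 * Y^-1))%g !mul1g.
- apply: ord4P.
  + rewrite t0 /weyl_basis (_ : mu _ _ = 0); last by vm_compute.
    by rewrite -[RHS]/(1 * ((1 * (1 * Y)) * t (legi 4 3)))%g !mul1g.
  + rewrite t1 /weyl_basis (_ : mu _ _ = 0); last by vm_compute.
    rewrite -[RHS]/(1 * ((gz zeta (- 24)%R * (X * Y)) * t (legi 4 3)))%g XY.
    by rewrite mul1g [(gz zeta (- 24)%R * _)%g]mulgA -gzD.
  + rewrite t2 /weyl_basis (_ : mu _ _ = 0); last by vm_compute.
    by rewrite -[RHS]/(1 * ((1 * (X * 1)) * t (legi 4 3)))%g !mul1g mulg1.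
  + rewrite /weyl_basis (_ : mu _ _ = 0); last by vm_compute.
    by rewrite -[RHS]/(1 * ((1 * (1 * 1)) * t (legi 4 3)))%g !mul1g.
Qed.

(** The translation part of a rotation matters modulo the image of [1 - rot k]
    and up to rotation.  Here this image is the lattice of even vectors, whose
    four cosets are the classes. *)
Definition D4_class_number (k : nat) (v : vec) : nat :=
  (if k == 1 then 1 + resz 2 v.1 + 2 * resz 2 v.2 else 0)%N.

Lemma D4_class : class_function D4_rot 5.
Proof.
apply: (@class_builder D4_rot 4 D4_class_number (nth 0 [:: 0; 1; 1; 1; 1])%N).
- nonzero_index; move=> v _; rewrite /D4_class_number /resz /=; cls_lia.
- nonzero_index; move=> v _; rewrite /D4_class_number /resz; vec_simp; cls_lia.
- nonzero_index; move=> v w _; rewrite /D4_class_number /resz; vec_simp; cls_lia.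
- nonzero_index; move=> v _; rewrite /D4_class_number /=.
  by case: (resz2 v.1) => ->; case: (resz2 v.2) => ->.
- nonzero_index; move=> v v' _; rewrite /D4_class_number /resz /= => e.
  by conj_by 0%N ((v'.1 - v.1) %/ 2)%Z ((v'.2 - v.2) %/ 2)%Z.
- move=> [|[|[|[|[|n]]]]] //= _.
  + by exists (inZp 1), (0, 0).
  + by exists (inZp 1), (1, 0).
  + by exists (inZp 1), (0, 1).
  + by exists (inZp 1), (1, 1).
Qed.

Definition D4_model : star_model D4 :=
  @StarModel D4 D4_rot 24 D4_leg erefl D4_integral D4_sum
    D4_order D4_prod D4_gen D4_star_lift D4_class.

(** ** The diagram E6 *)

Fact E6_rordP (v : vec) : iter 3 (linv ((0, -1), (1, -1))) v = v.
Proof. by case: v => a b; rewrite /linv /=; congr (_, _); ring. Qed.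
Definition E6_rot : rotation := @Rotation 1 ((0, -1), (1, -1)) erefl E6_rordP.

Definition E6_leg (k : 'I_(nlegs E6)) : crystal E6_rot :=
  nth 1%g [:: @mkc E6_rot (0, -1) (inZp 1);
    @mkc E6_rot (1, 0) (inZp 1);
    @mkc E6_rot 0 (inZp 1)] k.

Fact E6_order k : word (cexp (- 36)) E6_leg (nseq (leg_order k) k) = (0, 1%g).
Proof. by move: k; apply: ord3P; apply/eqP; vm_compute. Qed.

Fact E6_prod : word (cexp (- 36)) E6_leg (index_enum 'I_(nlegs E6)) = (24, 1%g).
Proof. by rewrite [index_enum _]index_enum3; apply/eqP; vm_compute. Qed.

Fact E6_integral : integral_rotation E6_rot (- 36).
Proof. by nonzero_index; move=> _; split; vm_compute. Qed.

Fact E6_sum (v : vec) : \sum_(j < 3) rot E6_rot j v = 0.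
Proof.
rewrite !big_ord_recl big_ord0; case: v => a b; rewrite /rot /linv /=.
by congr (_, _) => /=; ring.
Qed.

Fact E6_gen g : exists s, (word (cexp (- 36)) E6_leg s).2 = g.
Proof.
pose w s := map (fun i => nth (legi 3 0) [:: legi 3 0; legi 3 1; legi 3 2] i) s.
apply: (reachable_all (@cexp1 _ _) (@cexpA _ _)).
- by exists (w [:: 1; 2; 2]%N); apply/eqP; vm_compute.
- by exists (w [:: 2; 1; 1]%N); apply/eqP; vm_compute.
- by exists (w [:: 2; 1; 2; 2; 2; 2]%N); apply/eqP; vm_compute.
- by exists (w [:: 2; 2; 1; 1; 2; 2]%N); apply/eqP; vm_compute.
- by exists (w [:: 2]%N); apply/eqP; vm_compute.
Qed.

Fact E6_star_lift (H : groupType) (zeta : H) (t : 'I_(nlegs E6) -> H) :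
    (forall x, commute x zeta) -> (forall k, t k ^+ leg_order k = 1)%g ->
    (\prod_k t k)%g = gz zeta 24 ->
    exists X Y rho, [/\ (X * Y = gz zeta (2 * (- 36))%R * (Y * X))%g,
      (rho ^+ 3 = 1)%g,
      (rho * X * rho^-1)%g = weyl zeta X Y (- 36) (linv (rmx E6_rot) e1),
      (rho * Y * rho^-1)%g = weyl zeta X Y (- 36) (linv (rmx E6_rot) e2) &
      forall k, t k = weyl_basis zeta X Y rho (- 36) (E6_leg k)].
Proof.
move=> zetaC tk; rewrite [LHS]prod3 => tp.
have [X [Y [XY rX rY t0 t1]]] := E6_lift (fun n x => ZC zetaC n x) (gzD zeta)
  (tk (legi 3 0)) (tk (legi 3 1)) (tk (legi 3 2)) tp.
exists X, Y, (t (legi 3 2)); split.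
- exact: XY.
- exact: (tk (legi 3 2)).
- by rewrite rX -[RHS]/(1 * (1 * Y))%g !mul1g.
- exact: rY.
- apply: ord3P.
  + rewrite t0 /weyl_basis (_ : mu _ _ = - 12); last by vm_compute.
    by rewrite -[RHS]/(gz zeta 12 * ((1 * (1 * Y^-1)) * t (legi 3 2)))%g !mul1g.
  + rewrite t1 /weyl_basis (_ : mu _ _ = - 12); last by vm_compute.
    by rewrite -[RHS]/(gz zeta 12 * ((1 * (X * 1)) * t (legi 3 2)))%g !mul1g mulg1.
  + rewrite /weyl_basis (_ : mu _ _ = 0); last by vm_compute.
    by rewrite -[RHS]/(1 * ((1 * (1 * 1)) * t (legi 3 2)))%g !mul1g.
Qed.

(** The image of [1 - rot k] has index three, and is the kernel of the sum of the
    coordinates modulo three. *)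
Definition E6_class_number (k : nat) (v : vec) : nat :=
  match k with
  | 1 => 1 + resz 3 (v.1 + v.2)
  | 2 => 4 + resz 3 (v.1 + v.2)
  | _ => 0
  end%N.

Lemma E6_class : class_function E6_rot 7.
Proof.
apply: (@class_builder E6_rot 6 E6_class_number (nth 0 [:: 0; 1; 1; 1; 2; 2; 2])%N).
- nonzero_index; move=> v _; rewrite /E6_class_number /resz /=; cls_lia.
- nonzero_index; move=> v _; rewrite /E6_class_number /resz; vec_simp; cls_lia.
- nonzero_index; move=> v w _; rewrite /E6_class_number /resz; vec_simp; cls_lia.
- by nonzero_index; move=> v _; rewrite /E6_class_number /=; case: (resz3 (v.1 + v.2)) => ->.
- nonzero_index; move=> v v' _; rewrite /E6_class_number /resz /= => e;
    pose s := ((v'.1 - v.1 + (v'.2 - v.2)) %/ 3)%Z.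
  + by conj_by 0%N (v'.1 - v.1 - s) s.
  + by conj_by 0%N s (v'.2 - v.2 - s).
- move=> [|[|[|[|[|[|[|n]]]]]]] //= _.
  + by exists (inZp 1), (0, 0).
  + by exists (inZp 1), (1, 0).
  + by exists (inZp 1), (1, 1).
  + by exists (inZp 2), (0, 0).
  + by exists (inZp 2), (1, 0).
  + by exists (inZp 2), (1, 1).
Qed.

Definition E6_model : star_model E6 :=
  @StarModel E6 E6_rot (- 36) E6_leg erefl E6_integral E6_sum
    E6_order E6_prod E6_gen E6_star_lift E6_class.

(** ** The diagram E7 *)

Fact E7_rordP (v : vec) : iter 4 (linv ((0, -1), (1, 0))) v = v.
Proof. by case: v => a b; rewrite /linv /=; congr (_, _); ring. Qed.
Definition E7_rot : rotation := @Rotation 2 ((0, -1), (1, 0)) erefl E7_rordP.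

Definition E7_leg (k : 'I_(nlegs E7)) : crystal E7_rot :=
  nth 1%g [:: @mkc E7_rot (1, 0) (inZp 2);
    @mkc E7_rot (1, 0) (inZp 1);
    @mkc E7_rot 0 (inZp 1)] k.

Fact E7_order k : word (cexp (- 48)) E7_leg (nseq (leg_order k) k) = (0, 1%g).
Proof. by move: k; apply: ord3P; apply/eqP; vm_compute. Qed.

Fact E7_prod : word (cexp (- 48)) E7_leg (index_enum 'I_(nlegs E7)) = (24, 1%g).
Proof. by rewrite [index_enum _]index_enum3; apply/eqP; vm_compute. Qed.

Fact E7_integral : integral_rotation E7_rot (- 48).
Proof. by nonzero_index; move=> _; split; vm_compute. Qed.

Fact E7_sum (v : vec) : \sum_(j < 4) rot E7_rot j v = 0.
Proof.
rewrite !big_ord_recl big_ord0; case: v => a b; rewrite /rot /linv /=.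
by congr (_, _) => /=; ring.
Qed.

Fact E7_gen g : exists s, (word (cexp (- 48)) E7_leg s).2 = g.
Proof.
pose w s := map (fun i => nth (legi 3 0) [:: legi 3 0; legi 3 1; legi 3 2] i) s.
apply: (reachable_all (@cexp1 _ _) (@cexpA _ _)).
- by exists (w [:: 1; 2; 2; 2]%N); apply/eqP; vm_compute.
- by exists (w [:: 2; 1; 1; 1]%N); apply/eqP; vm_compute.
- by exists (w [:: 2; 1; 2; 2; 2; 2; 2; 2]%N); apply/eqP; vm_compute.
- by exists (w [:: 2; 2; 1; 1; 1; 2; 2; 2]%N); apply/eqP; vm_compute.
- by exists (w [:: 2]%N); apply/eqP; vm_compute.
Qed.

Fact E7_star_lift (H : groupType) (zeta : H) (t : 'I_(nlegs E7) -> H) :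
    (forall x, commute x zeta) -> (forall k, t k ^+ leg_order k = 1)%g ->
    (\prod_k t k)%g = gz zeta 24 ->
    exists X Y rho, [/\ (X * Y = gz zeta (2 * (- 48))%R * (Y * X))%g,
      (rho ^+ 4 = 1)%g,
      (rho * X * rho^-1)%g = weyl zeta X Y (- 48) (linv (rmx E7_rot) e1),
      (rho * Y * rho^-1)%g = weyl zeta X Y (- 48) (linv (rmx E7_rot) e2) &
      forall k, t k = weyl_basis zeta X Y rho (- 48) (E7_leg k)].
Proof.
move=> zetaC tk; rewrite [LHS]prod3 => tp.
have [X [Y [XY rX rY t0 t1]]] := E7_lift (fun n x => ZC zetaC n x) (gzD zeta)
  (tk (legi 3 0)) (tk (legi 3 1)) (tk (legi 3 2)) tp.
exists X, Y, (t (legi 3 2)); split.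
- exact: XY.
- exact: (tk (legi 3 2)).
- by rewrite rX -[RHS]/(1 * (1 * Y))%g !mul1g.
- by rewrite rY -[RHS]/(1 * (X^-1 * 1))%g mul1g mulg1.
- apply: ord3P.
  + rewrite t0 /weyl_basis (_ : mu _ _ = 0); last by vm_compute.
    by rewrite -[RHS]/(1 * ((1 * (X * 1)) * t (legi 3 2) ^+ 2))%g !mul1g mulg1.
  + rewrite t1 /weyl_basis (_ : mu _ _ = - 24); last by vm_compute.
    by rewrite -[RHS]/(gz zeta 24 * ((1 * (X * 1)) * t (legi 3 2)))%g !mul1g mulg1.
  + rewrite /weyl_basis (_ : mu _ _ = 0); last by vm_compute.
    by rewrite -[RHS]/(1 * ((1 * (1 * 1)) * t (legi 3 2)))%g !mul1g.
Qed.

(** For a quarter turn the image of [1 - rot k] has index two.  For the half turn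
    it consists of the even vectors, and the cosets of the two unit vectors
    form a single class, being exchanged by the quarter turn. *)
Definition E7_class_number (k : nat) (v : vec) : nat :=
  match k with
  | 1 => 1 + resz 2 (v.1 + v.2)
  | 2 => if resz 2 (v.1 + v.2) == 0 then 5 + resz 2 v.1 else 7
  | 3 => 3 + resz 2 (v.1 + v.2)
  | _ => 0
  end%N.

Lemma E7_class : class_function E7_rot 8.
Proof.
apply: (@class_builder E7_rot 7 E7_class_number (nth 0 [:: 0; 1; 1; 3; 3; 2; 2; 2])%N).
- nonzero_index; move=> v _; rewrite /E7_class_number /resz /=; cls_lia.
- nonzero_index; move=> v _; rewrite /E7_class_number /resz; vec_simp; cls_lia.
- nonzero_index; move=> v w _; rewrite /E7_class_number /resz; vec_simp; cls_lia.
- nonzero_index; move=> v _; rewrite /E7_class_number /=; try case: ifP => // _.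
  + by case: (resz2 (v.1 + v.2)) => ->.
  + by case: (resz2 v.1) => ->.
  + by case: (resz2 (v.1 + v.2)) => ->.
- nonzero_index; move=> v v' _; rewrite /E7_class_number /resz /=.
  + move=> e; pose s := ((v'.1 - v.1 + (v'.2 - v.2)) %/ 2)%Z.
    by conj_by 0%N (v'.1 - v.1 - s) s.
  + case: ifP => c1; case: ifP => c2 e; try (exfalso; lia);
      (have [j0|j1] := eqVneq `|(v.1 %% 2)%Z|%N `|(v'.1 %% 2)%Z|%N);
      try (exfalso; lia).
    * by conj_by 0%N ((v'.1 - v.1) %/ 2)%Z ((v'.2 - v.2) %/ 2)%Z.
    * by conj_by 0%N ((v'.1 - v.1) %/ 2)%Z ((v'.2 - v.2) %/ 2)%Z.
    * by conj_by 1%N ((v'.1 + v.2) %/ 2)%Z ((v'.2 - v.1) %/ 2)%Z.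
  + move=> e; pose s := ((v'.1 - v.1 + (v'.2 - v.2)) %/ 2)%Z.
    by conj_by 0%N s (v'.2 - v.2 - s).
- move=> [|[|[|[|[|[|[|[|n]]]]]]]] //= _.
  + by exists (inZp 1), (0, 0).
  + by exists (inZp 1), (1, 0).
  + by exists (inZp 3), (0, 0).
  + by exists (inZp 3), (1, 0).
  + by exists (inZp 2), (0, 0).
  + by exists (inZp 2), (1, 1).
  + by exists (inZp 2), (1, 0).
Qed.

Definition E7_model : star_model E7 :=
  @StarModel E7 E7_rot (- 48) E7_leg erefl E7_integral E7_sum
    E7_order E7_prod E7_gen E7_star_lift E7_class.

(** ** The diagram E8 *)

Fact E8_rordP (v : vec) : iter 6 (linv ((0, -1), (1, 1))) v = v.
Proof. by case: v => a b; rewrite /linv /=; congr (_, _); ring. Qed.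
Definition E8_rot : rotation := @Rotation 4 ((0, -1), (1, 1)) erefl E8_rordP.

Definition E8_leg (k : 'I_(nlegs E8)) : crystal E8_rot :=
  nth 1%g [:: @mkc E8_rot (1, 0) (inZp 3);
    @mkc E8_rot (1, 0) (inZp 2);
    @mkc E8_rot 0 (inZp 1)] k.

Fact E8_order k : word (cexp (- 72)) E8_leg (nseq (leg_order k) k) = (0, 1%g).
Proof. by move: k; apply: ord3P; apply/eqP; vm_compute. Qed.

Fact E8_prod : word (cexp (- 72)) E8_leg (index_enum 'I_(nlegs E8)) = (24, 1%g).
Proof. by rewrite [index_enum _]index_enum3; apply/eqP; vm_compute. Qed.

Fact E8_integral : integral_rotation E8_rot (- 72).
Proof. by nonzero_index; move=> _; split; vm_compute. Qed.

Fact E8_sum (v : vec) : \sum_(j < 6) rot E8_rot j v = 0.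
Proof.
rewrite !big_ord_recl big_ord0; case: v => a b; rewrite /rot /linv /=.
by congr (_, _) => /=; ring.
Qed.

Fact E8_gen g : exists s, (word (cexp (- 72)) E8_leg s).2 = g.
Proof.
pose w s := map (fun i => nth (legi 3 0) [:: legi 3 0; legi 3 1; legi 3 2] i) s.
apply: (reachable_all (@cexp1 _ _) (@cexpA _ _)).
- by exists (w [:: 1; 2; 2; 2; 2]%N); apply/eqP; vm_compute.
- by exists (w [:: 2; 2; 1; 1]%N); apply/eqP; vm_compute.
- by exists (w [:: 2; 1; 2; 2; 2; 2; 2; 2; 2; 2; 2]%N); apply/eqP; vm_compute.
- by exists (w [:: 2; 2; 2; 1; 1; 2; 2; 2; 2; 2]%N); apply/eqP; vm_compute.
- by exists (w [:: 2]%N); apply/eqP; vm_compute.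
Qed.

Fact E8_star_lift (H : groupType) (zeta : H) (t : 'I_(nlegs E8) -> H) :
    (forall x, commute x zeta) -> (forall k, t k ^+ leg_order k = 1)%g ->
    (\prod_k t k)%g = gz zeta 24 ->
    exists X Y rho, [/\ (X * Y = gz zeta (2 * (- 72))%R * (Y * X))%g,
      (rho ^+ 6 = 1)%g,
      (rho * X * rho^-1)%g = weyl zeta X Y (- 72) (linv (rmx E8_rot) e1),
      (rho * Y * rho^-1)%g = weyl zeta X Y (- 72) (linv (rmx E8_rot) e2) &
      forall k, t k = weyl_basis zeta X Y rho (- 72) (E8_leg k)].
Proof.
move=> zetaC tk; rewrite [LHS]prod3 => tp.
have [X [Y [XY rX rY t0 t1]]] := E8_lift (fun n x => ZC zetaC n x) (gzD zeta)
  (tk (legi 3 0)) (tk (legi 3 1)) (tk (legi 3 2)) tp.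
exists X, Y, (t (legi 3 2)); split.
- exact: XY.
- exact: (tk (legi 3 2)).
- by rewrite rX -[RHS]/(1 * (1 * Y))%g !mul1g.
- exact: rY.
- apply: ord3P.
  + rewrite t0 /weyl_basis (_ : mu _ _ = 0); last by vm_compute.
    by rewrite -[RHS]/(1 * ((1 * (X * 1)) * t (legi 3 2) ^+ 3))%g !mul1g mulg1.
  + rewrite t1 /weyl_basis (_ : mu _ _ = - 24); last by vm_compute.
    by rewrite -[RHS]/(gz zeta 24 * ((1 * (X * 1)) * t (legi 3 2) ^+ 2))%g !mul1g mulg1.
  + rewrite /weyl_basis (_ : mu _ _ = 0); last by vm_compute.
    by rewrite -[RHS]/(1 * ((1 * (1 * 1)) * t (legi 3 2)))%g !mul1g.
Qed.

(** The image of [1 - rot k] is everything when [k] is 1 or 5, it has index three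
    when [k] is 2 or 4, and it consists of the even vectors when [k] is 3.  The
    rotation of order six permutes its nonzero cosets transitively. *)
Definition E8_class_number (k : nat) (v : vec) : nat :=
  match k with
  | 1 => 1
  | 2 => if resz 3 (v.1 - v.2) == 0 then 3 else 4
  | 3 => if resz 2 v.1 + resz 2 v.2 == 0 then 7 else 8
  | 4 => if resz 3 (v.1 - v.2) == 0 then 5 else 6
  | 5 => 2
  | _ => 0
  end%N.

Lemma E8_class : class_function E8_rot 9.
Proof.
apply: (@class_builder E8_rot 8 E8_class_number (nth 0 [:: 0; 1; 5; 2; 2; 4; 4; 3; 3])%N).
- nonzero_index; move=> v _; rewrite /E8_class_number /resz /=; cls_lia.
- nonzero_index; move=> v _; rewrite /E8_class_number /resz; vec_simp; cls_lia.
- nonzero_index; move=> v w _; rewrite /E8_class_number /resz; vec_simp; cls_lia.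
- by nonzero_index; move=> v _; rewrite /E8_class_number /=; try case: ifP.
- nonzero_index; move=> v v' _; rewrite /E8_class_number /resz /=.
  + by move=> _; conj_by 0%N (v.2 - v'.2) (v'.1 - v.1 + (v'.2 - v.2)).
  + case: ifP => c1; case: ifP => c2 e; try (exfalso; lia);
      (have [j0|j1] : ((v'.1 - v'.2 - (v.1 - v.2)) %% 3)%Z = 0
         \/ ((v'.1 - v'.2 + (v.1 - v.2)) %% 3)%Z = 0 by lia); try (exfalso; lia);
      first
        [ have [s es] : exists s, v'.1 - v.1 - (v'.2 - v.2) = 3 * s
            by exists ((v'.1 - v.1 - (v'.2 - v.2)) %/ 3)%Z; lia
        | have [s es] : exists s, v'.1 + v.2 - (v'.2 - v.1 - v.2) = 3 * s
            by exists ((v'.1 + v.2 - (v'.2 - v.1 - v.2)) %/ 3)%Z; lia ];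
      first [ by conj_by 0%N s (v'.2 - v.2 + s) | by conj_by 1%N s (v'.2 - v.1 - v.2 + s) ].
  + case: ifP => c1; case: ifP => c2 e; try (exfalso; lia).
      by conj_by 0%N ((v'.1 - v.1) %/ 2)%Z ((v'.2 - v.2) %/ 2)%Z.
    have [j|[j|j]] : ((v'.1 - v.1) %% 2 = 0 /\ (v'.2 - v.2) %% 2 = 0)%Z
       \/ ((v'.1 + v.2) %% 2 = 0 /\ (v'.2 - v.1 - v.2) %% 2 = 0)%Z
       \/ ((v'.1 + v.1 + v.2) %% 2 = 0 /\ (v'.2 - v.1) %% 2 = 0)%Z by lia.
    * by conj_by 0%N ((v'.1 - v.1) %/ 2)%Z ((v'.2 - v.2) %/ 2)%Z.
    * by conj_by 1%N ((v'.1 + v.2) %/ 2)%Z ((v'.2 - v.1 - v.2) %/ 2)%Z.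
    * by conj_by 2%N ((v'.1 + v.1 + v.2) %/ 2)%Z ((v'.2 - v.1) %/ 2)%Z.
  + case: ifP => c1; case: ifP => c2 e; try (exfalso; lia);
      (have [j0|j1] : ((v'.1 - v'.2 - (v.1 - v.2)) %% 3)%Z = 0
         \/ ((v'.1 - v'.2 + (v.1 - v.2)) %% 3)%Z = 0 by lia); try (exfalso; lia);
      first
        [ have [s es] : exists s, v'.2 - v.2 - (v'.1 - v.1) = 3 * s
            by exists ((v'.2 - v.2 - (v'.1 - v.1)) %/ 3)%Z; lia
        | have [s es] : exists s, v'.2 - v.1 - v.2 - (v'.1 + v.2) = 3 * s
            by exists ((v'.2 - v.1 - v.2 - (v'.1 + v.2)) %/ 3)%Z; lia ];
      first [ by conj_by 0%N (v'.1 - v.1 + s) s | by conj_by 1%N (v'.1 + v.2 + s) s ].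
  + by move=> _; conj_by 0%N (v'.1 - v.1 + (v'.2 - v.2)) (v.1 - v'.1).
- move=> [|[|[|[|[|[|[|[|[|n]]]]]]]]] //= _.
  + by exists (inZp 1), (0, 0).
  + by exists (inZp 5), (0, 0).
  + by exists (inZp 2), (0, 0).
  + by exists (inZp 2), (1, 0).
  + by exists (inZp 4), (0, 0).
  + by exists (inZp 4), (1, 0).
  + by exists (inZp 3), (0, 0).
  + by exists (inZp 3), (1, 0).
Qed.

Definition E8_model : star_model E8 :=
  @StarModel E8 E8_rot (- 72) E8_leg erefl E8_integral E8_sum
    E8_order E8_prod E8_gen E8_star_lift E8_class.

Theorem theorem3p1 (R : realType) (D : diagram) (q : R[i]) (q_neq0 : q != 0)
    (q_not_root_of_unity : forall n : nat, (0 < n)%N -> q ^+ n != 1) :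
  [/\ lmod_iso (HH (B D q) 0) (R[i]^o),
      forall x : HH (B D q) 1, x = 0,
      lmod_iso (HH (B D q) 2) 'rV[R[i]]_(dynkin_rank D).+1
    & forall i : nat, (2 < i)%N -> forall x : HH (B D q) i, x = 0].
Proof.
have zq : (Num.Theory.nthroot 24 q) ^+ 24 = q by exact: Num.Theory.rootCK.
have char0 n : n.+1%:R != 0 :> R[i] by rewrite Num.Theory.pnatr_eq0.
case: D.
- exact: (star_cohomology D4_model zq q_neq0 q_not_root_of_unity char0).
- exact: (star_cohomology E6_model zq q_neq0 q_not_root_of_unity char0).
- exact: (star_cohomology E7_model zq q_neq0 q_not_root_of_unity char0).
- exact: (star_cohomology E8_model zq q_neq0 q_not_root_of_unity char0).
Qed.
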